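(* Let $\phi:\mathbb{R}^d\to\mathbb{R}$ be continuous and symmetric ($\phi(-x)=\phi(x)$ for all $x$), with $|\phi|_\infty:=\sup_{x\in[0,1]^d}\sum_{k\in\mathbb{Z}^d}|\phi(x-k)|<\infty$ and with cardinal symbol satisfying $\sigma_\phi(\zeta)>0$ for all $\zeta\in T^d$. Let $H$ be a half-space lattice, and let $\chi_j$, $j\in H$, be the Lagrange functions for semi-cardinal interpolation on $H$ with $\phi$. (i) (Algebraic decay.) If there exist $\alpha>d$ and $C_0>0$ such that $|\phi(x)|\le C_0(1+\|x\|)^{-\alpha}$ for all $x\in\mathbb{R}^d$, then there exists a constant $C_3=C_3(\alpha,d,\phi)$ such that $$|\chi_j(x)|\le C_3(1+\|x-j\|)^{-\alpha},\quad x\in\mathbb{R}^d,\ j\in H.$$ (ii) (Exponential decay.) If there exist $\alpha>0$ and $C_0>0$ such that $|\phi(x)|\le C_0e^{-\alpha|x|}$ for all $x\in\mathbb{R}^d$, and $\beta\in(0,\alpha)$ is a rate of decay of the Fourier coefficients $\{\gamma_k\}_{k\in H}$ of the Wiener-Hopf factor $\omega_+$, in the sense that $|\gamma_k|\le C_1e^{-\beta|k|}$ for all $k\in H$ and some constant $C_1=C_1(\beta,\phi,H,d)$, then for each $\beta'\in(0,\beta)$ there exists a constant $C_3=C_3(\beta,\beta',\phi,H,d)$ such that $$|\chi_j(x)|\le C_3e^{-\beta'|x-j|},\quad x\in\mathbb{R}^d,\ j\in H.$$ Further, if $H=\mathbb{Z}^{d-1}\times\mathbb{Z}_+$, the exponential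 in the last inequality can be replaced by $e^{-\beta'|x'-j'|-\beta|x_d-j_d|}$.
   Context: Notation: $\|x\|=(x_1^2+\cdots+x_d^2)^{1/2}$ is the Euclidean norm and $|x|=|x_1|+\cdots+|x_d|$ the $1$-norm on $\mathbb{R}^d$ (the same notation $|\cdot|$ for the $1$-norm on $\mathbb{R}^{d-1}$); write $x=(x',x_d)$ with $x'\in\mathbb{R}^{d-1}$. $T^d=\{\zeta\in\mathbb{C}^d:|\zeta_1|=\dots=|\zeta_d|=1\}$, $\zeta^k=\zeta_1^{k_1}\cdots\zeta_d^{k_d}$ for $k\in\mathbb{Z}^d$, $\zeta^{-1}=(\zeta_1^{-1},\dots,\zeta_d^{-1})$. $W=W(T^d)$ is the Wiener algebra of continuous functions $u$ on $T^d$ with absolutely summable Fourier coefficients $\{\widehat u_k\}_{k\in\mathbb{Z}^d}$, $\|u\|_W=\sum_k|\widehat u_k|$. $\mathbb{Z}_+=\{0,1,2,\dots\}$. Half-space lattice: a set $H\subset\mathbb{Z}^d$ that is either $H=\mathbb{Z}^{d-1}\times\mathbb{Z}_+$, or $H=\mathbb{Z}^d_{\preceq,+}:=\{j\in\mathbb{Z}^d:0\preceq j\}$, where $\preceq$ is a linear (total) order on $\mathbb{Z}^d$ compatible with addition ($j\preceq k$ implies $j+l\preceq k+l$). Cardinal symbol: $\sigma_\phi(\zeta)=\sum_{k\in\mathbb{Z}^d}\phi(k)\zeta^k$, $\zeta\in T^d$. Under the stated assumptions on $\phi$, $\omega:=1/\sigma_\phi\in W$ and $\log\omega\in W$; write $\log\omega(\zeta)=\sum_{k\in\mathbb{Z}^d}\lambda_k\zeta^k$.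 Wiener-Hopf factor: if $H=\mathbb{Z}^{d-1}\times\mathbb{Z}_+$, let $\Lambda_+(\zeta)=\frac12\sum_{k'\in\mathbb{Z}^{d-1}}\lambda_{(k',0)}(\zeta')^{k'}+\sum_{k_d=1}^\infty\sum_{k'\in\mathbb{Z}^{d-1}}\lambda_k\zeta^k$; if $H=\mathbb{Z}^d_{\preceq,+}$, let $\Lambda_+(\zeta)=\frac12\lambda_0+\sum_{k\succ0}\lambda_k\zeta^k$. Set $\omega_+=\exp(\Lambda_+)$. Then $\omega(\zeta)=\omega_+(\zeta)\omega_+(\zeta^{-1})$, $\omega_+\in W$, and its Fourier coefficients are supported on $H$: $\omega_+(\zeta)=\sum_{k\in H}\gamma_k\zeta^k$. Semi-cardinal symbols: let $P_+\{\sum_{k\in\mathbb{Z}^d}\widehat\psi_k\zeta^k\}=\sum_{k\in H}\widehat\psi_k\zeta^k$ for $\psi\in W$. For $j\in H$, $\omega_j(\zeta):=\omega_+(\zeta)\,P_+\{\zeta^j\omega_+(\zeta^{-1})\}$, which lies in $W$ with Fourier coefficients supported on $H$: $\omega_j(\zeta)=\sum_{k\in H}a_{k,j}\zeta^k$. Lagrange functions for semi-cardinal interpolation on $H$: $\chi_j(x)=\sum_{k\in H}a_{k,j}\phi(x-k)$, $x\in\mathbb{R}^d$, $j\in H$; they satisfy $\chi_j(l)=\delta_{j,l}$ for $l\in H$. *)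

(* Defs.v *)
From mathcomp Require Import all_boot all_order all_algebra.
From mathcomp Require Import all_classical all_reals all_analysis.
From mathcomp Require Export complex.

Set Implicit Arguments.
Unset Strict Implicit.
Unset Printing Implicit Defensive.

Import Order.TTheory GRing.Theory Num.Theory.
Import numFieldNormedType.Exports.

Local Open Scope classical_set_scope.
Local Open Scope ring_scope.

(* The dimension is d = n.+1 wherever the last coordinate x_d is singled out;
   it is the one of index ord_max. *)

Section Norms.
Context {R : realType}.

Definition eucl_norm d (x : 'rV[R]_d) : R := Num.sqrt (\sum_i x 0 i ^+ 2).

Definition l1_norm d (x : 'rV[R]_d) : R := \sum_i `|x 0 i|.

(* |x'| for x = (x', x_d) *)
Definition l1_norm_init n (x : 'rV[R]_n.+1) : R :=
  \sum_(i | i != ord_max) `|x 0 i|.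

Definition lat d (k : 'rV[int]_d) : 'rV[R]_d := map_mx intr k.

End Norms.

Section Sums.
Context {R : realType} {T : choiceType}.

(* Unordered sums of absolutely summable families; the value carries no
   meaning for other families. *)
Definition rsum (D : set T) (f : T -> R) : R :=
  fine (\esum_(k in D) ((EFin \o f)^\+ k) - \esum_(k in D) ((EFin \o f)^\- k))%E.

Definition csum (D : set T) (f : T -> R[i]) : R[i] :=
  (rsum D (fun k => complex.Re (f k)) +i* rsum D (fun k => complex.Im (f k)))%C.

End Sums.

Section Torus.
Context {R : realType}.

Definition torus d : set 'rV[R[i]]_d := [set z | forall i, `|z 0 i| = 1].

Definition monom d (z : 'rV[R[i]]_d) (k : 'rV[int]_d) : R[i] :=
  \prod_i z 0 i ^ k 0 i.

Definition inv_pt d (z : 'rV[R[i]]_d) : 'rV[R[i]]_d := \row_i (z 0 i)^-1.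

Definition cexp (z : R[i]) : R[i] :=
  (expR (complex.Re z) * cos (complex.Im z) +i* (expR (complex.Re z) * sin (complex.Im z)))%C.

Definition torus_pt d (t : 'rV[R]_d) : 'rV[R[i]]_d :=
  \row_i cexp (0 +i* (2 * pi * t 0 i))%C.

(* Lebesgue integral over [0,1]^d, as an iterated integral; it is only applied
   to integrands that are continuous under the hypotheses on phi. *)
Fixpoint cube_integral d : ('rV[R]_d -> R) -> R :=
  match d return ('rV[R]_d -> R) -> R with
  | 0 => fun f => f 0
  | d'.+1 => fun f =>
      \int[lebesgue_measure]_(t in `[0, 1])
        cube_integral (fun s : 'rV[R]_d' => f (row_mx t%:M s))
  end.

(* k-th Fourier coefficient of u : T^d -> C *)
Definition fourier d (u : 'rV[R[i]]_d -> R[i]) (k : 'rV[int]_d) : R[i] :=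
  let g (t : 'rV[R]_d) := u (torus_pt t) * monom (torus_pt t) (- k) in
  (cube_integral (fun t => complex.Re (g t)) +i* cube_integral (fun t => complex.Im (g t)))%C.

End Torus.

Record add_order d := AddOrder {
  ole :> rel 'rV[int]_d;
  ole_refl : reflexive ole;
  ole_anti : antisymmetric ole;
  ole_trans : transitive ole;
  ole_total : total ole;
  ole_add : forall j k l, ole j k -> ole (j + l) (k + l)
}.

Inductive half_space n :=
  | SliceHalf
  | OrderHalf of add_order n.+1.

Arguments SliceHalf {n}.

(* Z^{d-1} x Z_+; for d = 1 it is also the lattice of the usual order. *)
Definition slice_lattice n : set 'rV[int]_n.+1 := [set k | 0 <= k 0 ord_max].

Definition half_lattice n (H : half_space n) : set 'rV[int]_n.+1 :=
  match H with
  | SliceHalf => @slice_lattice n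
  | OrderHalf le => [set j | le 0 j]
  end.

Section SemiCardinal.
Context {R : realType} {n : nat}.
Implicit Types (phi : 'rV[R]_n.+1 -> R) (H : half_space n)
  (z : 'rV[R[i]]_n.+1) (j k : 'rV[int]_n.+1) (x : 'rV[R]_n.+1).

(* |phi|_oo *)
Definition cube_norm phi : \bar R :=
  ereal_sup [set \esum_(k in [set: 'rV[int]_n.+1]) (`|phi (x - lat k)|)%:E
            | x in [set x : 'rV[R]_n.+1 | forall i, 0 <= x 0 i <= 1]].

Definition cardinal_symbol phi z : R[i] :=
  csum setT (fun k => (phi (lat k))%:C%C * monom z k).

Definition omega phi z : R[i] := (cardinal_symbol phi z)^-1.

(* omega is positive real on the torus, where this is its real logarithm. *)
Definition log_omega phi z : R[i] := (ln (complex.Re (omega phi z)))%:C%C.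

Definition log_coef phi k : R[i] := fourier (log_omega phi) k.

Definition Lambda_plus H phi z : R[i] :=
  let term k : R[i] := log_coef phi k * monom z k in
  match H with
  | SliceHalf => 2^-1 * csum [set k : 'rV[int]_n.+1 | k 0 ord_max = 0] term
                 + csum [set k : 'rV[int]_n.+1 | 0 < k 0 ord_max] term
  | OrderHalf le => 2^-1 * log_coef phi 0 + csum [set k : 'rV[int]_n.+1 | le 0 k /\ k <> 0] term
  end.

Definition omega_plus H phi z : R[i] := cexp (Lambda_plus H phi z).

Definition wh_coef H phi k : R[i] := fourier (omega_plus H phi) k.

Definition P_plus H (psi : 'rV[R[i]]_n.+1 -> R[i]) z : R[i] :=
  csum (half_lattice H) (fun k => fourier psi k * monom z k).

Definition semi_symbol H phi j z : R[i] :=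
  omega_plus H phi z *
  P_plus H (fun w => monom w j * omega_plus H phi (inv_pt w)) z.

(* a_{k,j} *)
Definition semi_coef H phi k j : R[i] := fourier (semi_symbol H phi j) k.

(* The Lagrange function chi_j. It is kept complex-valued, as the semi_coef are
   Fourier coefficients. *)
Definition chi H phi j x : R[i] :=
  csum (half_lattice H) (fun k => semi_coef H phi k j * (phi (x - lat k))%:C%C).

End SemiCardinal.

(* The modulus in R of a complex number (`|z| itself lives in R[i]). *)
Definition cmod {R : realType} (z : R[i]) : R := ComplexField.Normc.normc z.

(* Main.v *)
Require Import Defs.
From mathcomp Require Import all_boot all_order all_algebra.
From mathcomp Require Import all_classical all_reals all_analysis.
From mathcomp Require Import ring lra zify.

Set Implicit Arguments.
Unset Strict Implicit.
Unset Printing Implicit Defensive.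

Import Order.TTheory GRing.Theory Num.Theory.
Import numFieldNormedType.Exports.

Local Open Scope classical_set_scope.
Local Open Scope ring_scope.

Local Notation Re := complex.Re.
Local Notation Im := complex.Im.

(** Only the decay of the coefficients of log omega is needed, never the
    factorization of omega itself. Let w(k) = (1 + |k|)^(-alpha), alpha > d.
    Since 1 + |k| <= 2 max(1 + |l|, 1 + |k - l|), coefficient families of size
    O(w) form an algebra: if |f_k| <= A w(k) and |g_k| <= B w(k), then
    |(fg)_k| <= C w(k) (A |g|_1 + B |f|_1), where |.|_1 is the Wiener norm.

    Scale the symbol so that sigma = M (1 - u) with 0 <= u <= rho < 1 on the
    torus. Approximating u in the Wiener norm by a trigonometric polynomial p,
    the coefficients of p^i are bounded by its sup norm and live in a ball of
    radius O(i), so the Wiener norm of u^m is O(r^m) for some r < 1. The bound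
    above, applied to u^m = u^(m/2) u^(m - m/2), upgrades this to
    |(u^m)_k| = O(s^m w(k)) with s < 1. Summing -log(1 - u) = sum u^m / m shows
    that log omega has coefficients O(w); cutting to the half-space and
    exponentiating preserve this, uniformly in H.

    Finally a_{k,j} = sum_{l in H} gamma_{k-l} gamma_{j-l}, and the bounds on
    gamma and phi propagate to chi_j through sums over the lattice. In the
    exponential case on Z^{d-1} x Z_+, the support of gamma forces
    l_d <= min(k_d, j_d), which is why no rate is lost in the last coordinate. *)

(** * Moduli and unordered sums *)

(** The weighted bounds form an algebra only up to the constant [wK], so submultiplicativity alone
    loses a fixed factor with every product and does not show that u^m decays. The remedy is the
    asymmetry of the product estimate: each of its terms contains one weighted bound and one plain
    Wiener norm. For large m the Wiener norms of the two halves of u^m are small enough to absorb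
    [wK], and a single weighted constant serves all powers. The exponential needs no such care,
    since the factorials absorb any geometric growth.

    In part (i) the constant must not depend on H. Restriction to a half-space and the factor 1/2 on
    its boundary do not increase moduli, and the bound for an exponential depends only on the bound
    for its argument; this is why log omega is estimated before H enters.

    In part (ii) the decay of gamma is a hypothesis, and the algebraic theory supplies the
    absolutely convergent series and the support of gamma. Each lattice sum is paid for by a gap
    between two rates: the sum over l by beta - beta', the sum over k in chi_j by alpha - beta. *)

Section ComplexModulus.
Context {R : realType}.
Implicit Types z w : R[i].

Lemma cmodE z : cmod z = Num.sqrt (Re z ^+ 2 + Im z ^+ 2).
Proof. by case: z. Qed.

Lemma cmod_ge0 z : 0 <= cmod z.
Proof. by rewrite cmodE sqrtr_ge0. Qed.

Lemma cmod0 : cmod 0 = 0 :> R.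
Proof. exact: ComplexField.Normc.normc0. Qed.

Lemma cmod1 : cmod 1 = 1 :> R.
Proof. exact: ComplexField.Normc.normc1. Qed.

Lemma cmodM z w : cmod (z * w) = cmod z * cmod w.
Proof. exact: ComplexField.Normc.normcM. Qed.

Lemma cmodX z n : cmod (z ^+ n) = cmod z ^+ n.
Proof.
by elim: n => [|n IH]; rewrite ?expr0 ?cmod1// !exprS cmodM IH.
Qed.

Lemma cmodV z : cmod z^-1 = (cmod z)^-1.
Proof. exact: ComplexField.Normc.normcV. Qed.

Lemma cmod_eq0 z : cmod z = 0 -> z = 0.
Proof. exact: ComplexField.Normc.eq0_normc. Qed.

Lemma ler_cmodD z w : cmod (z + w) <= cmod z + cmod w.
Proof. exact: le_normcD. Qed.

Lemma cmodN z : cmod (- z) = cmod z.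
Proof. exact: normcN. Qed.

Lemma norm_cmod z : `|z| = (cmod z)%:C%C.
Proof. by case: z. Qed.

Lemma cmodR (x : R) : cmod x%:C%C = `|x|.
Proof. by rewrite cmodE /= expr0n addr0 sqrtr_sqr. Qed.

Lemma ler_Re_cmod z : `|Re z| <= cmod z.
Proof. by rewrite cmodE -sqrtr_sqr ler_wsqrtr// lerDl sqr_ge0. Qed.

Lemma ler_Im_cmod z : `|Im z| <= cmod z.
Proof. by rewrite cmodE -sqrtr_sqr ler_wsqrtr// lerDr sqr_ge0. Qed.

Lemma ler_cmod_ReIm z : cmod z <= `|Re z| + `|Im z|.
Proof.
rewrite -ler_sqr ?nnegrE ?addr_ge0 ?cmod_ge0// cmodE sqr_sqrtr ?addr_ge0 ?sqr_ge0//.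
have := mulr_ge0 (normr_ge0 (Re z)) (normr_ge0 (Im z)).
have := real_normK (num_real (Re z)); have := real_normK (num_real (Im z)); nra.
Qed.

Lemma cmul_conj z : (z * conjc z = (cmod z ^+ 2)%:C)%C.
Proof.
rewrite cmodE sqr_sqrtr ?addr_ge0 ?sqr_ge0//; case: z => a b /=.
by apply/eqP; rewrite eq_complex/=; apply/andP; split; apply/eqP; ring.
Qed.

Lemma cmodJ z : cmod (conjc z) = cmod z.
Proof. by rewrite !cmodE; case: z => a b /=; rewrite sqrrN. Qed.

Lemma cReD z w : Re (z + w) = Re z + Re w.
Proof. by case: z w => ? ? [? ?]. Qed.
Lemma cImD z w : Im (z + w) = Im z + Im w.
Proof. by case: z w => ? ? [? ?]. Qed.
Lemma cReN z : Re (- z) = - Re z.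
Proof. by case: z. Qed.
Lemma cImN z : Im (- z) = - Im z.
Proof. by case: z. Qed.
Lemma cReM z w : Re (z * w) = Re z * Re w - Im z * Im w.
Proof. by case: z w => ? ? [? ?]. Qed.
Lemma cImM z w : Im (z * w) = Re z * Im w + Im z * Re w.
Proof. by case: z w => ? ? [? ?]. Qed.
Lemma complex_eqP z w : Re z = Re w -> Im z = Im w -> z = w.
Proof. by case: z w => ? ? [? ?] /= -> ->. Qed.

End ComplexModulus.

(** * Sums of nonnegative families, with values in the extended reals *)

Section Nsum.
Context {R : realType}.
Implicit Types T : choiceType.

Definition nsum T (g : T -> R) : \bar R := \esum_(k in [set: T]) (g k)%:E.

Lemma nsum_ge0 T (g : T -> R) : (forall k, 0 <= g k) -> (0 <= nsum g)%E.
Proof. by move=> g0; apply: esum_ge0 => k _; rewrite lee_fin. Qed.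

Lemma nsum_fin T (g : T -> R) : (forall k, 0 <= g k) -> (nsum g < +oo)%E ->
  nsum g \is a fin_num.
Proof. by move=> /nsum_ge0 ? ?; rewrite ge0_fin_numE. Qed.

Lemma nsumE T (g : T -> R) : (forall k, 0 <= g k) -> (nsum g < +oo)%E ->
  nsum g = (fine (nsum g))%:E.
Proof. by move=> g0 goo; rewrite fineK// nsum_fin. Qed.

Lemma le_nsum T (f g : T -> R) : (forall k, f k <= g k) -> (nsum f <= nsum g)%E.
Proof. by move=> fg; apply: le_esum => k _; rewrite lee_fin. Qed.

Lemma eq_nsum T (f g : T -> R) : f =1 g -> nsum f = nsum g.
Proof. by move=> fg; apply: eq_esum => k _; rewrite fg. Qed.

Lemma le_nsum_fin T (f g : T -> R) : (forall k, f k <= g k) ->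
  (nsum g < +oo)%E -> (nsum f < +oo)%E.
Proof. by move=> fg; apply: le_lt_trans; exact: le_nsum. Qed.

Lemma nsumD T (f g : T -> R) : (forall k, 0 <= f k) -> (forall k, 0 <= g k) ->
  (nsum (fun k => (f k + g k)%R) = nsum f + nsum g)%E.
Proof.
move=> f0 g0; rewrite /nsum -esumD; do ?by move=> i _; rewrite lee_fin.
by apply: eq_esum => k _; rewrite EFinD.
Qed.

Lemma nsumD_fin T (f g : T -> R) : (forall k, 0 <= f k) -> (forall k, 0 <= g k) ->
  (nsum f < +oo)%E -> (nsum g < +oo)%E ->
  (nsum (fun k => (f k + g k)%R) < +oo)%E.
Proof. by move=> f0 g0 foo goo; rewrite nsumD// lte_add_pinfty. Qed.

Lemma nsumZ_le T (f : T -> R) (c : R) : 0 <= c -> (forall k, 0 <= f k) ->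
  (nsum (fun k => c * f k)%R <= c%:E * nsum f)%E.
Proof.
move=> c0 f0; apply: ge_ereal_sup => _ [X [finX _] <-].
have -> : (\sum_(i \in X) (c * f i)%:E = c%:E * \sum_(i \in X) (f i)%:E)%E.
  rewrite !fsbig_finite//= ge0_sume_distrr//=; last by move=> i _; rewrite lee_fin.
by rewrite lee_wpmul2l ?lee_fin//; apply: esum_ge; exists X.
Qed.

Lemma nsumZ T (f : T -> R) (c : R) : 0 <= c -> (forall k, 0 <= f k) ->
  (nsum (fun k => c * f k)%R = c%:E * nsum f)%E.
Proof.
move=> c0 f0; apply/eqP; rewrite eq_le nsumZ_le//=.
have [->|cn0] := eqVneq c 0; first by rewrite mul0e nsum_ge0// => k; rewrite mul0r.
have cp : 0 < c by rewrite lt_neqAle eq_sym cn0.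
(* The converse inequality is [nsumZ_le] for the family [c * f] and the factor [c^-1], multiplied
   back by [c]. *)
have := @nsumZ_le T (fun k => c * f k)%R c^-1.
rewrite invr_ge0 => /(_ c0 (fun k => mulr_ge0 c0 (f0 k))).
rewrite (@eq_nsum _ _ f); last by move=> k; rewrite mulrA mulVf// mul1r.
move=> /(@lee_wpmul2l _ c%:E) => /(_ ltac:(by rewrite lee_fin)).
by rewrite muleA -EFinM divff// mul1e.
Qed.

Lemma nsumZ_fin T (f : T -> R) (c : R) : 0 <= c -> (forall k, 0 <= f k) ->
  (nsum f < +oo)%E -> (nsum (fun k => (c * f k)%R) < +oo)%E.
Proof.
by move=> c0 f0 foo; rewrite nsumZ// nsumE// -EFinM ltry.
Qed.

Lemma nsum_reindex (T T' : choiceType) (e : T' -> T) (g : T -> R) : bijective e ->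
  nsum (fun k => g (e k)) = nsum g.
Proof.
move=> be; rewrite /nsum [RHS](reindex_esum [set: T'] _ e)//.
by rewrite setTT_bijective.
Qed.

Lemma nsum_fubini (T1 T2 : choiceType) (g : T1 -> T2 -> R) :
  (forall i j, 0 <= g i j) ->
  nsum (fun p : T1 * T2 => g p.1 p.2) = \esum_(i in [set: T1]) nsum (g i).
Proof.
move=> g0; rewrite /nsum esum_esum; last by move=> i j _ _; rewrite lee_fin.
by congr esum; apply/seteqP; split.
Qed.

Lemma nsum_swap (T1 T2 : choiceType) (g : T1 * T2 -> R) :
  nsum (fun p : T2 * T1 => g (p.2, p.1)) = nsum g.
Proof.
apply: (@nsum_reindex _ _ (fun p : T2 * T1 => (p.2, p.1))).
by exists (fun p => (p.2, p.1)); case.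
Qed.

(** In the iterated sum, the slice at [i] is one term among nonnegative ones. *)
Lemma nsum_pair_slice (T1 T2 : choiceType) (g : T1 * T2 -> R) i :
  (forall p, 0 <= g p) -> (nsum (fun j => g (i, j)) <= nsum g)%E.
Proof.
move=> g0; have := @nsum_fubini _ _ (fun i j => g (i, j)) (fun i j => g0 (i, j)).
under eq_nsum do rewrite -surjective_pairing; move=> ->.
rewrite (esumID [set i])/=; last by move=> ? _; exact: nsum_ge0.
rewrite setTI esum_set1 ?nsum_ge0// leeDl//.
by apply: esum_ge0 => ? _; exact: nsum_ge0.
Qed.

End Nsum.

(** * Absolutely summable real families *)

Section Rsum.
Context {R : realType}.
Implicit Types T : choiceType.

Lemma rsum_mkcond T (D : set T) (f : T -> R) :
  rsum D f = rsum setT (fun k => if k \in D then f k else 0).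
Proof.
rewrite /rsum [X in (X - _)%E]esum_mkcond [X in (_ - X)%E]esum_mkcond.
by congr (fine (_ - _)%E); apply: eq_esum => k _;
  rewrite ?funeposE ?funenegE /=; case: ifP => //; rewrite ?oppr0 maxxx.
Qed.

Lemma eq_rsum T (D : set T) (f g : T -> R) : f =1 g -> rsum D f = rsum D g.
Proof. by move=> /funext ->. Qed.

Definition rsummable T (f : T -> R) := (nsum (fun k => `|f k|%R) < +oo)%E.

(** [p] and [q] need not be the positive and negative parts of [f]. This freedom is what gives
    additivity, since the positive part of a sum is not the sum of the positive parts. *)
Lemma rsum_diff T (f p q : T -> R) :
  (forall k, 0 <= p k) -> (forall k, 0 <= q k) ->
  (nsum p < +oo)%E -> (nsum q < +oo)%E -> (forall k, f k = p k - q k) ->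
  rsum setT f = fine (nsum p) - fine (nsum q).
Proof.
move=> p0 q0 poo qoo /funext ->; rewrite -fineB ?nsum_fin// /rsum.
congr fine; rewrite -[RHS](@esumB _ _ setT (EFin \o p) (EFin \o q))//.
- rewrite /summable; under eq_esum do rewrite /= ger0_norm//; exact: poo.
- rewrite /summable; under eq_esum do rewrite /= ger0_norm//; exact: qoo.
- by move=> k _; rewrite lee_fin.
- by move=> k _; rewrite lee_fin.
Qed.

Definition rpos (x : R) := Num.max x 0.
Lemma rpos_ge0 x : 0 <= rpos x.
Proof. by rewrite /rpos le_max lexx orbT. Qed.
Lemma rpos_le x : rpos x <= `|x|.
Proof. by rewrite /rpos ge_max ler_norm normr_ge0. Qed.
Lemma rposB x : x = rpos x - rpos (- x).
Proof. by rewrite /rpos /Num.max; case: ltP => ?; case: ltP => ?; lra. Qed.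
Lemma rpos_fin T (f : T -> R) : rsummable f -> (nsum (fun k => rpos (f k)%R) < +oo)%E.
Proof. by apply: le_nsum_fin => k; exact: rpos_le. Qed.

Lemma rsummableN T (f : T -> R) : rsummable f -> rsummable (fun k => - f k).
Proof. by apply: le_nsum_fin => k; rewrite normrN. Qed.

Lemma rpos_fin_num T (f : T -> R) : rsummable f ->
  nsum (fun k => rpos (f k)) \is a fin_num.
Proof. by move=> sf; apply: nsum_fin (rpos_fin sf) => k; exact: rpos_ge0. Qed.

Lemma rsummable_pos_neg T (f : T -> R) : rsummable f ->
  rsum setT f = fine (nsum (fun k => rpos (f k))) - fine (nsum (fun k => rpos (- f k))).
Proof.
move=> sf; apply: rsum_diff => //; try (by move=> k; exact: rpos_ge0).
- exact: rpos_fin.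
- by apply: (@rpos_fin _ (fun k => - f k)); exact: rsummableN.
- by move=> k; exact: rposB.
Qed.

Lemma rsumN T (f : T -> R) : rsummable f -> rsum setT (fun k => - f k) = - rsum setT f.
Proof.
move=> sf; rewrite !rsummable_pos_neg//; last exact: rsummableN.
by under [X in _ - fine X]eq_nsum do rewrite opprK; rewrite opprB.
Qed.

Lemma rsummableD T (f g : T -> R) : rsummable f -> rsummable g -> rsummable (fun k => f k + g k).
Proof.
move=> sf sg; apply: le_nsum_fin (nsumD_fin _ _ sf sg) => // k.
exact: ler_normD.
Qed.

Lemma rsumD T (f g : T -> R) : rsummable f -> rsummable g ->
  rsum setT (fun k => f k + g k) = rsum setT f + rsum setT g.
Proof.
move=> sf sg; rewrite (rsummable_pos_neg sf) (rsummable_pos_neg sg).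
have sfN := rsummableN sf; have sgN := rsummableN sg.
rewrite (@rsum_diff _ _ (fun k => rpos (f k) + rpos (g k))
  (fun k => rpos (- f k) + rpos (- g k))).
- rewrite !nsumD; try (by move=> k; exact: rpos_ge0).
  by rewrite !fineD ?rpos_fin_num//; ring.
- by move=> k; rewrite addr_ge0 ?rpos_ge0.
- by move=> k; rewrite addr_ge0 ?rpos_ge0.
- by apply: nsumD_fin; try (by move=> k; exact: rpos_ge0); exact: rpos_fin.
- apply: nsumD_fin; try (by move=> k; exact: rpos_ge0).
    exact: (rpos_fin sfN).
  exact: (rpos_fin sgN).
- by move=> k; rewrite [in LHS](rposB (f k)) [in LHS](rposB (g k)); ring.
Qed.

Lemma rsum_ge0E T (f : T -> R) : (forall k, 0 <= f k) -> (nsum f < +oo)%E ->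
  rsum setT f = fine (nsum f).
Proof.
have z0 : nsum (fun _ : T => 0 : R) = 0%E by rewrite /nsum esum1.
move=> f0 foo; rewrite (@rsum_diff _ _ f (fun=> 0)) ?z0 ?subr0 ?ltry// => k.
by rewrite subr0.
Qed.

Lemma rsummableZ T (f : T -> R) c : rsummable f -> rsummable (fun k => c * f k).
Proof.
move=> sf; apply: le_nsum_fin (nsumZ_fin (normr_ge0 c) _ sf) => // k.
by rewrite normrM.
Qed.

Lemma rsumZ_ge0 T (f : T -> R) c : 0 <= c -> rsummable f ->
  rsum setT (fun k => c * f k) = c * rsum setT f.
Proof.
move=> c0 sf; rewrite (rsummable_pos_neg sf).
have sfN := rsummableN sf.
rewrite (@rsum_diff _ _ (fun k => c * rpos (f k)) (fun k => c * rpos (- f k))).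
- rewrite !nsumZ//; try (by move=> k; exact: rpos_ge0).
  by rewrite !fineM ?rpos_fin_num//= mulrBr.
- by move=> k; rewrite mulr_ge0 ?rpos_ge0.
- by move=> k; rewrite mulr_ge0 ?rpos_ge0.
- by apply: nsumZ_fin => // [k|]; [exact: rpos_ge0|exact: (rpos_fin sf)].
- by apply: nsumZ_fin => // [k|]; [exact: rpos_ge0|exact: (rpos_fin sfN)].
- by move=> k; rewrite -mulrBr -rposB.
Qed.

Lemma rsumZ T (f : T -> R) c : rsummable f ->
  rsum setT (fun k => c * f k) = c * rsum setT f.
Proof.
move=> sf; have [c0|c0] := leP 0 c; first exact: rsumZ_ge0.
rewrite (@eq_rsum _ _ _ (fun k => - ((- c) * f k))); last by move=> k; rewrite mulNr opprK.
rewrite rsumN ?rsumZ_ge0 ?oppr_ge0 ?(ltW c0)//; first by rewrite mulNr opprK.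
exact: rsummableZ.
Qed.

Lemma ler_rsum T (f g : T -> R) : rsummable f -> rsummable g -> (forall k, f k <= g k) ->
  rsum setT f <= rsum setT g.
Proof.
move=> sf sg fg; rewrite -subr_ge0 -(rsumN sf) -(rsumD sg (rsummableN sf)).
rewrite rsum_ge0E; first by rewrite fine_ge0// nsum_ge0// => k; rewrite subr_ge0.
  by move=> k; rewrite subr_ge0.
apply: le_nsum_fin (rsummableD sg (rsummableN sf)) => k; exact: ler_norm.
Qed.

Lemma rsum_reindex (T T' : choiceType) (e : T' -> T) (f : T -> R) : bijective e ->
  rsum setT (fun k => f (e k)) = rsum setT f.
Proof.
rewrite -setTT_bijective => be.
have H (g : T -> \bar R) : esum [set: T] g = esum [set: T'] (g \o e).
  exact: (@reindex_esum R T' T setT setT e g be).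
rewrite /rsum (H (EFin \o f)^\+%E) (H (EFin \o f)^\-%E).
by congr (fine (_ - _)%E); apply: eq_esum => k _; rewrite /= ?funeposE ?funenegE.
Qed.

(** Tonelli for the positive and for the negative part; their inner sums are finite and form a
    decomposition to which [rsum_diff] applies. *)
Lemma rsum_fubini (T1 T2 : choiceType) (f : T1 * T2 -> R) : rsummable f ->
  rsum setT f = rsum setT (fun i => rsum setT (fun j => f (i, j))).
Proof.
move=> sf; have sfN := rsummableN sf.
have slice g i : rsummable g -> rsummable (fun j : T2 => g (i : T1, j)) :> Prop.
  by apply: le_lt_trans; apply: (@nsum_pair_slice _ _ _ (fun p => `|g p|)).
have key (g : T1 * T2 -> R) : rsummable g ->
  nsum (fun i => fine (nsum (fun j => rpos (g (i, j))))) = nsum (fun p => rpos (g p)).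
  move=> sg.
  have := @nsum_fubini R _ _ (fun i j => rpos (g (i, j))) (fun i j => rpos_ge0 _).
  under eq_nsum do rewrite -surjective_pairing; move=> ->.
  apply: eq_esum => i _; rewrite -nsumE// => [k|]; first exact: rpos_ge0.
  by apply: (@rpos_fin _ (fun j => g (i, j))); exact: slice.
rewrite (rsummable_pos_neg sf) -(key f)// -(key (fun p => - f p))//.
rewrite -(@rsum_diff _ (fun i => fine (nsum (fun j => rpos (f (i, j))))
   - fine (nsum (fun j => rpos (- f (i, j))))))//.
- apply: eq_rsum => i; rewrite rsummable_pos_neg//; exact: slice.
- by move=> k; rewrite fine_ge0// nsum_ge0// => j; exact: rpos_ge0.
- by move=> k; rewrite fine_ge0// nsum_ge0// => j; exact: rpos_ge0.
- by rewrite key//; exact: rpos_fin.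
- by rewrite (key (fun p => - f p))//; exact: (rpos_fin sfN).
Qed.

End Rsum.

(** * Absolutely summable complex families *)

Section Csum.
Context {R : realType}.
Implicit Types T : choiceType.

Definition csummable T (f : T -> R[i]) := (nsum (fun k => cmod (f k)) < +oo)%E.

Lemma csummable_le T (f : T -> R[i]) (g : T -> R) : (nsum g < +oo)%E ->
  (forall k, cmod (f k) <= g k) -> csummable f.
Proof. by move=> + fg; apply: le_nsum_fin. Qed.

Lemma csummable_Re T (f : T -> R[i]) : csummable f -> rsummable (fun k => Re (f k)).
Proof. by apply: le_nsum_fin => k; exact: ler_Re_cmod. Qed.

Lemma csummable_Im T (f : T -> R[i]) : csummable f -> rsummable (fun k => Im (f k)).
Proof. by apply: le_nsum_fin => k; exact: ler_Im_cmod. Qed.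

Lemma csummableD T (f g : T -> R[i]) : csummable f -> csummable g -> csummable (fun k => f k + g k).
Proof.
move=> sf sg; apply: csummable_le (nsumD_fin _ _ sf sg) _ => k; rewrite ?cmod_ge0//.
exact: ler_cmodD.
Qed.

Lemma csummableZ T (f : T -> R[i]) (c : R[i]) : csummable f -> csummable (fun k => c * f k).
Proof.
move=> sf; apply: csummable_le (nsumZ_fin (cmod_ge0 c) _ sf) _ => k; rewrite ?cmod_ge0//.
by rewrite cmodM.
Qed.

Lemma csum_mkcond T (D : set T) (f : T -> R[i]) :
  csum D f = csum setT (fun k => if k \in D then f k else 0).
Proof.
by rewrite /csum (rsum_mkcond D) (rsum_mkcond D); apply: complex_eqP => /=;
  apply: eq_rsum => k; case: ifP.
Qed.

Lemma eq_csum T (D : set T) (f g : T -> R[i]) : f =1 g -> csum D f = csum D g.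
Proof. by move=> /funext ->. Qed.

Lemma csumD T (f g : T -> R[i]) : csummable f -> csummable g ->
  csum setT (fun k => f k + g k) = csum setT f + csum setT g.
Proof.
move=> sf sg; apply: complex_eqP; rewrite ?(cReD, cImD) /=.
  rewrite -rsumD; [|exact: csummable_Re..].
  by apply: eq_rsum => k; rewrite cReD.
rewrite -rsumD; [|exact: csummable_Im..].
by apply: eq_rsum => k; rewrite cImD.
Qed.

Lemma csumZ T (f : T -> R[i]) (c : R[i]) : csummable f ->
  csum setT (fun k => c * f k) = c * csum setT f.
Proof.
move=> sf; have sr := csummable_Re sf; have si := csummable_Im sf.
have rr := rsummableZ (Re c) sr; have ri := rsummableZ (Re c) si.
have ir := rsummableZ (Im c) sr; have ii := rsummableZ (Im c) si.
apply: complex_eqP; rewrite ?(cReM, cImM) /=.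
  rewrite -(rsumZ _ sr) -(rsumZ _ si) -(rsumN ii) -(rsumD rr (rsummableN ii)).
  by apply: eq_rsum => k; rewrite cReM.
rewrite -(rsumZ _ sr) -(rsumZ _ si) -(rsumD ri ir).
by apply: eq_rsum => k; rewrite cImM.
Qed.

Lemma csum_reindex (T T' : choiceType) (e : T' -> T) (f : T -> R[i]) :
  bijective e -> csum setT (fun k => f (e k)) = csum setT f.
Proof.
move=> be; apply: complex_eqP => /=.
  exact: (@rsum_reindex _ _ _ e (fun k => Re (f k))).
exact: (@rsum_reindex _ _ _ e (fun k => Im (f k))).
Qed.

Lemma csummable_reindex (T T' : choiceType) (e : T' -> T) (f : T -> R[i]) :
  bijective e -> csummable f -> csummable (fun k => f (e k)).
Proof.
by move=> be; rewrite /csummable (@nsum_reindex _ _ _ e (fun k => cmod (f k))).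
Qed.

Lemma csum_fubini (T1 T2 : choiceType) (f : T1 * T2 -> R[i]) : csummable f ->
  csum setT f = csum setT (fun i => csum setT (fun j => f (i, j))).
Proof.
move=> sf; apply: complex_eqP => /=.
  by rewrite rsum_fubini//; exact: csummable_Re.
by rewrite rsum_fubini//; exact: csummable_Im.
Qed.

Lemma csum_swap (T1 T2 : choiceType) (f : T1 -> T2 -> R[i]) :
  csummable (fun p => f p.1 p.2) ->
  csum setT (fun i => csum setT (f i)) = csum setT (fun j => csum setT (f^~ j)).
Proof.
have bs : bijective (fun p : T2 * T1 => (p.2, p.1)).
  by exists (fun p => (p.2, p.1)); case.
move=> sf; rewrite -(csum_fubini sf) -(csum_reindex _ bs).
by rewrite csum_fubini//; exact: (csummable_reindex bs sf).
Qed.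

Lemma csummable_slice (T1 T2 : choiceType) (f : T1 -> T2 -> R[i]) i :
  csummable (fun p => f p.1 p.2) -> csummable (f i).
Proof.
apply: le_lt_trans.
by apply: (@nsum_pair_slice _ _ _ (fun p => cmod (f p.1 p.2))) => p; exact: cmod_ge0.
Qed.

Lemma csummable_slice2 (T1 T2 : choiceType) (f : T1 -> T2 -> R[i]) j :
  csummable (fun p => f p.1 p.2) -> csummable (f^~ j).
Proof.
have bs : bijective (fun p : T2 * T1 => (p.2, p.1)).
  by exists (fun p => (p.2, p.1)); case.
move=> /(csummable_reindex bs) /=; exact: (@csummable_slice _ _ (fun j i => f i j)).
Qed.

Lemma csummable_fubini (T1 T2 : choiceType) (f : T1 -> T2 -> R[i]) :
  (\esum_(i in [set: T1]) nsum (fun j => cmod (f i j)) < +oo)%E ->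
  csummable (fun p => f p.1 p.2).
Proof.
by rewrite -nsum_fubini// => i j; exact: cmod_ge0.
Qed.

(** An infinite right side leaves nothing to prove. Otherwise, for the sum S, the number |S|^2 is
    the real part of the sum of conj(S) f_k, which is compared termwise with |S| |f_k|. *)
Lemma cmod_csum T (f : T -> R[i]) :
  ((cmod (csum setT f))%:E <= nsum (fun k => cmod (f k)))%E.
Proof.
have [foo|] := ltP (nsum (fun k => cmod (f k))) +oo%E; last first.
  by rewrite leye_eq => /eqP ->; rewrite leey.
have sf : csummable f by [].
set S := csum setT f; have [S0|Sn0] := eqVneq (cmod S) 0.
  by rewrite S0 nsum_ge0// => k; exact: cmod_ge0.
have Sp : 0 < cmod S by rewrite lt_neqAle eq_sym Sn0 cmod_ge0.
rewrite nsumE// => [|k]; last exact: cmod_ge0.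
rewrite lee_fin -(ler_pM2l Sp).
have -> : cmod S * cmod S = Re (conjc S * S).
  by rewrite (mulrC (conjc S)) cmul_conj /= expr2.
rewrite -csumZ// -(cmodJ S); move: (conjc S) => c.
rewrite -(rsum_ge0E (f := fun k => cmod (f k)))// => [|k]; last exact: cmod_ge0.
have sc : rsummable (fun k => cmod (f k)).
  by apply: le_nsum_fin foo => k; rewrite ger0_norm// cmod_ge0.
rewrite -rsumZ// /csum /=; apply: ler_rsum => [||k].
- by apply: csummable_Re; exact: csummableZ.
- exact: rsummableZ.
- apply: le_trans (ler_norm _) _; apply: le_trans (ler_Re_cmod _) _.
  by rewrite cmodM.
Qed.

Lemma cmod_csum_le T (f : T -> R[i]) (g : T -> R) : (nsum g < +oo)%E ->
  (forall k, cmod (f k) <= g k) -> cmod (csum setT f) <= fine (nsum g).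
Proof.
move=> goo fg; rewrite -lee_fin; apply: le_trans (cmod_csum f) _.
rewrite -nsumE// => [|k]; first exact: le_nsum.
by apply: le_trans (fg k); exact: cmod_ge0.
Qed.

Lemma nsum_seq T (r : seq T) (f : T -> R) : (forall k, 0 <= f k) ->
  uniq r -> (forall k, k \notin r -> f k = 0) -> nsum f = (\sum_(k <- r) f k)%:E.
Proof.
move=> f0 ur fr; rewrite /nsum.
rewrite [LHS](_ : _ = \esum_(k in [set` r]) (f k)%:E).
  rewrite esum_fset//; last by move=> k _; rewrite lee_fin.
  by rewrite -fsbig_seq// sumEFin.
rewrite [RHS]esum_mkcond; apply: eq_esum => k _.
by rewrite mem_setE; case: ifPn => // /fr ->.
Qed.

Lemma csummable_seq T (r : seq T) (f : T -> R[i]) :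
  uniq r -> (forall k, k \notin r -> f k = 0) -> csummable f.
Proof.
move=> ur fr; rewrite /csummable (@nsum_seq _ r) ?ltry// => k; first exact: cmod_ge0.
by move=> /fr ->; rewrite cmod0.
Qed.

Lemma csum0 T : csum setT (fun _ : T => 0 : R[i]) = 0.
Proof.
rewrite /csum /= rsum_ge0E//; last by rewrite /nsum esum1.
by rewrite /nsum esum1.
Qed.

Lemma csum_seq T (r : seq T) (f : T -> R[i]) :
  uniq r -> (forall k, k \notin r -> f k = 0) -> csum setT f = \sum_(k <- r) f k.
Proof.
(* Families with a single nonzero term; the induction on [r] splits off one such family at a
   time. *)
have dl (k0 : T) (c : R[i]) : csum setT (fun k => if k == k0 then c else 0) = c.
  have H (x : R) : 0 <= x ->
      nsum (fun k => if k == k0 then x else 0) = x%:E.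
    move=> x0; rewrite (@nsum_seq _ [:: k0])//; first by rewrite big_seq1 eqxx.
      by move=> k; case: ifP.
    by move=> k; rewrite mem_seq1 => /negbTE ->.
  have H2 (x : R) : rsum setT (fun k => if k == k0 then x else 0) = x.
    rewrite (@rsum_diff _ _ _ (fun k => if k == k0 then rpos x else 0)
       (fun k => if k == k0 then rpos (- x) else 0)).
    - by rewrite !H ?rpos_ge0//= -rposB.
    - by move=> k; case: ifP; rewrite ?rpos_ge0.
    - by move=> k; case: ifP; rewrite ?rpos_ge0.
    - by rewrite H ?rpos_ge0 ?ltry.
    - by rewrite H ?rpos_ge0 ?ltry.
    - by move=> k; case: ifP => _; rewrite ?subr0// -rposB.
  apply: complex_eqP => /=; rewrite -[RHS]H2; apply: eq_rsum => k; by case: ifP.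
elim: r f => [|k0 r IH] f ur fr.
  rewrite big_nil -[RHS](csum0 T); apply: eq_csum => k; exact: fr.
move: ur => /= /andP[k0r ur]; rewrite big_cons.
pose g k := if k == k0 then 0 else f k.
have gr k : k \notin r -> g k = 0.
  rewrite /g; case: eqP => // /eqP kk0 kr; apply: fr.
  by rewrite in_cons negb_or kk0.
rewrite (@eq_csum _ _ f (fun k => (if k == k0 then f k0 else 0) + g k)); last first.
  by move=> k; rewrite /g; case: eqP => [->|_]; rewrite ?addr0 ?add0r.
rewrite csumD; last exact: csummable_seq gr.
  rewrite dl (IH g)//; congr (_ + _); apply: eq_big_seq => k kr.
  by rewrite /g; case: eqP => // kk; move: k0r; rewrite -kk kr.
apply: (@csummable_seq _ [:: k0]) => // k.
by rewrite mem_seq1 => /negbTE ->.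
Qed.

(** The list enumerates a finite set whose partial sum comes within [e] of the supremum that defines
    [nsum f]. *)
Lemma nsum_tail T (f : T -> R) (e : R) : (forall k, 0 <= f k) -> (nsum f < +oo)%E -> 0 < e ->
  exists r : seq T, uniq r /\
    (nsum (fun k => if k \in r then 0 else f k)%R <= e%:E)%E.
Proof.
move=> f0 foo e0; have ffin := nsum_fin f0 foo.
have [_ [X [finX _] <-]] := ub_ereal_sup_adherent e0 ffin.
have [s Xs] := (finite_seqP X).1 finX; pose r := undup s.
have ur : uniq r by exact: undup_uniq.
have {Xs} -> : X = [set` r].
  by rewrite Xs; apply/seteqP; split => k /=; rewrite mem_undup.
rewrite -fsbig_seq// sumEFin -[ereal_sup _]/(nsum f) => Xe.
exists r; split=> //.
have s1 : nsum f = (nsum (fun k => if k \in r then f k else 0)%R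
                + nsum (fun k => if k \in r then 0 else f k)%R)%E.
  rewrite -nsumD; try by move=> k; case: ifP.
  by apply: eq_nsum => k; case: ifP; rewrite ?addr0 ?add0r.
have s2 : nsum (fun k => if k \in r then f k else 0) = (\sum_(k <- r) f k)%:E.
  rewrite (@nsum_seq _ r)//; last 2 first.
  - by move=> k; case: ifP.
  - by move=> k /negbTE ->.
  by congr _%:E; apply: eq_big_seq => k ->.
move: Xe; rewrite {1}s1 s2; set B := nsum _.
have Bfin : B \is a fin_num.
  apply: nsum_fin => [k|]; first by case: ifP.
  by apply: le_nsum_fin foo => k; case: ifP.
by rewrite -(fineK Bfin) -EFinN -!EFinD lte_fin lee_fin => ?; lra.
Qed.

Lemma csum_split T (r : seq T) (f : T -> R[i]) : uniq r -> csummable f ->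
  csum setT f = \sum_(k <- r) f k + csum setT (fun k => if k \in r then 0 else f k).
Proof.
move=> ur sf.
have sg : csummable (fun k => if k \in r then f k else 0).
  by apply: le_nsum_fin sf => k; case: ifP; rewrite ?cmod0 ?cmod_ge0.
have sh : csummable (fun k => if k \in r then 0 else f k).
  by apply: le_nsum_fin sf => k; case: ifP; rewrite ?cmod0 ?cmod_ge0.
have -> : \sum_(k <- r) f k = csum setT (fun k => if k \in r then f k else 0).
  rewrite (@csum_seq _ r)//; first by apply: eq_big_seq => k ->.
  by move=> k /negbTE ->.
by rewrite -csumD//; apply: eq_csum => k; case: ifP; rewrite ?addr0 ?add0r.
Qed.

(** Every list containing [r] is allowed, so that [csum_nat] can take initial segments of the
    natural numbers. *)
Lemma csum_tail T (f : T -> R[i]) e : csummable f -> 0 < e ->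
  exists r : seq T, uniq r /\
    forall r', uniq r' -> {subset r <= r'} ->
    cmod (csum setT f - \sum_(k <- r') f k) <= e.
Proof.
move=> sf e0; have [|r [ur re]] := nsum_tail _ sf e0.
  by move=> k; exact: cmod_ge0.
exists r; split=> // r' ur' rr'.
rewrite (csum_split ur' sf) addrC addKr -lee_fin.
apply: le_trans (cmod_csum _) _; apply: le_trans re; apply: le_nsum => k.
have [kr'|kr'] := boolP (k \in r'); first by rewrite cmod0; case: ifP; rewrite ?cmod_ge0.
by case: ifPn => // /rr'; rewrite (negbTE kr').
Qed.

Lemma csum_nat (f : nat -> R[i]) e : csummable f -> 0 < e ->
  exists N, forall n, (N <= n)%N -> cmod (csum setT f - \sum_(k < n) f k) <= e.
Proof.
move=> sf e0; have [r [ur re]] := csum_tail sf e0.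
exists (\max_(k <- r) k).+1%N => n Nn.
rewrite -(big_mkord xpredT f) /index_iota subn0; apply: re; first exact: iota_uniq.
move=> k kr; rewrite mem_iota add0n; apply: leq_ltn_trans Nn.
exact: leq_bigmax_seq.
Qed.

End Csum.

(** * Fourier series on the torus *)

Section Torus.
Context {R : realType}.
Implicit Types d : nat.

Lemma torus_neq0 d (z : 'rV[R[i]]_d) i : torus z -> z 0 i != 0.
Proof. by move=> /(_ i) zi; rewrite -normr_eq0 zi oner_eq0. Qed.

Lemma monomD d (z : 'rV[R[i]]_d) k l : torus z ->
  monom z (k + l) = monom z k * monom z l.
Proof.
move=> tz; rewrite /monom -big_split/=; apply: eq_bigr => i _.
by rewrite mxE expfzDr// torus_neq0.
Qed.

Lemma monom0 d (z : 'rV[R[i]]_d) : monom z 0 = 1.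
Proof. by rewrite /monom big1// => i _; rewrite mxE expr0z. Qed.

Lemma monom_inv_pt d (z : 'rV[R[i]]_d) k : monom (inv_pt z) k = monom z (- k).
Proof.
by rewrite /monom; apply: eq_bigr => i _; rewrite !mxE exprz_inv.
Qed.

Lemma cmod_monom d (z : 'rV[R[i]]_d) k : torus z -> cmod (monom z k) = 1.
Proof.
move=> tz; have := norm_cmod (monom z k).
rewrite /monom normr_prod big1 => [|i _]; first by move=> /(congr1 (@Re R)).
have := tz i; case: (k 0 i) => m; rewrite ?NegzE -?invr_expz -?exprnP ?normfV ?normrX => ->.
  by rewrite expr1n.
by rewrite expr1n invr1.
Qed.

Lemma torus_inv_pt d (z : 'rV[R[i]]_d) : torus z -> torus (inv_pt z).
Proof. by move=> tz i; rewrite mxE normfV tz invr1. Qed.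

Lemma cexpD (z w : R[i]) : cexp (z + w) = cexp z * cexp w.
Proof.
case: z w => a b [c d]; apply: complex_eqP; rewrite ?cReM ?cImM/=.
  by rewrite expRD cosD; ring.
by rewrite expRD sinD; ring.
Qed.

Lemma cexp0 : cexp 0 = 1 :> R[i].
Proof. by apply: complex_eqP; rewrite /= expR0 ?cos0 ?sin0 mul1r. Qed.

Lemma cexpN (z : R[i]) : cexp (- z) = (cexp z)^-1.
Proof.
have h : cexp (- z) * cexp z = 1 by rewrite -cexpD addNr cexp0.
have z0 : cexp z != 0.
  by apply/eqP => z0; move: h; rewrite z0 mulr0 => /eqP; rewrite eq_sym oner_eq0.
by rewrite -[LHS]mulr1 -(mulfV z0) mulrA h mul1r.
Qed.

Lemma cexpMz (z : R[i]) (k : int) : cexp (k%:~R * z) = cexp z ^ k.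
Proof.
have hn (n : nat) : cexp (n%:R * z) = cexp z ^+ n.
  elim: n => [|n IH]; first by rewrite mul0r cexp0 expr0.
  by rewrite -addn1 natrD mulrDl cexpD IH mul1r exprD expr1.
by case: k => n; rewrite ?NegzE -?invr_expz -?exprnP ?mulrNz ?mulNr ?cexpN hn.
Qed.

Lemma cmod_cexp (z : R[i]) : cmod (cexp z) = expR (Re z).
Proof.
by rewrite cmodE/= !exprMn -mulrDr cos2Dsin2 mulr1 sqrtr_sqr ger0_norm ?expR_ge0.
Qed.

Lemma torus_torus_pt d (t : 'rV[R]_d) : torus (torus_pt t).
Proof. by move=> i; rewrite mxE norm_cmod cmod_cexp expR0. Qed.

Definition fser d (c : 'rV[int]_d -> R[i]) (z : 'rV[R[i]]_d) : R[i] :=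
  csum setT (fun k => c k * monom z k).

Lemma csummable_fser d (c : 'rV[int]_d -> R[i]) z : csummable c -> torus z ->
  csummable (fun k => c k * monom z k).
Proof.
move=> sc tz; apply: csummable_le sc _ => k.
by rewrite cmodM cmod_monom// mulr1.
Qed.

Lemma fserD d (a b : 'rV[int]_d -> R[i]) z : csummable a -> csummable b -> torus z ->
  fser (fun k => a k + b k) z = fser a z + fser b z.
Proof.
move=> sa sb tz; rewrite /fser -csumD; [|exact: csummable_fser..].
by apply: eq_csum => k; rewrite mulrDl.
Qed.

Lemma fserZ d (a : 'rV[int]_d -> R[i]) (c : R[i]) z : csummable a -> torus z ->
  fser (fun k => c * a k) z = c * fser a z.
Proof.
move=> sa tz; rewrite /fser -csumZ; last exact: csummable_fser.
by apply: eq_csum => k; rewrite mulrA.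
Qed.

Lemma fser_shift d (a : 'rV[int]_d -> R[i]) l z : torus z ->
  csummable a -> fser (fun k => a (k + l)) z = fser a z * monom z (- l).
Proof.
move=> tz sa; rewrite mulrC /fser -csumZ; last exact: csummable_fser.
rewrite -[RHS](@csum_reindex _ _ _ (fun k => k + l)); last first.
  by exists (fun k => k - l) => k; rewrite ?addrK ?subrK.
by apply: eq_csum => k; rewrite mulrCA -monomD// [- l + _]addrC addrK.
Qed.

Section Conv.
Context {V : zmodType}.
Implicit Types a b : V -> R[i].

Definition convol a b k : R[i] := csum setT (fun l => a l * b (k - l)).

Definition rconv (f g : V -> R) (k : V) : \bar R := nsum (fun l => f l * g (k - l)).

Lemma nsum_rconv (f g : V -> R) : (forall k, 0 <= f k) -> (forall k, 0 <= g k) ->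
  (nsum g < +oo)%E ->
  (\esum_(k in [set: V]) rconv f g k = nsum f * nsum g)%E.
Proof.
move=> f0 g0 goo; rewrite /rconv.
rewrite -(@nsum_fubini _ _ _ (fun k l => f l * g (k - l))); last first.
  by move=> i j; rewrite mulr_ge0.
(* With l = [p.1] and k = [p.2 + p.1], the factors [f l] and [g (k - l)] depend on separate
   variables. *)
pose e (p : V * V) := (p.2 + p.1, p.1).
rewrite -(@nsum_reindex _ _ _ e); last first.
  by exists (fun p => (p.2, p.1 - p.2)) => -[x y]; rewrite /e /= ?addrK ?subrK.
rewrite /e /= (@nsum_fubini _ _ _ (fun i j => f i * g (j + i - i))); last first.
  by move=> i j; rewrite mulr_ge0.
rewrite [LHS](_ : _ = \esum_(i in [set: V]) (fine (nsum g) * f i)%:E).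
  by rewrite -/(nsum _) nsumZ ?fine_ge0 ?nsum_ge0// -nsumE// muleC.
apply: eq_esum => i _; under eq_nsum do rewrite addrK.
by rewrite nsumZ// nsumE//= -EFinM mulrC.
Qed.

Lemma csummable_pair_conv a b : csummable a -> csummable b ->
  csummable (fun p : V * V => a p.2 * b (p.1 - p.2)).
Proof.
move=> sa sb; apply: (@csummable_fubini _ _ _ (fun k l => a l * b (k - l))).
under eq_esum do under eq_nsum do rewrite cmodM.
rewrite (@nsum_rconv (fun k => cmod (a k)) (fun k => cmod (b k)))//.
- by rewrite (nsumE _ sa) 1?(nsumE _ sb) -?EFinM ?ltry// => k; exact: cmod_ge0.
- by move=> k; exact: cmod_ge0.
- by move=> k; exact: cmod_ge0.
Qed.

Lemma csummable_conv_term a b k : csummable a -> csummable b -> csummable (fun l => a l * b (k - l)).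
Proof.
move=> sa sb.
exact: (csummable_slice (f := fun k l => a l * b (k - l)) _ (csummable_pair_conv sa sb)).
Qed.

Lemma nsum_conv a b : csummable a -> csummable b ->
  (nsum (fun k => cmod (convol a b k)) <=
   nsum (fun k => cmod (a k)) * nsum (fun k => cmod (b k)))%E.
Proof.
move=> sa sb; rewrite -nsum_rconv; try by move=> k; exact: cmod_ge0.
  apply: le_esum => k _; apply: le_trans (cmod_csum _) _.
  by under eq_nsum do rewrite cmodM.
by [].
Qed.

Lemma csummable_conv a b : csummable a -> csummable b -> csummable (convol a b).
Proof.
move=> sa sb; apply: le_lt_trans (nsum_conv sa sb) _.
by rewrite (nsumE _ sa) 1?(nsumE _ sb) -?EFinM ?ltry// => k; exact: cmod_ge0.
Qed.

End Conv.

Lemma fserM d (a b : 'rV[int]_d -> R[i]) z : csummable a -> csummable b -> torus z ->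
  fser a z * fser b z = fser (convol a b) z.
Proof.
move=> sa sb tz; rewrite {2}/fser /convol.
pose g k l := a l * b (k - l) * monom z k.
have sg : csummable (fun p => g p.1 p.2).
  apply: csummable_le (csummable_pair_conv sa sb) _ => p.
  by rewrite /g cmodM cmod_monom// mulr1.
transitivity (csum setT (fun k => csum setT (g k))); last first.
  apply: eq_csum => k; rewrite mulrC -csumZ; last exact: csummable_conv_term.
  by apply: eq_csum => l; rewrite mulrC.
rewrite (csum_swap sg) mulrC /fser -csumZ; last exact: csummable_fser.
apply: eq_csum => l; rewrite mulrC -csumZ; last exact: csummable_fser.
rewrite -[RHS](@csum_reindex _ _ _ (fun k => k + l)); last first.
  by exists (fun k => k - l) => k; rewrite ?addrK ?subrK.
by apply: eq_csum => k; rewrite /g addrK monomD//; ring.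
Qed.

End Torus.

(** * Uniform convergence of dominated series *)

Section UniformSeries.
Context {R : realType}.

(** The list is chosen from the majorant [b] alone, hence works for all [x] at once. *)
Lemma csum_unif_tail (X : Type) (T : choiceType) (f : X -> T -> R[i]) (b : T -> R)
    (e : R) : (nsum b < +oo)%E -> (forall x k, cmod (f x k) <= b k) -> 0 < e ->
  exists r : seq T, uniq r /\ forall r', uniq r' -> {subset r <= r'} ->
    forall x, cmod (csum setT (f x) - \sum_(k <- r') f x k) <= e.
Proof.
move=> boo fb e0.
(* Nonnegativity of [b] is read off at a point of [X]; without such a point the claim is vacuous. *)
have [[x0 _]|noX] := pselect (exists x : X, True); last first.
  by exists [::]; split=> // r' _ _ x; exfalso; apply: noX; exists x.
have b0 k : 0 <= b k by apply: le_trans (fb x0 k); exact: cmod_ge0.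
have [r [ur re]] := nsum_tail b0 boo e0.
exists r; split=> // r' ur' rr' x.
have sf : csummable (f x) by exact: csummable_le boo (fb x).
rewrite (csum_split ur' sf) addrC addKr -lee_fin.
apply: le_trans (cmod_csum _) _; apply: le_trans re; apply: le_nsum => k.
have [kr'|kr'] := boolP (k \in r'); first by rewrite cmod0; case: ifP; rewrite ?cmod_ge0.
by case: ifPn => // /rr'; rewrite (negbTE kr').
Qed.

Lemma Re_sum (I : Type) (r : seq I) (f : I -> R[i]) :
  Re (\sum_(k <- r) f k) = \sum_(k <- r) Re (f k).
Proof. by elim/big_rec2: _ => // k x y _ <-; rewrite cReD. Qed.

Lemma continuous_sum (X : topologicalType) (I : Type) (r : seq I) (F : I -> X -> R) :
  (forall i, continuous (F i)) -> continuous (fun x => \sum_(i <- r) F i x).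
Proof.
move=> cF; elim: r => [|i r IH].
  rewrite (_ : (fun x => _) = cst 0); first exact: cst_continuous.
  by apply/funext => x; rewrite big_nil.
rewrite (_ : (fun x => _) = (fun x => F i x + \sum_(j <- r) F j x)); last first.
  by apply/funext => x; rewrite big_cons.
by move=> x; apply: cvgD; [exact: cF|exact: IH].
Qed.

(** Weierstrass M-test: a finite partial sum is continuous and uniformly within e/3 of the
    series. *)
Lemma continuous_Re_csum (X : topologicalType) (T : choiceType)
    (f : X -> T -> R[i]) (b : T -> R) :
  (nsum b < +oo)%E -> (forall x k, cmod (f x k) <= b k) ->
  (forall k, continuous (fun x => Re (f x k))) ->
  continuous (fun x => Re (csum setT (f x))).
Proof.
move=> boo fb fc x; apply/cvgrPdist_le => e e0.
have e30 : 0 < e / 3 by lra.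
have [r [ur /(_ r ur (fun _ => id)) re]] := csum_unif_tail boo fb e30.
pose g y := \sum_(k <- r) Re (f y k).
have gc : g y @[y --> x] --> g x by exact: continuous_sum.
have hg y : `|Re (csum setT (f y)) - g y| <= e / 3.
  apply: le_trans (re y); rewrite /g -Re_sum -cReN -cReD; exact: ler_Re_cmod.
move/cvgrPdist_le : gc => /(_ _ e30); apply: filterS => y gxy.
have := hg x; have := hg y; move: gxy; rewrite !ler_norml; lra.
Qed.

End UniformSeries.

(** * Trigonometric series in one variable and their mean values *)

Section CircleIntegral.
Context {R : realType}.
Notation mu := (@lebesgue_measure R).

Definition circ (t : R) : R[i] := cexp (0 +i* (2 * pi * t))%C.

Lemma circXz t (k : int) :
  circ t ^ k = (cos (2 * pi * k%:~R * t) +i* sin (2 * pi * k%:~R * t))%C.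
Proof.
rewrite /circ -cexpMz.
have -> : k%:~R * (0 +i* (2 * pi * t))%C = (0 +i* (2 * pi * k%:~R * t))%C :> R[i].
  have -> : k%:~R = (k%:~R +i* 0)%C :> R[i].
    have -> : (k%:~R +i* 0)%C = (k%:~R : R)%:C%C by [].
    by rewrite rmorph_int.
  by apply: complex_eqP; rewrite ?cReM ?cImM /=; ring.
by apply: complex_eqP; rewrite /= expR0 mul1r.
Qed.

Lemma cmod_circ t (k : int) : cmod (circ t ^ k) = 1.
Proof. by rewrite circXz cmodE/= cos2Dsin2 sqrtr1. Qed.

Lemma Re_circ (a : R[i]) t (k : int) :
  Re (a * circ t ^ k) =
  Re a * cos (2 * pi * k%:~R * t) - Im a * sin (2 * pi * k%:~R * t).
Proof. by rewrite cReM circXz. Qed.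

Lemma continuous_circ (a : R[i]) (k : int) :
  continuous (fun t => Re (a * circ t ^ k)).
Proof.
under eq_fun do rewrite Re_circ.
move=> t; apply: cvgB; apply: cvgM; try exact: cvg_cst.
  apply: (@continuous_comp _ _ _ (fun t => 2 * pi * k%:~R * t) cos).
    by apply: cvgM => //; exact: cvg_cst.
  exact: continuous_cos.
apply: (@continuous_comp _ _ _ (fun t => 2 * pi * k%:~R * t) sin).
  by apply: cvgM => //; exact: cvg_cst.
exact: continuous_sin.
Qed.

(** The two parts of [circ 1 ^ k], where [circ 1 = 1]. *)
Lemma cos_sin_2piz (k : int) :
  cos (2 * pi * k%:~R) = 1 :> R /\ sin (2 * pi * k%:~R) = 0 :> R.
Proof.
have h : circ 1 ^ k = 1.
  have -> : circ 1 = 1.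
    apply: complex_eqP; rewrite /= expR0 mul1r mulr1 mulrC mulr_natr.
      by rewrite cos2pi.
    by rewrite sin2pi.
  by rewrite exp1rz.
move: h; rewrite circXz mulr1 => /[dup] /(congr1 (@Re R)) /= h1 /(congr1 (@Im R)) /= h2.
by split.
Qed.

Lemma continuous_integrable01 (f : R -> R) : continuous f ->
  mu.-integrable `[0, 1] (EFin \o f).
Proof.
move=> cf; apply: continuous_compact_integrable; first exact: segment_compact.
exact: continuous_subspaceT.
Qed.

Lemma integral01_cst (B : R) : \int[mu]_(t in `[0, 1]) B = B.
Proof.
by rewrite Rintegral_cst//= lebesgue_measure_itv/= lte_fin ltr01 oppr0 adde0 mulr1.
Qed.

Lemma integral_circ (a : R[i]) (k : int) :
  \int[mu]_(t in `[0, 1]) Re (a * circ t ^ k) = if k == 0 then Re a else 0.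
Proof.
have [->|k0] := eqVneq k 0.
  under eq_Rintegral do rewrite expr0z mulr1.
  by rewrite integral01_cst.
have w0 : 2 * pi * k%:~R != 0 :> R.
  by rewrite !mulf_neq0// ?intr_eq0// gt_eqF// pi_gt0.
set w : R := 2 * pi * k%:~R in w0.
(* An antiderivative taking the same value at 0 and at 1, since [w] is a multiple of 2 pi. *)
pose F (t : R) := w^-1 * (Re a * sin (w * t) + Im a * cos (w * t)).
have dF (t : R) : is_derive t 1 F (Re (a * circ t ^ k)).
  rewrite Re_circ -/w /F.
  apply: is_derive_eq.
  rewrite /GRing.scale/=.
  by field.
have cF : continuous F.
  by move=> t; apply: differentiable_continuous; apply/derivable1_diffP; case: (dF t).
rewrite /Rintegral (@continuous_FTC2 _ _ F)//.
- rewrite /F mulr1 mulr0 sin0 cos0.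
  by have [-> ->] := cos_sin_2piz k; rewrite /= mulr0 add0r subrr.
- by apply: continuous_subspaceT; exact: continuous_circ.
- split.
  + by move=> x _; case: (dF x).
  + by apply: cvg_at_right_filter; exact: cF.
  + by apply: cvg_at_left_filter; exact: cF.
- by move=> x _; rewrite derive1E; case: (dF x).
Qed.

Lemma continuous_circ_sum (a : int -> R[i]) (r : seq int) :
  continuous (fun t => \sum_(k <- r) Re (a k * circ t ^ k)).
Proof.
by apply: continuous_sum => k; exact: continuous_circ.
Qed.

Lemma integral_circ_sum (a : int -> R[i]) (r : seq int) :
  uniq r ->
  \int[mu]_(t in `[0, 1]) (\sum_(k <- r) Re (a k * circ t ^ k))
  = if 0 \in r then Re (a 0) else 0.
Proof.
elim: r => [_|k r IH /= /andP[kr ur]].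
  under eq_Rintegral do rewrite big_nil.
  by rewrite integral01_cst.
under eq_Rintegral do rewrite big_cons.
rewrite RintegralD//=; last 2 first.
- by apply: continuous_integrable01; exact: continuous_circ.
- apply: continuous_integrable01; exact: continuous_circ_sum.
rewrite integral_circ IH// in_cons eq_sym; move: kr; case: eqP => [->|_ _].
  by move=> /negbTE ->; rewrite addr0.
by rewrite add0r.
Qed.

Variable a : int -> R[i].
Hypothesis sa : csummable a.

Lemma continuous_circ_series :
  continuous (fun t => Re (csum setT (fun k : int => a k * circ t ^ k))).
Proof.
apply: (@continuous_Re_csum _ _ _ (fun t k => a k * circ t ^ k) _ sa).
  by move=> t k; rewrite cmodM cmod_circ mulr1.
by move=> k; exact: continuous_circ.
Qed.

Lemma integral_circ_series :
  \int[mu]_(t in `[0, 1]) Re (csum setT (fun k : int => a k * circ t ^ k)) = Re (a 0).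
Proof.
apply/eqP; rewrite -subr_eq0 -normr_le0; apply/ler_addgt0Pl => e e0; rewrite addr0.
have ub t k : cmod (a k * circ t ^ k) <= cmod (a k).
  by rewrite cmodM cmod_circ mulr1.
have [r [ur re]] := csum_unif_tail sa ub e0.
(* Frequency 0 is put into the list by force, so that the partial sum has integral exactly
   [Re (a 0)]. *)
pose r' := undup (0 :: r).
have H t : cmod (csum setT (fun k => a k * circ t ^ k) - \sum_(k <- r') a k * circ t ^ k) <= e.
  apply: re; first exact: undup_uniq.
  by move=> k kr; rewrite mem_undup in_cons kr orbT.
have cp := @continuous_circ_sum a r'; have ch := continuous_circ_series.
have <- : \int[mu]_(t in `[0, 1]) (\sum_(k <- r') Re (a k * circ t ^ k)) = Re (a 0).
  by rewrite integral_circ_sum ?undup_uniq// mem_undup in_cons eqxx.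
have cd : continuous (fun t => Re (csum setT (fun k : int => a k * circ t ^ k))
   - \sum_(k <- r') Re (a k * circ t ^ k)).
  by move=> t; apply: cvgB; [exact: ch|exact: cp].
rewrite -RintegralB//; try exact: continuous_integrable01.
apply: le_trans (le_normr_Rintegral _ _) _ => //; first exact: continuous_integrable01.
apply: (@le_trans _ _ (\int[mu]_(t in `[0, 1]) e)).
  apply: le_Rintegral => //.
  - apply: continuous_integrable01 => t; apply: cvg_norm; exact: cd.
  - by apply: continuous_integrable01 => t; exact: cvg_cst.
  - move=> t _; apply: le_trans (H t); rewrite -Re_sum -cReN -cReD; exact: ler_Re_cmod.
by rewrite integral01_cst.
Qed.

Lemma Re_circ_series_le (B : R) :
  (forall t, 0 <= t <= 1 -> Re (csum setT (fun k : int => a k * circ t ^ k)) <= B) ->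
  Re (a 0) <= B.
Proof.
move=> hB; rewrite -integral_circ_series.
apply: (@le_trans _ _ (\int[mu]_(t in `[0, 1]) B)); last by rewrite integral01_cst.
apply: le_Rintegral => //.
- by apply: continuous_integrable01; exact: continuous_circ_series.
- by apply: continuous_integrable01 => t; exact: cvg_cst.
Qed.

End CircleIntegral.

(** * Fourier coefficients in several variables, by induction on the dimension *)

Section FourierCoefficients.
Context {R : realType}.

Definition cube d : set 'rV[R]_d := [set t | forall i, 0 <= t 0 i <= 1].

(** The form in which [cube_integral] assembles a point from its first coordinate and the remaining
    ones; it serves for frequencies as well. *)
Definition row_cons (T : pzSemiRingType) d (x : T) (s : 'rV[T]_d) : 'rV[T]_d.+1 :=
  row_mx (x%:M : 'M[T]_1) s.

Lemma row_cons0 (T : pzSemiRingType) d : row_cons 0 0 = 0 :> 'rV[T]_d.+1.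
Proof. by rewrite /row_cons raddf0 row_mx0. Qed.

Lemma row_consEl (T : pzSemiRingType) d (x : T) (s : 'rV[T]_d) (j : 'I_1) :
  row_cons x s 0 (lshift d j) = x.
Proof. by apply: etrans (row_mxEl _ _ _ _) _; rewrite (ord1 j) mxE eqxx. Qed.

Lemma row_consEr (T : pzSemiRingType) d (x : T) (s : 'rV[T]_d) (j : 'I_d) :
  row_cons x s 0 (rshift 1 j) = s 0 j.
Proof. exact: etrans (row_mxEr _ _ _ _) _. Qed.

Lemma row_cons_bij (T : pzSemiRingType) d :
  bijective (fun p : T * 'rV[T]_d => row_cons p.1 p.2).
Proof.
exists (fun k : 'rV[T]_(1 + d) => ((lsubmx k : 'rV_1) 0 0, rsubmx k)) => [[x s]|k] /=.
  by rewrite row_mxKl row_mxKr !mxE eqxx.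
rewrite /row_cons -[RHS]hsubmxK; congr row_mx.
by apply/matrixP => i j; rewrite !ord1 !mxE eqxx.
Qed.

Lemma cube_row_cons d (t : R) (s : 'rV[R]_d) : 0 <= t <= 1 -> cube s ->
  cube (row_cons t s).
Proof.
move=> t01 cs i.
rewrite -(@splitK 1 d i); case: (@fintype.split 1 d i) => j /=.
  by rewrite row_consEl.
by rewrite row_consEr.
Qed.

Lemma monom_row_cons d (t : R) (s : 'rV[R]_d) k (k' : 'rV[int]_d) :
  monom (torus_pt (row_cons t s)) (row_cons k k') =
  circ t ^ k * monom (torus_pt s) k'.
Proof.
rewrite /monom (@big_split_ord _ _ _ 1 d) big_ord1/=; congr (_ * _).
  by rewrite mxE !row_consEl.
by apply: eq_bigr => i _; rewrite [in LHS]mxE !row_consEr [in RHS]mxE.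
Qed.

Lemma eq_cube_integral d (f g : 'rV[R]_d -> R) :
  (forall t, cube t -> f t = g t) -> cube_integral f = cube_integral g.
Proof.
elim: d f g => [|d IH] f g fg /=; first by apply: fg => -[].
apply: eq_Rintegral => t; rewrite inE/= in_itv/= => t01.
by apply: IH => s cs; apply: fg; exact: cube_row_cons.
Qed.

Section Slice.
Variables (d : nat) (c : 'rV[int]_d.+1 -> R[i]).
Hypothesis sc : csummable c.

Let a k' (k : int) := c (row_cons k k').

(** With the first parameter frozen at [t], the Fourier coefficients in the remaining variables. *)
Definition coef_slice (t : R) (k' : 'rV[int]_d) : R[i] :=
  csum setT (fun k => a k' k * circ t ^ k).

Lemma csummable_row_cons : csummable (fun p : int * 'rV[int]_d => a p.2 p.1).
Proof. exact: (csummable_reindex (@row_cons_bij _ d) sc). Qed.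

Lemma csummable_row k' : csummable (a k').
Proof. exact: (@csummable_slice2 _ _ _ (fun k k' => a k' k) k' csummable_row_cons). Qed.

Lemma fser_row_cons t s :
  fser c (torus_pt (row_cons t s)) = fser (coef_slice t) (torus_pt s).
Proof.
rewrite /fser -(csum_reindex _ (@row_cons_bij _ d)).
pose f (k : int) k' := a k' k * circ t ^ k * monom (torus_pt s) k'.
have sf : csummable (fun p => f p.1 p.2).
  apply: csummable_le csummable_row_cons _ => p.
  by rewrite /f !cmodM cmod_circ (cmod_monom _ (torus_torus_pt s)) !mulr1.
transitivity (csum setT (fun p => f p.1 p.2)).
  by apply: eq_csum => p; rewrite monom_row_cons mulrA.
rewrite (csum_fubini sf)/= csum_swap//; apply: eq_csum => k'.
rewrite mulrC -csumZ.
  by apply: eq_csum => k; rewrite /f mulrC.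
apply: csummable_le (csummable_row k') _ => k.
by rewrite cmodM cmod_circ mulr1.
Qed.

Lemma csummable_coef_slice t : csummable (coef_slice t).
Proof.
have := sc; rewrite /csummable -(@nsum_reindex _ _ _ _ _ (@row_cons_bij _ d)).
rewrite -nsum_swap/= (@nsum_fubini _ _ _ (fun k' k => cmod (a k' k))); last first.
  by move=> i j; exact: cmod_ge0.
apply: le_lt_trans; apply: le_esum => k' _.
apply: le_trans (cmod_csum _) _; apply: le_nsum => k.
by rewrite cmodM cmod_circ mulr1.
Qed.

End Slice.

Lemma fser0 (c : 'rV[int]_0 -> R[i]) z : fser c z = c 0.
Proof.
have u (k : 'rV[int]_0) : k = 0 by apply/rowP => -[].
rewrite /fser (@csum_seq _ _ [:: 0])//; first by rewrite big_seq1 monom0 mulr1.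
by move=> k; rewrite mem_seq1 (u k) eqxx.
Qed.

(** By induction, the inner integral is the coefficient of frequency 0 of the slice. As a function
    of [t] this is a one-variable series, whose mean value is its own coefficient of frequency 0. *)
Lemma cube_integral_fser d (c : 'rV[int]_d -> R[i]) : csummable c ->
  cube_integral (fun t => Re (fser c (torus_pt t))) = Re (c 0).
Proof.
elim: d c => [|d IH] c sc.
  by rewrite -[LHS]/(Re (fser c (torus_pt 0))) fser0.
rewrite -row_cons0 -(integral_circ_series (csummable_row sc 0)).
apply: eq_Rintegral => t _; rewrite -[RHS]/(Re (coef_slice c t 0)).
rewrite -IH; last exact: csummable_coef_slice.
by congr cube_integral; apply/funext => s; rewrite -fser_row_cons.
Qed.

(** The bound itself is carried through the induction on the dimension, so that only one-variable
    integrals are ever compared. *)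
Lemma Re_coef0_le d (c : 'rV[int]_d -> R[i]) (B : R) : csummable c ->
  (forall t, cube t -> Re (fser c (torus_pt t)) <= B) -> Re (c 0) <= B.
Proof.
elim: d c => [|d IH] c sc hB.
  by have := hB 0; rewrite fser0; apply => -[].
rewrite -row_cons0; apply: (Re_circ_series_le (csummable_row sc 0)) => t t01.
apply: (IH (coef_slice c t)); first exact: csummable_coef_slice.
by move=> s cs; rewrite -fser_row_cons//; apply: hB; exact: cube_row_cons.
Qed.

Lemma csummable_shift (V : zmodType) (c : V -> R[i]) l : csummable c -> csummable (fun k => c (k + l)).
Proof.
by apply: (@csummable_reindex _ _ _ (fun k => k + l)); exists (fun k => k - l) => k;
  rewrite ?addrK ?subrK.
Qed.

Lemma cmod_coef_le d (c : 'rV[int]_d -> R[i]) (B : R) k : csummable c ->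
  (forall t, cube t -> cmod (fser c (torus_pt t)) <= B) -> cmod (c k) <= B.
Proof.
move=> sc hB; have [c0|cn0] := eqVneq (cmod (c k)) 0.
  rewrite c0; apply: le_trans (hB 0 _); first exact: cmod_ge0.
  by move=> i; rewrite mxE lexx ler01.
(* A rotation reduces to the real part of the coefficient of frequency 0. *)
pose w := conjc (c k) * ((cmod (c k))^-1)%:C%C.
have -> : cmod (c k) = Re (w * c (0 + k)).
  rewrite add0r /w mulrAC (mulrC (conjc _)) cmul_conj -rmorphM /=.
  by rewrite expr2 mulfK.
have sk := csummable_shift k sc.
apply: (@Re_coef0_le _ (fun l => w * c (l + k))); first exact: csummableZ.
move=> t ct; have tt := torus_torus_pt t.
rewrite (fserZ w sk tt) fser_shift//; apply: le_trans (ler_norm _) _.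
apply: le_trans (ler_Re_cmod _) _; rewrite !cmodM cmod_monom// mulr1.
by rewrite cmodJ cmodR ger0_norm ?invr_ge0 ?cmod_ge0// divff// mul1r hB.
Qed.

(** Multiplication by the monomial of exponent -k shifts the series, which turns the coefficient of
    frequency k into a mean value. *)
Lemma fourierE d (c : 'rV[int]_d -> R[i]) u : csummable c ->
  (forall t, cube t -> u (torus_pt t) = fser c (torus_pt t)) ->
  fourier u = c.
Proof.
move=> sc uc; apply/funext => k; have sk := csummable_shift k sc.
have E t : cube t -> u (torus_pt t) * monom (torus_pt t) (- k)
    = fser (fun l => c (l + k)) (torus_pt t).
  by move=> ct; rewrite uc// fser_shift//; exact: torus_torus_pt.
rewrite /fourier; apply: complex_eqP => /=.
  rewrite -[in RHS](add0r k) -(cube_integral_fser sk).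
  by apply: eq_cube_integral => t ct; rewrite E.
(* Multiplication by -i moves the imaginary part into the real part, so that [cube_integral_fser]
   covers both. *)
have [w [wRe wIm]] : exists w : R[i], Re w = 0 /\ Im w = -1.
  by exists (0 -i* 1)%C.
have wE x : Re (w * x) = Im x by rewrite cReM wRe wIm mul0r mulN1r opprK add0r.
rewrite -[in RHS](add0r k) -wE -(cube_integral_fser (csummableZ w sk)).
apply: eq_cube_integral => t ct; have tt := torus_torus_pt t.
by rewrite E// (fserZ w sk tt) wE.
Qed.

End FourierCoefficients.

(** * The Wiener algebra and polynomial weights *)

Section WienerAlgebra.
Context {R : realType} {d : nat}.
Implicit Types (f g u : 'rV[R[i]]_d -> R[i]) (c : 'rV[int]_d -> R[i]).

(* Equality is required only at the points [torus_pt t] with [t] in the cube, the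
   only ones that [fourier] sees. *)
Definition has_coef u c := csummable c /\
  forall t, cube t -> u (torus_pt t) = fser c (torus_pt t).

Definition wiener u := exists c, has_coef u c.

Lemma has_coef_fourier u c : has_coef u c -> fourier u = c.
Proof. by case=> sc; exact: fourierE. Qed.

Lemma has_coef_wiener u c : has_coef u c -> wiener u.
Proof. by exists c. Qed.

Lemma wienerP u : wiener u -> has_coef u (fourier u).
Proof. by case=> c /[dup] /has_coef_fourier ->. Qed.

Lemma wiener_csumm u : wiener u -> csummable (fourier u).
Proof. by move=> /wienerP []. Qed.

Lemma has_coefD f g a b : has_coef f a -> has_coef g b ->
  has_coef (fun z => f z + g z) (fun k => a k + b k).
Proof.
move=> [sa fa] [sb gb]; split; first exact: csummableD.
by move=> t ct; rewrite fserD ?fa ?gb//; exact: torus_torus_pt.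
Qed.

Lemma has_coefZ f a (x : R[i]) : has_coef f a ->
  has_coef (fun z => x * f z) (fun k => x * a k).
Proof.
move=> [sa fa]; split; first exact: csummableZ.
by move=> t ct; rewrite fserZ ?fa//; exact: torus_torus_pt.
Qed.

Lemma has_coefM f g a b : has_coef f a -> has_coef g b ->
  has_coef (fun z => f z * g z) (convol a b).
Proof.
move=> [sa fa] [sb gb]; split; first exact: csummable_conv.
by move=> t ct; rewrite -fserM ?fa ?gb//; exact: torus_torus_pt.
Qed.

Definition delta0 (k : 'rV[int]_d) : R[i] := (k == 0)%:R.

Lemma has_coef1 : has_coef (fun=> 1) delta0.
Proof.
have d0 k : k \notin [:: 0] -> delta0 k = 0.
  by rewrite mem_seq1 /delta0 => /negbTE ->.
split; first exact: (@csummable_seq _ _ [:: 0]).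
move=> t _; rewrite /fser (@csum_seq _ _ [:: 0])//.
  by rewrite big_seq1 monom0 mulr1 /delta0 eqxx.
by move=> k /d0 ->; rewrite mul0r.
Qed.

Lemma fourier1 : fourier (fun=> 1) = delta0.
Proof. exact: has_coef_fourier has_coef1. Qed.

Lemma wiener1 : wiener (fun=> 1). Proof. exact: has_coef_wiener has_coef1. Qed.

Lemma wienerD f g : wiener f -> wiener g -> wiener (fun z => f z + g z).
Proof. by move=> [a fa] [b gb]; exists (fun k => a k + b k); exact: has_coefD. Qed.

Lemma wienerZ f (x : R[i]) : wiener f -> wiener (fun z => x * f z).
Proof. by move=> [a fa]; exists (fun k => x * a k); exact: has_coefZ. Qed.

Lemma wienerM f g : wiener f -> wiener g -> wiener (fun z => f z * g z).
Proof. by move=> [a fa] [b gb]; exists (convol a b); exact: has_coefM. Qed.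

Lemma wienerX f n : wiener f -> wiener (fun z => f z ^+ n).
Proof.
move=> wf; elim: n => [|n IH]; first exact: wiener1.
have [c [sc hc]] := wienerM wf IH; exists c; split=> // t ct.
by rewrite exprS hc.
Qed.

Lemma fourierD f g : wiener f -> wiener g ->
  fourier (fun z => f z + g z) = (fun k => fourier f k + fourier g k).
Proof. by move=> /wienerP wf /wienerP wg; apply: has_coef_fourier; exact: has_coefD. Qed.

Lemma fourierZ f (x : R[i]) : wiener f ->
  fourier (fun z => x * f z) = (fun k => x * fourier f k).
Proof. by move=> /wienerP wf; apply: has_coef_fourier; exact: has_coefZ. Qed.

Lemma fourierM f g : wiener f -> wiener g ->
  fourier (fun z => f z * g z) = convol (fourier f) (fourier g).
Proof. by move=> /wienerP wf /wienerP wg; apply: has_coef_fourier; exact: has_coefM. Qed.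

Lemma eq_fourier f g : wiener g -> (forall t, cube t -> f (torus_pt t) = g (torus_pt t)) ->
  fourier f = fourier g.
Proof.
move=> /wienerP [sg hg] fg; apply: fourierE => // t ct.
by rewrite fg// hg.
Qed.

Definition norm1 f : \bar R := nsum (fun k => cmod (fourier f k)).

Lemma norm1_ge0 f : (0 <= norm1 f)%E.
Proof. by apply: nsum_ge0 => k; exact: cmod_ge0. Qed.

Lemma norm1D f g : wiener f -> wiener g ->
  (norm1 (fun z => (f z + g z)%R) <= norm1 f + norm1 g)%E.
Proof.
move=> wf wg; rewrite /norm1 fourierD// -nsumD; try by move=> k; exact: cmod_ge0.
by apply: le_nsum => k; exact: ler_cmodD.
Qed.

Lemma norm1M f g : wiener f -> wiener g ->
  (norm1 (fun z => (f z * g z)%R) <= norm1 f * norm1 g)%E.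
Proof.
by move=> wf wg; rewrite /norm1 fourierM//; apply: nsum_conv; exact: wiener_csumm.
Qed.

Lemma wiener_fser c : csummable c -> has_coef (fser c) c.
Proof. by []. Qed.

Lemma fourier_sup_le f (B : R) k : wiener f ->
  (forall t, cube t -> cmod (f (torus_pt t)) <= B) -> cmod (fourier f k) <= B.
Proof.
move=> /wienerP [sf hf] hB; apply: cmod_coef_le => // t ct.
by rewrite -hf// hB.
Qed.

End WienerAlgebra.

Section Weight.
Context {R : realType}.

Lemma l1_normD d (x y : 'rV[R]_d) : l1_norm (x + y) <= l1_norm x + l1_norm y.
Proof.
by rewrite /l1_norm -big_split; apply: ler_sum => i _; rewrite mxE ler_normD.
Qed.

Lemma l1_normN d (x : 'rV[R]_d) : l1_norm (- x) = l1_norm x.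
Proof. by apply: eq_bigr => i _; rewrite mxE normrN. Qed.

Lemma l1_norm_ge0 d (x : 'rV[R]_d) : 0 <= l1_norm x.
Proof. by apply: sumr_ge0. Qed.

Lemma l1_norm0 d : l1_norm (0 : 'rV[R]_d) = 0.
Proof. by rewrite /l1_norm big1// => i _; rewrite mxE normr0. Qed.

Lemma latD d (k l : 'rV[int]_d) : lat (k + l) = lat k + lat l :> 'rV[R]_d.
Proof. by apply/rowP => i; rewrite !mxE rmorphD. Qed.

Lemma latN d (k : 'rV[int]_d) : lat (- k) = - lat k :> 'rV[R]_d.
Proof. by apply/rowP => i; rewrite !mxE rmorphN. Qed.

Lemma lat0 d : lat 0 = 0 :> 'rV[R]_d.
Proof. by apply/rowP => i; rewrite !mxE. Qed.

Lemma powRN_le (alpha a b K : R) : 0 <= alpha -> 0 < a -> 0 < b -> 0 < K ->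
  b <= K * a -> a `^ (- alpha) <= K `^ alpha * b `^ (- alpha).
Proof.
move=> alpha0 a0 b0 K0 ba; rewrite !powRN.
rewrite ler_pdivlMr ?powR_gt0// mulrC ler_pdivrMr ?powR_gt0//.
rewrite -powRM; [|exact: ltW..].
have Ka0 : 0 <= K * a by rewrite mulr_ge0// ltW.
by apply: ge0_ler_powR => //; rewrite ?nnegrE ?ltW.
Qed.

Variable alpha : R.
Hypothesis alpha0 : 0 < alpha.

(** The 1-norm is used throughout, in the exponential case too; the Euclidean hypothesis of part (i)
    enters through [eucl_weight_le], at the price of the factor d^alpha. *)
Definition weight d (x : 'rV[R]_d) : R := (1 + l1_norm x) `^ (- alpha).

Lemma weight_gt0 d (x : 'rV[R]_d) : 0 < weight x.
Proof. by apply: powR_gt0; have := l1_norm_ge0 x; lra. Qed.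

Lemma weight0 d : weight (0 : 'rV[R]_d) = 1.
Proof. by rewrite /weight l1_norm0 addr0 powR1. Qed.

Lemma weightN d (x : 'rV[R]_d) : weight (- x) = weight x.
Proof. by rewrite /weight l1_normN. Qed.

Lemma weight_le d d' (x : 'rV[R]_d) (y : 'rV[R]_d') (K : R) : 0 < K ->
  1 + l1_norm y <= K * (1 + l1_norm x) -> weight x <= K `^ alpha * weight y.
Proof.
by move=> K0 h; apply: powRN_le; rewrite ?ltr_pwDl ?l1_norm_ge0 ?(ltW alpha0).
Qed.

Definition wK : R := 2 `^ alpha.

Lemma wK_ge0 : 0 <= wK. Proof. exact: powR_ge0. Qed.

Lemma weight_split d (x y : 'rV[R]_d) :
  weight x <= wK * weight (x + y) \/ weight y <= wK * weight (x + y).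
Proof.
have [xy|yx] := leP (l1_norm y) (l1_norm x); [left|right]; apply: weight_le => //;
  have := l1_normD x y; lra.
Qed.

(** This makes the lattice convolution of two weights a multiple of the weight: [x + y] stays fixed
    under the sum, and each term of the last factor is summable. *)
Lemma weightM_le d (x y : 'rV[R]_d) :
  weight x * weight y <= wK * weight (x + y) * (weight x + weight y).
Proof.
have [[a0 b0] c0] := (weight_gt0 x, weight_gt0 y, weight_gt0 (x + y)).
move: (weight_split x y) wK_ge0 a0 b0 c0; move: wK => K.
move: (weight x) (weight y) (weight (x + y)) => a b c h K0 a0 b0 c0.
have p1 : 0 <= K * c * a by rewrite !mulr_ge0// ltW.
have p2 : 0 <= K * c * b by rewrite !mulr_ge0// ltW.
rewrite mulrDr; case: h => h.
  have := ler_wpM2r (ltW b0) h; lra.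
have := ler_wpM2r (ltW a0) h; rewrite (mulrC b); lra.
Qed.

End Weight.

(** * Summability of the weight over the lattice *)

Section WeightSummability.
Context {R : realType}.

Lemma nsum_nat_le (g : nat -> R) (B : R) : (forall n, 0 <= g n) ->
  (forall n, \sum_(0 <= i < n) g i <= B) -> (nsum g <= B%:E)%E.
Proof.
move=> g0 gB; rewrite /nsum -nneseries_esumT; last by move=> n; rewrite lee_fin.
apply: lime_le; first by apply: is_cvg_nneseries => n _ _; rewrite lee_fin.
by apply: nearW => n; rewrite sumEFin lee_fin.
Qed.

(** The integral test in discrete form. With y = x + 1, the inequality ln(x/y) <= -1/y and exp(t) >=
    1 + t give (x/y)^(1-s) >= 1 + (s-1)/y, which is then multiplied by y^(1-s). *)
Lemma powR_telescope (s : R) (N : nat) : 1 < s ->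
  (s - 1) * (N.+2%:R `^ (- s)) <= N.+1%:R `^ (1 - s) - N.+2%:R `^ (1 - s) :> R.
Proof.
move=> s1; set x : R := N.+1%:R; set y : R := N.+2%:R.
have x0 : 0 < x by rewrite /x ltr0n.
have yx : y = x + 1 by rewrite /y /x [in LHS]mulrSr.
have y0 : 0 < y by rewrite /y ltr0n.
have lnxy : ln (x / y) <= - y^-1.
  have -> : x / y = 1 + (- y^-1).
    by rewrite (_ : x = y - 1); [field; rewrite gt_eqF|rewrite yx addrK].
  by apply: le_ln1Dx; rewrite ltrNl opprK invf_lt1// yx ltrDr.
have -> : x `^ (1 - s) = y `^ (1 - s) * (x / y) `^ (1 - s).
  rewrite -powRM ?ltW ?divr_gt0//; congr (_ `^ _); field; exact: lt0r_neq0.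
have h1 : 1 + (s - 1) * y^-1 <= (x / y) `^ (1 - s).
  rewrite /powR gt_eqF ?divr_gt0//; apply: le_trans (expR_ge1Dx _).
  rewrite lerD2l (_ : (1 - s) * ln _ = (s - 1) * (- ln (x / y))); last by ring.
  by rewrite ler_pM2l ?subr_gt0// lerNr.
have h2 : y `^ (1 - s) = y * y `^ (- s).
  by rewrite powRD ?(gt_eqF y0) ?implybT// powRr1// ltW.
have yp : 0 < y `^ (1 - s) by exact: powR_gt0.
have := ler_wpM2l (ltW yp) h1.
have -> : y `^ (1 - s) * (1 + (s - 1) * y^-1) = y `^ (1 - s) + (s - 1) * y `^ (- s).
  by rewrite h2; field; exact: lt0r_neq0.
lra.
Qed.

Lemma nsum_nat_powR (s : R) : 1 < s ->
  (nsum (fun n : nat => (1 + n%:R) `^ (- s))%R < +oo)%E.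
Proof.
move=> s1; have s10 : 0 < s - 1 by lra.
apply: (@le_lt_trans _ _ (1 + (s - 1)^-1)%:E); last by rewrite ltry.
apply: nsum_nat_le => [n|n]; first exact: powR_ge0.
(* The subtracted power of [m.+1] makes the induction telescope; it is discarded afterwards. *)
suff H m : \sum_(0 <= i < m.+1) (1 + i%:R) `^ (- s) <=
    1 + (s - 1)^-1 * (1 - m.+1%:R `^ (1 - s)) :> R.
  case: n => [|n]; first by rewrite big_geq// addr_ge0// invr_ge0 ltW.
  by apply: le_trans (H n) _; rewrite lerD2l -[leRHS]mulr1 ler_pM2l ?invr_gt0//.
elim: m => [|m IH].
  by rewrite big_nat1 addr0 !powR1 subrr mulr0 addr0.
rewrite big_nat_recr//=; apply: le_trans (lerD IH (lexx _)) _.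
have := powR_telescope m s1.
rewrite -(ler_pM2l (x := (s - 1)^-1)) ?invr_gt0// mulKf ?gt_eqF//.
by rewrite [1 + m.+1%:R](_ : _ = m.+2%:R); [lra|rewrite [RHS]mulrS].
Qed.

Lemma nsum_int (g : nat -> R) : (forall n, 0 <= g n) -> (nsum g < +oo)%E ->
  (nsum (fun k : int => g `|k|%N) < +oo)%E.
Proof.
move=> g0 goo.
pose e (p : bool * nat) : int := if p.1 then Posz p.2 else Negz p.2.
have be : bijective e.
  exists (fun k => match k with Posz n => (true, n) | Negz n => (false, n) end).
    by case=> -[].
  by case.
rewrite -(@nsum_reindex _ _ _ _ _ be) -nsum_swap.
rewrite (@nsum_fubini _ _ _ (fun (n : nat) (b : bool) => g `|e (b, n)|%N))//.
(* [Negz n] has absolute value [n.+1], so the negative integers contribute the shifted family. *)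
apply: (@le_lt_trans _ _ (nsum (fun n => g n + g n.+1)%R)).
  apply: le_esum => n _; rewrite (@nsum_seq _ _ [:: true; false])//.
    by rewrite big_cons big_seq1.
  by case.
rewrite nsumD//; apply: lte_add_pinfty => //; apply: le_lt_trans goo.
rewrite /nsum -(@esum_image _ _ _ setT S (fun n => (g n)%:E)).
  rewrite [leLHS]esum_mkcond; apply: le_esum => n _.
  by case: ifP; rewrite ?lee_fin.
by move=> x y _ _ [].
Qed.

Lemma nsum_prod (g : int -> R) d : (forall k, 0 <= g k) -> (nsum g < +oo)%E ->
  (nsum (fun k : 'rV[int]_d => \prod_i g (k 0 i))%R < +oo)%E.
Proof.
move=> g0 goo; elim: d => [|d IH].
  rewrite (@nsum_seq _ _ [:: 0]) ?ltry//; last first.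
    move=> k; rewrite mem_seq1 (_ : k = 0) ?eqxx//; apply/rowP; by case.
  by move=> k; apply: prodr_ge0.
have pg0 (k : 'rV[int]_d) : 0 <= \prod_i g (k 0 i) by exact: prodr_ge0.
rewrite -(@nsum_reindex _ _ _ _ _ (@row_cons_bij _ d)).
rewrite (@eq_nsum _ _ _ (fun p : int * 'rV[int]_d => g p.1 * \prod_i g (p.2 0 i))); last first.
  move=> p; rewrite (@big_split_ord _ _ _ 1 d) big_ord1 row_consEl; congr (_ * _).
  by apply: eq_bigr => i _; rewrite row_consEr.
rewrite (@nsum_fubini _ _ _ (fun i (s : 'rV[int]_d) => g i * \prod_j g (s 0 j))); last first.
  by move=> i j; rewrite mulr_ge0.
set S := nsum (fun k : 'rV[int]_d => _) in IH.
have S0 : 0 <= fine S by rewrite fine_ge0// nsum_ge0.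
rewrite (@eq_esum _ _ _ _ (fun i => (fine S * g i)%:E)); last first.
  by move=> i _; rewrite nsumZ// -/S mulrC EFinM -nsumE.
exact: nsumZ_fin.
Qed.

(** The weight is a product of as many equal factors as there are coordinates, each of exponent
    -alpha divided by the dimension. Replacing |k| by |k_i| in the i-th factor leaves a product of
    one-variable families of exponent below -1. *)
Lemma nsum_weight (alpha : R) d : d.+1%:R < alpha ->
  (nsum (fun k : 'rV[int]_d.+1 => weight alpha (lat k)) < +oo)%E.
Proof.
move=> da; have d0 : 0 < d.+1%:R :> R by rewrite ltr0n.
have s1 : 1 < alpha / d.+1%:R by rewrite ltr_pdivlMr// mul1r.
have := nsum_prod d.+1 (fun k => powR_ge0 _ _) (nsum_int (fun n => powR_ge0 _ _) (nsum_nat_powR s1)).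
apply: le_nsum_fin => k; rewrite /weight.
have S0 := l1_norm_ge0 (lat k : 'rV[R]_d.+1).
have -> : (1 + l1_norm (lat k)) `^ (- alpha) =
    \prod_(i < d.+1) (1 + l1_norm (lat k : 'rV[R]_d.+1)) `^ (- (alpha / d.+1%:R)).
  rewrite prodr_const card_ord -powR_mulrn ?powR_ge0// -powRrM; congr (_ `^ _).
  by field; rewrite gt_eqF.
apply: ler_prod => i _; rewrite powR_ge0/= !powRN.
have ki : `|(lat k : 'rV[R]_d.+1) 0 i| <= l1_norm (lat k : 'rV[R]_d.+1).
  by rewrite /l1_norm (bigD1 i)//= lerDl sumr_ge0.
have kiE : `|(lat k : 'rV[R]_d.+1) 0 i| = `|(k 0%R i : int)|%N%:R.
  by rewrite mxE -intr_norm -abszE.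
have a1 : 0 <= alpha / d.+1%:R by rewrite ltW// (lt_trans _ s1).
have p1 : 0 < 1 + l1_norm (lat k : 'rV[R]_d.+1) by lra.
have p2 : 0 < 1 + `|(k 0%R i : int)|%N%:R :> R by rewrite ltr_pwDl.
rewrite lef_pV2 ?posrE ?powR_gt0//.
by apply: ge0_ler_powR; rewrite ?nnegrE ?(ltW p1) ?(ltW p2)// lerD2l -kiE.
Qed.

(** Rounding down moves [x] by at most [d] in the 1-norm, which changes the weight by a bounded
    factor. Sums over a translated lattice thus reduce to [wsum], uniformly in [x]. *)
Lemma weight_round (alpha : R) d : 0 < alpha -> forall x : 'rV[R]_d,
  exists m : 'rV[int]_d, forall k, weight alpha (x - lat k) <=
    (1 + d%:R) `^ alpha * weight alpha (lat (m - k)).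
Proof.
move=> a0 x; exists (\row_i Num.floor (x 0 i)) => k; set m := \row_i _.
have d0 : 0 <= d%:R :> R by [].
apply: weight_le; [exact: a0|by rewrite ltr_pwDl|].
have h : l1_norm (lat m - x) <= d%:R.
  rewrite -[leRHS]mulr1 -[d in leRHS]card_ord mulrC mulr_natr -sumr_const.
  apply: ler_sum => i _; rewrite !mxE.
  have := Num.Theory.floor_le (x 0 i); have := floorD1_gt (x 0 i).
  by rewrite intrD ler_norml; lra.
have : l1_norm (lat (m - k)) <= l1_norm (x - lat k) + d%:R.
  rewrite latD latN (_ : lat m - lat k = (x - lat k) + (lat m - x)); last first.
    by apply/rowP => i; rewrite !mxE; ring.
  by apply: le_trans (l1_normD _ _) _; rewrite lerD2l.
have := mulr_ge0 d0 (l1_norm_ge0 (x - lat k)).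
lra.
Qed.

Definition wsum (alpha : R) d : R :=
  fine (nsum (fun k : 'rV[int]_d => weight alpha (lat k))).

Lemma nsum_weight_shift (alpha : R) d (x : 'rV[R]_d.+1) : d.+1%:R < alpha ->
  (nsum (fun k : 'rV[int]_d.+1 => weight alpha (x - lat k)) <=
    ((1 + d.+1%:R) `^ alpha * wsum alpha d.+1)%:E)%E.
Proof.
move=> da; have a0 : 0 < alpha by apply: lt_trans da; rewrite ltr0n.
have [m hm] := weight_round a0 x.
apply: le_trans (le_nsum hm) _; rewrite nsumZ ?powR_ge0//; last first.
  by move=> k; rewrite ltW// weight_gt0.
have be : bijective (fun k : 'rV[int]_d.+1 => m - k).
  by exists (fun k => m - k) => k; rewrite opprB addrC subrK.
rewrite (@nsum_reindex _ _ _ (fun k => m - k) (fun k => weight alpha (lat k)))//.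
rewrite EFinM -nsumE//; last exact: nsum_weight.
by move=> k; rewrite ltW// weight_gt0.
Qed.

Lemma eucl_le_l1 d (x : 'rV[R]_d) : eucl_norm x <= l1_norm x.
Proof.
rewrite /eucl_norm -(ger0_norm (l1_norm_ge0 x)) -sqrtr_sqr; apply: ler_wsqrtr.
rewrite expr2 {1}/l1_norm mulr_suml; apply: ler_sum => i _.
rewrite -real_normK ?num_real// expr2 ler_wpM2l//.
by rewrite /l1_norm (bigD1 i)//= lerDl sumr_ge0.
Qed.

Lemma l1_le_eucl d (x : 'rV[R]_d) : l1_norm x <= d%:R * eucl_norm x.
Proof.
have -> : d%:R * eucl_norm x = \sum_(i < d) eucl_norm x.
  by rewrite sumr_const card_ord mulr_natl.
apply: ler_sum => i _.
rewrite -sqrtr_sqr; apply: ler_wsqrtr; rewrite (bigD1 i)//= lerDl.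
by apply: sumr_ge0 => j _; exact: sqr_ge0.
Qed.

End WeightSummability.

(** * Spectral radius with respect to weighted coefficients *)

(** Arithmetic of the halving recursion in [decay_geometric]: the halves must be long enough for the
    smallness estimate, and the extra 2 makes both of them proper. *)
Lemma half_bounds (n m : nat) : ((n + n).+2 <= m)%N ->
  [/\ (m./2 < m)%N, (m - m./2 < m)%N, (n <= m./2)%N & (n <= m - m./2)%N].
Proof. by move=> h; split; lia. Qed.

Section Spectral.
Context {R : realType} {n' : nat}.
Notation d := n'.+1.
Variable alpha : R.
Hypothesis da : d%:R < alpha.
Notation w := (fun k : 'rV[int]_d => weight alpha (lat k)).
Implicit Types (f g u p e : 'rV[R[i]]_d -> R[i]) (a b c : 'rV[int]_d -> R[i]).

Let alpha0 : 0 < alpha.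
Proof. by apply: lt_trans da; rewrite ltr0n. Qed.

Let w_gt0 k : 0 < w k. Proof. exact: weight_gt0. Qed.
Let w_ge0 k : 0 <= w k. Proof. by rewrite ltW. Qed.

Notation S := (wsum alpha d).

Lemma wsumE : nsum w = S%:E.
Proof. by rewrite /wsum -nsumE//; exact: nsum_weight. Qed.

Lemma wsum_ge0 : 0 <= S.
Proof. by rewrite -lee_fin -wsumE; exact: nsum_ge0. Qed.

Lemma csummable_weight c (A : R) : (forall k, cmod (c k) <= A * w k) -> csummable c.
Proof.
move=> cA; have A0 : 0 <= A.
  by have := le_trans (cmod_ge0 _) (cA 0); rewrite pmulr_lge0.
apply: csummable_le cA.
by apply: nsumZ_fin => //; exact: nsum_weight.
Qed.

Lemma nsum_weight_le c (A : R) : 0 <= A -> (forall k, cmod (c k) <= A * w k) ->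
  (nsum (fun k => cmod (c k)) <= (A * S)%:E)%E.
Proof.
move=> A0 cA; apply: le_trans (le_nsum cA) _.
by rewrite nsumZ// wsumE.
Qed.

Lemma csub_bij (V : zmodType) (k : V) : bijective (fun l => k - l).
Proof. by exists (fun l => k - l) => l; rewrite opprB addrC subrK. Qed.

Lemma cmod_convol_weight a b (A B Na Nb : R) k :
  0 <= A -> 0 <= B ->
  (forall l, cmod (a l) <= A * w l) -> (forall l, cmod (b l) <= B * w l) ->
  (nsum (fun l => cmod (a l)) <= Na%:E)%E -> (nsum (fun l => cmod (b l)) <= Nb%:E)%E ->
  cmod (convol a b k) <= wK alpha * w k * (A * Nb + B * Na).
Proof.
move=> A0 B0 aA bB aN bN; rewrite -lee_fin; apply: le_trans (cmod_csum _) _.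
have K0 : 0 <= wK alpha * w k by rewrite mulr_ge0// wK_ge0.
set K := wK alpha * w k in K0 *; have KE : K = wK alpha * weight alpha (lat k) by [].
clearbody K.
(* By [weight_split] one of the two terms dominates for each [l]; keeping both spares a partition of
   the lattice. *)
apply: (@le_trans _ _ (nsum (fun l => K * A * cmod (b (k - l)) + K * B * cmod (a l))%R)).
  apply: le_nsum => l; rewrite cmodM.
  have [a0 b0] := (cmod_ge0 (a l), cmod_ge0 (b (k - l))).
  have p1 : 0 <= K * A * cmod (b (k - l)) by rewrite !mulr_ge0.
  have p2 : 0 <= K * B * cmod (a l) by rewrite !mulr_ge0.
  have := weight_split alpha0 (lat l) (lat (k - l)).
  rewrite -latD (_ : l + (k - l) = k); last by rewrite addrC subrK.
  rewrite -KE => -[h|h].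
    have h1 : cmod (a l) <= K * A.
      by apply: le_trans (aA l) _; rewrite mulrC ler_wpM2r.
    by apply: le_trans (ler_wpM2r b0 h1) _; rewrite lerDl.
  have h1 : cmod (b (k - l)) <= K * B.
    by apply: le_trans (bB (k - l)) _; rewrite mulrC ler_wpM2r.
  by apply: le_trans (ler_wpM2l a0 h1) _; rewrite [X in X <= _]mulrC lerDr.
rewrite nsumD; try by move=> l; rewrite !mulr_ge0// cmod_ge0.
rewrite !nsumZ ?mulr_ge0//; try by move=> l; rewrite cmod_ge0.
rewrite (@nsum_reindex _ _ _ (fun l => k - l) (fun l => cmod (b l))); last exact: csub_bij.
apply: (@le_trans _ _ ((K * A)%:E * Nb%:E + (K * B)%:E * Na%:E)%E).
  by apply: leeD; apply: lee_wpmul2l; rewrite ?lee_fin ?mulr_ge0.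
by rewrite -!EFinM -EFinD lee_fin mulrDr !mulrA.
Qed.

Definition decay f (A : R) := forall k, cmod (fourier f k) <= A * w k.

Lemma decay_ge0 f A : decay f A -> 0 <= A.
Proof. by move=> /(_ 0) /(le_trans (cmod_ge0 _)); rewrite pmulr_lge0. Qed.

Lemma decay_norm1 f A : decay f A -> (norm1 f <= (A * S)%:E)%E.
Proof. by move=> fA; apply: nsum_weight_le => //; exact: decay_ge0 fA. Qed.

Lemma decay1 : decay (fun=> 1) 1.
Proof.
move=> k; rewrite fourier1 /delta0 mul1r.
have [->|_] := eqVneq k 0; last by rewrite cmod0.
by rewrite cmod1 lat0 weight0.
Qed.

(** The Wiener norms are bounded separately from [A] and [B]: for powers of u they are already known
    to be geometrically small when the weighted bounds are still to be found. *)
Lemma decayM f g A B Na Nb : wiener f -> wiener g -> decay f A -> decay g B ->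
  (norm1 f <= Na%:E)%E -> (norm1 g <= Nb%:E)%E ->
  decay (fun z => f z * g z) (wK alpha * (A * Nb + B * Na)).
Proof.
move=> wf wg fA gB fN gN k; rewrite fourierM//.
rewrite [leRHS]mulrAC.
by apply: cmod_convol_weight => //; [exact: decay_ge0 fA|exact: decay_ge0 gB].
Qed.

(** Taking roots of order alpha leaves a linear function against the powers of t = s^(1/alpha) > 1,
    which is Bernoulli's inequality. *)
Lemma polynomial_le_exponential (s N : R) : 1 < s -> 0 <= N ->
  exists2 C : R, 0 <= C & forall m : nat, (1 + m%:R * N) `^ alpha <= C * s ^+ m.
Proof.
move=> s1 N0; have s0 : 0 < s by lra.
pose t := s `^ (alpha^-1); pose dl := t - 1.
have t1 : 1 < t.
  have := @gt0_ltr_powR R alpha^-1; rewrite invr_gt0 => /(_ alpha0 1 s).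
  by rewrite powR1; apply; rewrite // nnegrE ltW.
have dl0 : 0 < dl by rewrite /dl; lra.
(* Chosen so that [1 + m%:R * N <= K * (1 + m%:R * dl)] for every [m]. *)
pose K := (1 + N) * (1 + dl^-1).
have K0 : 0 <= K by rewrite mulr_ge0// addr_ge0// invr_ge0 ltW.
exists (K `^ alpha) => [|m]; first exact: powR_ge0.
have -> : s ^+ m = (t ^+ m) `^ alpha.
  rewrite -(powR_mulrn m (ltW (lt_trans ltr01 t1))) powRAC.
  by rewrite /t -[(s `^ _) `^ alpha]powRrM mulVf ?gt_eqF// powRr1 ?powR_mulrn// ltW.
have tm0 : 0 <= t ^+ m by rewrite exprn_ge0//; lra.
have mN : 0 <= m%:R * N by rewrite mulr_ge0.
rewrite -powRM//; apply: ge0_ler_powR; rewrite ?nnegrE ?mulr_ge0 ?addr_ge0 ?(ltW alpha0)//.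
  by rewrite invr_ge0 ltW.
have bern : 1 + m%:R * dl <= t ^+ m.
  elim: (m) => [|l IH]; first by rewrite mul0r addr0 expr0.
  have := ler_wpM2l (ltW (lt_trans ltr01 t1)) IH; rewrite -exprS; apply: le_trans.
  have h : 0 <= l%:R * dl * dl by rewrite !mulr_ge0// ltW.
  have -> : t = 1 + dl by rewrite /dl addrC subrK.
  by rewrite -natr1; lra.
apply: (@le_trans _ _ (K * (1 + m%:R * dl))); last by rewrite ler_wpM2l.
have -> : K * (1 + m%:R * dl) = (1 + N) * (1 + m%:R + m%:R * dl + dl^-1).
  by rewrite /K; field; rewrite gt_eqF.
have h1 : 0 <= m%:R * dl by rewrite mulr_ge0// ltW.
have h2 : 0 <= dl^-1 by rewrite invr_ge0 ltW.
have h3 : 0 <= N * (m%:R * dl) by rewrite mulr_ge0.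
have h4 : 0 <= N * dl^-1 by rewrite mulr_ge0.
have h5 : 0 <= m%:R :> R by [].
lra.
Qed.

Lemma convol_support a b (N M : R) :
  (forall k, N < l1_norm (lat k) -> a k = 0) ->
  (forall k, M < l1_norm (lat k) -> b k = 0) ->
  forall k, N + M < l1_norm (lat k : 'rV[R]_d) -> convol a b k = 0.
Proof.
move=> aN bM k kNM; rewrite /convol (@eq_csum _ _ _ _ (fun=> 0)) ?csum0// => l.
have [lN|/aN ->] := leP (l1_norm (lat l : 'rV[R]_d)) N; last by rewrite mul0r.
rewrite bM ?mulr0//; have := @l1_normD R d (lat l) (lat (k - l)).
by rewrite -latD (_ : l + (k - l) = k); [lra|rewrite addrC subrK].
Qed.

(** The lattice points of the ball of radius iN are not counted: there 1 <= (1 + iN)^alpha w(k), so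
    the sum of the weight, times this power, bounds their number. *)
Lemma norm1_pow_trig p (N Q : R) : wiener p -> 0 <= N -> 0 <= Q ->
  (forall k, N < l1_norm (lat k : 'rV[R]_d) -> fourier p k = 0) ->
  (forall t, cube t -> cmod (p (torus_pt t)) <= Q) ->
  forall i, (norm1 (fun z => p z ^+ i)%R <= ((1 + i%:R * N) `^ alpha * S * Q ^+ i)%:E)%E.
Proof.
move=> wp N0 Q0 pN pQ i.
have supp k : i%:R * N < l1_norm (lat k : 'rV[R]_d) -> fourier (fun z => p z ^+ i) k = 0.
  elim: i k => [|i IH] k.
    rewrite mul0r; have -> : (fun z => p z ^+ 0) = (fun=> 1 : R[i]) by [].
    rewrite fourier1 /delta0; case: eqP => // ->.
    by rewrite lat0 l1_norm0 ltxx.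
  have -> : (fun z => p z ^+ i.+1) = (fun z => p z * p z ^+ i).
    by apply/funext => z; rewrite exprS.
  rewrite fourierM//; last exact: wienerX.
  rewrite -natr1 mulrDl mul1r addrC; exact: convol_support.
have coefQ k : cmod (fourier (fun z => p z ^+ i) k) <= Q ^+ i.
  apply: fourier_sup_le; first exact: wienerX.
  move=> t ct; rewrite cmodX; apply: lerXn2r; rewrite ?nnegrE ?cmod_ge0//.
  exact: pQ.
have iN0 : 0 <= i%:R * N by rewrite mulr_ge0.
rewrite -mulrAC; apply: nsum_weight_le => [|k]; first by rewrite mulr_ge0 ?powR_ge0 ?exprn_ge0.
have [kN|/supp ->] := leP (l1_norm (lat k : 'rV[R]_d)) (i%:R * N); last first.
  by rewrite cmod0 !mulr_ge0 ?powR_ge0 ?exprn_ge0.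
apply: le_trans (coefQ k) _; rewrite [_ * Q ^+ i]mulrC -mulrA ler_peMr ?exprn_ge0//.
rewrite -[leLHS](@weight0 _ alpha d); apply: weight_le; [exact: alpha0|by rewrite ltr_pwDl|].
rewrite l1_norm0 addr0 mulr1; lra.
Qed.

Lemma norm1_geometric u (rho : R) : wiener u -> 0 <= rho < 1 ->
  (forall t, cube t -> cmod (u (torus_pt t)) <= rho) ->
  exists C r : R, [/\ 0 <= C, 0 < r < 1 &
    forall m, (norm1 (fun z => u z ^+ m)%R <= (C * r ^+ m)%:E)%E].
Proof.
move=> wu /andP[rho0 rho1] hu.
(* Spent twice: the sup norm of p is at most Q = rho + eps, and the final rate is q = Q + eps = (1 +
   rho) / 2. *)
pose eps := (1 - rho) / 4; have eps0 : 0 < eps by rewrite /eps; lra.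
have [su huE] := wienerP wu.
have [rr [urr tail]] := nsum_tail (fun k => cmod_ge0 (fourier u k)) su eps0.
pose cp k := if k \in rr then fourier u k else 0.
pose ce k := if k \in rr then 0 else fourier u k.
have scp : csummable cp.
  by apply: le_nsum_fin su => k; rewrite /cp; case: ifP; rewrite ?cmod0 ?cmod_ge0.
have sce : csummable ce.
  by apply: le_nsum_fin su => k; rewrite /ce; case: ifP; rewrite ?cmod0 ?cmod_ge0.
pose p := fser cp; pose e := fser ce.
have [hp he] := (wiener_fser scp, wiener_fser sce).
have [wp we] := (has_coef_wiener hp, has_coef_wiener he).
have ne : (norm1 e <= eps%:E)%E.
  rewrite /norm1 (has_coef_fourier he); apply: le_trans tail; apply: le_nsum => k.
  by rewrite /ce; case: ifP; rewrite ?cmod0.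
have upe t : cube t -> u (torus_pt t) = p (torus_pt t) + e (torus_pt t).
  move=> ct; have tt := torus_torus_pt t; rewrite (huE t ct) /p /e -(fserD scp sce tt).
  have E : fourier u = (fun k => cp k + ce k).
    by apply/funext => k; rewrite /cp /ce; case: ifP; rewrite ?addr0 ?add0r.
  by rewrite {1}E.
have ce_le t : cmod (e (torus_pt t)) <= eps.
  have tt := torus_torus_pt t.
  rewrite -lee_fin; apply: le_trans (cmod_csum _) _; apply: le_trans tail.
  apply: le_nsum => k; rewrite cmodM cmod_monom// mulr1 /ce.
  by case: ifP; rewrite ?cmod0.
pose Q := rho + eps; have Q0 : 0 <= Q by rewrite /Q; lra.
have pQ t : cube t -> cmod (p (torus_pt t)) <= Q.
  move=> ct; have -> : p (torus_pt t) = u (torus_pt t) + (- e (torus_pt t)).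
    by rewrite upe// addrK.
  by apply: le_trans (ler_cmodD _ _) _; rewrite cmodN lerD ?hu.
(* A crude radius: the sum of the norms of all frequencies of p bounds each of them. *)
pose N : R := \sum_(k <- rr) l1_norm (lat k).
have N0 : 0 <= N by apply: sumr_ge0 => k _; exact: l1_norm_ge0.
have pN k : N < l1_norm (lat k : 'rV[R]_d) -> fourier p k = 0.
  rewrite (has_coef_fourier hp) /cp; case: ifP => // krr.
  rewrite ltNge /N (big_rem k)//= lerDl sumr_ge0// => j _; exact: l1_norm_ge0.
pose q := Q + eps; have q01 : 0 < q < 1 by rewrite /q /Q /eps; lra.
have [q0 q1] := andP q01.
(* The factors u are replaced by p + e one at a time. *)
have step M i m : (i + m <= M)%N ->
  (norm1 (fun z => p z ^+ i * u z ^+ m)%R <=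
    ((1 + M%:R * N) `^ alpha * S * (Q ^+ i * q ^+ m))%:E)%E.
  elim: m i => [|m IH] i iM.
    have -> : (fun z => p z ^+ i * u z ^+ 0) = (fun z => p z ^+ i).
      by apply/funext => z; rewrite expr0 mulr1.
    apply: le_trans (norm1_pow_trig wp N0 Q0 pN pQ i) _.
    rewrite lee_fin expr0 mulr1 ler_wpM2r ?exprn_ge0// ler_wpM2r ?wsum_ge0//.
    rewrite addn0 in iM.
    have iN0 : 0 <= i%:R * N by rewrite mulr_ge0.
    have MN0 : 0 <= M%:R * N by rewrite mulr_ge0.
    apply: ge0_ler_powR; rewrite ?nnegrE ?(ltW alpha0) ?addr_ge0//.
    by rewrite lerD2l ler_wpM2r// ler_nat.
  have w1 : wiener (fun z => p z ^+ i.+1 * u z ^+ m) by apply: wienerM; exact: wienerX.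
  have w2 : wiener (fun z => p z ^+ i * u z ^+ m) by apply: wienerM; exact: wienerX.
  have w3 : wiener (fun z => e z * (p z ^+ i * u z ^+ m)) by exact: wienerM.
  have -> : norm1 (fun z => p z ^+ i * u z ^+ m.+1) =
     norm1 (fun z => p z ^+ i.+1 * u z ^+ m + e z * (p z ^+ i * u z ^+ m)).
    rewrite /norm1; congr nsum; apply/funext => k; congr cmod.
    apply: (f_equal (fun h => h k)); apply: eq_fourier; first exact: wienerD.
    by move=> t ct; rewrite !exprS {1}(upe t ct); ring.
  apply: le_trans (norm1D w1 w3) _.
  have iM1 : (i.+1 + m <= M)%N by rewrite addSnnS.
  have iM2 : (i + m <= M)%N by apply: leq_trans iM; rewrite addnS.
  (* Since [M] is fixed, the same factor [X] stands in both recursive bounds, and Q + eps = q closes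
     the induction. *)
  set X := (1 + M%:R * N) `^ alpha * S.
  have h3 : (norm1 (fun z => e z * (p z ^+ i * u z ^+ m))%R <=
      eps%:E * (X * (Q ^+ i * q ^+ m))%:E)%E.
    apply: le_trans (norm1M we w2) _.
    apply: lee_pmul => //; [exact: norm1_ge0|exact: norm1_ge0|exact: IH].
  apply: le_trans (leeD (IH _ iM1) h3) _.
  rewrite -EFinM -EFinD lee_fin -/X !exprS /q le_eqVlt; apply/orP; left; apply/eqP; ring.
(* The gap between q and r absorbs the polynomial factor, which (r/q)^m outgrows. *)
pose r := (1 + q) / 2; have r01 : 0 < r < 1 by rewrite /r; lra.
have [r0 r1] := andP r01.
have s1 : 1 < r / q by rewrite ltr_pdivlMr// mul1r /r; lra.
have [C C0 hC] := polynomial_le_exponential s1 N0.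
exists (C * S), r; split=> //; first by rewrite mulr_ge0// wsum_ge0.
move=> m; have := step m 0%N m (leqnn _).
have -> : (fun z => p z ^+ 0 * u z ^+ m) = (fun z => u z ^+ m).
  by apply/funext => z; rewrite expr0 mul1r.
move=> /le_trans; apply; rewrite lee_fin expr0 mul1r.
have -> : r ^+ m = (r / q) ^+ m * q ^+ m by rewrite -exprMn divfK// gt_eqF.
have Sq : 0 <= S * q ^+ m by rewrite mulr_ge0 ?wsum_ge0 ?exprn_ge0 ?ltW.
rewrite (_ : C * S * _ = C * (r / q) ^+ m * (S * q ^+ m)); last by ring.
by rewrite -mulrA; apply: ler_wpM2r (hC m).
Qed.

Lemma decay_geometric u (A rho : R) : decay u A -> wiener u -> 0 <= rho < 1 ->
  (forall t, cube t -> cmod (u (torus_pt t)) <= rho) ->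
  exists D s : R, [/\ 0 <= D, 0 < s < 1 &
    forall m, decay (fun z => u z ^+ m) (D * s ^+ m)].
Proof.
move=> uA wu rho01 hu.
have [C [r [C0 /andP[r0 r1] hC]]] := norm1_geometric wu rho01 hu.
(* Any rate strictly between r and 1 would do, so that (r/s)^n tends to 0. *)
pose s := (1 + r) / 2; have s0 : 0 < s by rewrite /s; lra.
have s1 : s < 1 by rewrite /s; lra.
(* The factor 2 is for the two terms of [decayM]: once K (r/s)^n <= 1 for both halves, each term is
   at most half of [D * s ^+ m], and [D] does not grow. *)
pose K := wK alpha * C *+ 2; have K0 : 0 <= K by rewrite mulrn_wge0// mulr_ge0// wK_ge0.
have rs0 : 0 <= r / s by rewrite divr_ge0// ltW.
have rs1 : r / s < 1 by rewrite ltr_pdivrMr// mul1r /s; lra.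
have [n0 hn0] : exists n0, K * (r / s) ^+ n0 <= 1.
  have e0 : 0 < (K + 1)^-1 by rewrite invr_gt0; lra.
  have : (r / s) ^+ n @[n --> \oo] --> (0 : R) by apply: cvg_expr; rewrite ger0_norm.
  move=> /cvgrPdist_le /(_ _ e0) [n0 _ /(_ n0 (leqnn _))].
  rewrite sub0r normrN ger0_norm ?exprn_ge0// => h; exists n0.
  apply: le_trans (ler_wpM2l K0 h) _; rewrite ler_pdivrMr; lra.
have hn n : (n0 <= n)%N -> K * (r / s) ^+ n <= 1.
  move=> n0n; apply: le_trans hn0; rewrite ler_wpM2l// ler_wiXn2l// ltW//.
(* Below the threshold no rate is available; the constant absorbs these finitely many powers. *)
have small M : exists2 D : R, 0 <= D & forall m, (m < M)%N -> decay (fun z => u z ^+ m) (D * s ^+ m).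
  have each m : exists2 B : R, 0 <= B & decay (fun z => u z ^+ m) B.
    elim: m => [|m [B B0 IH]].
      by exists 1 => //; exact: decay1.
    have -> : (fun z => u z ^+ m.+1) = (fun z => u z * u z ^+ m).
      by apply/funext => z; rewrite exprS.
    have wm : wiener (fun z => u z ^+ m) by exact: wienerX.
    have h := decayM wu wm uA IH (decay_norm1 uA) (decay_norm1 IH).
    by exists (wK alpha * (A * (B * S) + B * (A * S))) => //; exact: decay_ge0 h.
  elim: M => [|M [D D0 IH]]; first by exists 0.
  have [B B0 hB] := each M.
  exists (D + B / s ^+ M); first by rewrite addr_ge0// divr_ge0// exprn_ge0// ltW.
  have B1 : 0 <= B / s ^+ M by rewrite divr_ge0// exprn_ge0// ltW.
  move=> m; rewrite ltnS leq_eqVlt => /orP[/eqP ->|/IH hm] k.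
    apply: le_trans (hB k) _; rewrite ler_wpM2r// mulrDl divfK ?expf_neq0 ?gt_eqF//.
    by rewrite lerDr mulr_ge0// exprn_ge0// ltW.
  apply: le_trans (hm k) _; rewrite ler_wpM2r// ler_wpM2r ?lerDl//.
  by rewrite exprn_ge0// ltW.
have [D D0 hD] := small (n0 + n0).+2.
exists D, s; split=> //; first by rewrite s0.
elim/ltn_ind => m IH.
have [mn|nm] := ltnP m (n0 + n0).+2; first exact: hD.
pose a := m./2; pose b := (m - a)%N.
have [am bm na nb] := half_bounds nm.
have mab : m = (a + b)%N by rewrite /b subnKC// ltnW.
have -> : (fun z => u z ^+ m) = (fun z => u z ^+ a * u z ^+ b).
  by apply/funext => z; rewrite mab exprD.
move=> k; have := decayM (wienerX a wu) (wienerX b wu) (IH a am) (IH b bm) (hC a) (hC b).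
move=> /(_ k) /le_trans; apply; rewrite ler_wpM2r//.
have E i : r ^+ i = (r / s) ^+ i * s ^+ i by rewrite -exprMn divfK// gt_eqF.
have := hn a na; have := hn b nb; rewrite mab exprD (E a) (E b) /K.
set x := (r / s) ^+ a; set y := (r / s) ^+ b => hy hx.
have sa0 : 0 <= s ^+ a * s ^+ b * D by rewrite !mulr_ge0// exprn_ge0// ltW.
have := ler_wpM2r sa0 hx; have := ler_wpM2r sa0 hy.
rewrite mulr2n; lra.
Qed.

End Spectral.

(** * Power series in the Wiener algebra *)

Section NatSeries.
Context {R : realType}.

(** The bridge from limits of partial sums, in which form the series of [expR], [cos], [sin] and
    [ln] are accessible, to unordered sums. *)
Lemma csum_natP (f : nat -> R[i]) (l : R[i]) : csummable f ->
  (forall e, 0 < e -> exists N, forall n, (N <= n)%N ->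
    cmod (l - \sum_(k < n) f k) <= e) ->
  csum setT f = l.
Proof.
move=> sf fl; apply/eqP; rewrite -subr_eq0; apply/eqP/cmod_eq0/eqP.
rewrite eq_le cmod_ge0 andbT; apply/ler_addgt0Pl => e e0; rewrite addr0.
have e20 : 0 < e / 2 by rewrite divr_gt0.
have [N1 h1] := csum_nat sf e20; have [N2 h2] := fl _ e20.
pose n := maxn N1 N2.
have := h1 n (leq_maxl _ _); have := h2 n (leq_maxr _ _).
set s := \sum_(k < n) f k => hl hs.
have -> : csum setT f - l = (csum setT f - s) + - (l - s) by ring.
by apply: le_trans (ler_cmodD _ _) _; rewrite cmodN; lra.
Qed.

Lemma sum_le_nsum (F : nat -> R) n : (forall k, 0 <= F k) ->
  ((\sum_(k < n) F k)%:E <= nsum F)%E.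
Proof.
move=> F0; rewrite /nsum -nneseries_esumT; last by move=> k; rewrite lee_fin.
rewrite -(big_mkord xpredT F) -sumEFin; apply: nneseries_lim_ge => k _ _.
by rewrite lee_fin.
Qed.

Lemma nsum_nat_shift (F : nat -> R) m : (forall k, 0 <= F k) ->
  (nsum (fun n => if (m <= n)%N then F (n - m)%N else 0%R) <= nsum F)%E.
Proof.
move=> F0; have [Foo|] := ltP (nsum F) +oo%E; last first.
  by rewrite leye_eq => /eqP ->; rewrite leey.
rewrite (nsumE F0 Foo); apply: nsum_nat_le => [k|n]; first by case: ifP.
rewrite -lee_fin -nsumE//; apply: le_trans (sum_le_nsum n F0).
rewrite lee_fin big_mkord; have [mn|nm] := leqP m n; last first.
  rewrite big1 ?sumr_ge0// => i _; rewrite ifF//.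
  by apply/negbTE; rewrite -ltnNge (ltn_trans (ltn_ord i)).
rewrite -(big_mkord xpredT (fun n => if (m <= n)%N then F (n - m)%N else 0)).
rewrite (big_cat_nat (leq0n m) mn)/= big_nat_cond big1 ?add0r; last first.
  by move=> i /andP[/andP[_ im] _]; rewrite leqNgt im.
rewrite -[m in leLHS]add0n big_addn.
under eq_bigr do rewrite leq_addl addnK.
rewrite big_mkord -[in leRHS](subnK mn) big_split_ord/=.
by rewrite lerDl sumr_ge0.
Qed.

Lemma csummable_nat_shift (F : nat -> R[i]) m : csummable F ->
  csummable (fun n => if (m <= n)%N then F (n - m)%N else 0).
Proof.
apply: le_lt_trans; apply: le_trans (nsum_nat_shift m (fun k => cmod_ge0 (F k))).
by apply: le_nsum => n; case: ifP; rewrite ?cmod0.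
Qed.

Lemma csum_nat_shift (F : nat -> R[i]) m : csummable F ->
  csum setT (fun n => if (m <= n)%N then F (n - m)%N else 0) = csum setT F.
Proof.
move=> sF; apply: csum_natP; first exact: csummable_nat_shift.
move=> e e0; have [N hN] := csum_nat sF e0.
exists (N + m)%N => n Nn; have mn : (m <= n)%N by apply: leq_trans Nn; exact: leq_addl.
have -> : \sum_(k < n) (if (m <= k)%N then F (k - m)%N else 0) = \sum_(k < n - m) F k.
  rewrite -(big_mkord xpredT (fun n => if (m <= n)%N then F (n - m)%N else 0)).
  rewrite (big_cat_nat (leq0n m) mn)/= big_nat_cond big1 ?add0r; last first.
    by move=> i /andP[/andP[_ im] _]; rewrite leqNgt im.
  rewrite -[m in LHS]add0n big_addn big_mkord add0n.
  by apply: eq_bigr => i _; rewrite leq_addl addnK.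
by apply: hN; rewrite leq_subRL// addnC.
Qed.

Lemma nsum_exp_coeff (x : R) : 0 <= x -> (nsum (fun m : nat => x ^+ m / m`!%:R)%R < +oo)%E.
Proof.
move=> x0; apply: (@le_lt_trans _ _ (expR x)%:E); last by rewrite ltry.
apply: nsum_nat_le => n; first by rewrite divr_ge0// exprn_ge0.
have -> : \sum_(0 <= i < n) x ^+ i / i`!%:R = series (exp_coeff x) n by [].
apply: nondecreasing_cvgn_le; last exact: is_cvg_series_exp_coeff.
by apply: nondecreasing_series => i _ _; exact: exp_coeff_ge0.
Qed.

(** The functional calculus needs the exponential as a power series, whereas [cexp] is given by real
    functions; [cexpE] identifies the two. *)
Definition expc (z : R[i]) : R[i] := csum setT (fun m : nat => z ^+ m / m`!%:R).

Lemma cmod_fact m : cmod (m`!%:R : R[i]) = m`!%:R.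
Proof. by rewrite -(rmorph_nat (real_complex R)) cmodR normr_nat. Qed.

Lemma csummable_expc z : csummable (fun m : nat => z ^+ m / m`!%:R : R[i]).
Proof.
apply: csummable_le (nsum_exp_coeff (cmod_ge0 z)) _ => m.
by rewrite cmodM cmodX cmodV cmod_fact.
Qed.

Lemma expcD z w : expc (z + w) = expc z * expc w.
Proof.
pose F w m : R[i] := w ^+ m / m`!%:R.
(* Cauchy product, with n the total degree. Extending the triangle by 0 lets both orders of
   summation run over all of [nat]: fixed n gives the binomial formula, fixed m a shifted
   exponential series. *)
pose g m n : R[i] := if (m <= n)%N then F z m * F w (n - m)%N else 0.
have gE m n : g m n = F z m * (if (m <= n)%N then F w (n - m)%N else 0).
  by rewrite /g; case: ifP; rewrite ?mulr0.
have sg : csummable (fun p => g p.1 p.2).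
  apply: csummable_fubini.
  pose A := nsum (fun m => cmod (F w m)).
  have Afin : A = (fine A)%:E by apply: nsumE (csummable_expc w) => m; exact: cmod_ge0.
  apply: (@le_lt_trans _ _ (nsum (fun m => fine A * cmod (F z m))%R)).
    apply: le_esum => m _; under eq_nsum do rewrite gE cmodM.
    rewrite nsumZ ?cmod_ge0//; last by move=> k; exact: cmod_ge0.
    rewrite mulrC EFinM -Afin; apply: lee_wpmul2l; first by rewrite lee_fin cmod_ge0.
    apply: le_trans (nsum_nat_shift m (fun k => cmod_ge0 (F w k))).
    by apply: le_nsum => n; case: ifP; rewrite ?cmod0.
  apply: nsumZ_fin; last exact: csummable_expc.
    by rewrite fine_ge0// nsum_ge0// => k; exact: cmod_ge0.
  by move=> k; exact: cmod_ge0.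
transitivity (csum setT (fun n => csum setT (fun m => g m n))).
  apply: eq_csum => n; rewrite (@csum_seq _ _ (iota 0 n.+1)) ?iota_uniq//; last first.
    move=> m; rewrite mem_iota/= add0n ltnS => /negbTE mn; by rewrite /g mn.
  have -> : iota 0 n.+1 = index_iota 0 n.+1 by rewrite /index_iota subn0.
  rewrite big_mkord [z + w]addrC exprDn mulr_suml; apply: eq_bigr => i _.
  have iN : (i <= n)%N by rewrite -ltnS.
  rewrite /g iN /F -mulr_natr.
  have fn k : k`!%:R != 0 :> R[i] by rewrite pnatr_eq0 -lt0n fact_gt0.
  have bn : 'C(n, i)%:R != 0 :> R[i] by rewrite pnatr_eq0 -lt0n bin_gt0.
  rewrite -(bin_fact iN) !natrM; field.
  by rewrite !fn bn.
rewrite -(csum_swap sg) [RHS]mulrC -csumZ; last exact: csummable_expc.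
apply: eq_csum => m; under eq_csum do rewrite gE.
have sw : csummable (F w) by exact: csummable_expc.
by rewrite (csumZ _ (csummable_nat_shift m sw)) (csum_nat_shift m sw) [RHS]mulrC.
Qed.

Lemma cvg_series_close (u : nat -> R) (l : R) : series u @ \oo --> l ->
  forall e, 0 < e -> exists N, forall n, (N <= n)%N -> `|l - \sum_(k < n) u k| <= e.
Proof.
move=> /cvgrPdist_le ul e e0; have [N _ hN] := ul _ e0.
exists N => n Nn; have := hN n Nn; by rewrite /series /= big_mkord.
Qed.

Lemma expcR (x : R) : expc x%:C%C = (expR x)%:C%C.
Proof.
apply: csum_natP; first exact: csummable_expc.
move=> e e0; have [N hN] := cvg_series_close (is_cvg_series_exp_coeff x) e0.
exists N => n /hN; rewrite -cmodR rmorphB rmorph_sum/=; apply: le_trans.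
rewrite -[expR x]/(lim (series (exp_coeff x) @ \oo)).
rewrite le_eqVlt; apply/orP; left; apply/eqP; congr (cmod (_ - _)).
by apply: eq_bigr => i _; rewrite /exp_coeff/= rmorphM fmorphV rmorphXn rmorph_nat.
Qed.

(** Even powers of iy are real and odd ones imaginary, so the parity of k decides which of the two
    coefficients survives. *)
Lemma imag_pow (y : R) k :
  (0 +i* y)%C ^+ k / k`!%:R = (cos_coeff y k +i* sin_coeff y k)%C.
Proof.
have sq m : (0 +i* y)%C ^+ m.*2 = ((-1) ^+ m * y ^+ m.*2)%:C%C.
  rewrite -mul2n exprM (_ : (0 +i* y)%C ^+ 2 = (- y ^+ 2)%:C%C); last first.
    by rewrite expr2; apply: complex_eqP; rewrite ?cReM ?cImM /=; ring.
  by rewrite -rmorphXn (exprNn (y ^+ 2)) -exprM.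
have fE : (k`!%:R : R[i])^-1 = (k`!%:R^-1 : R)%:C%C by rewrite fmorphV rmorph_nat.
rewrite fE /cos_coeff /sin_coeff /= -!exprnP; move: (k`!%:R^-1) => X.
have := odd_double_half k; case: (odd k) => /= kE; rewrite -kE ?add0n.
  by rewrite exprS sq /= ?add0n ?doubleK; apply: complex_eqP; rewrite ?cReM ?cImM/= exprS; ring.
by rewrite sq !doubleK; apply: complex_eqP; rewrite ?cReM ?cImM/=; ring.
Qed.

Lemma expc_imag (y : R) : expc (0 +i* y)%C = (cos y +i* sin y)%C.
Proof.
apply: csum_natP; first exact: csummable_expc.
move=> e e0; have e20 : 0 < e / 2 by rewrite divr_gt0.
have := cvg_series_close (@is_cvg_series_cos_coeff R y) e20.
have := cvg_series_close (@is_cvg_series_sin_coeff R y) e20.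
move=> [N1 h1] [N2 h2].
exists (maxn N1 N2) => n; rewrite geq_max => /andP[/h1 {}h1 /h2 {}h2].
apply: le_trans (ler_cmod_ReIm _) _.
have E : \sum_(k < n) (0 +i* y)%C ^+ k / k`!%:R =
   ((\sum_(k < n) cos_coeff y k) +i* (\sum_(k < n) sin_coeff y k))%C.
  elim: (n) => [|m IH]; first by rewrite !big_ord0.
  by rewrite !big_ord_recr /= IH imag_pow.
rewrite E cReD cImD cReN cImN /= cos.unlock sin.unlock.
by have := lerD h1 h2; rewrite -splitr addrC.
Qed.

Lemma cexpE (z : R[i]) : cexp z = expc z.
Proof.
case: z => x y; have -> : (x +i* y)%C = x%:C%C + (0 +i* y)%C.
  by apply: complex_eqP; rewrite ?cReD ?cImD/= ?addr0 ?add0r.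
rewrite expcD expcR expc_imag.
by apply: complex_eqP; rewrite /cexp ?cReM ?cImM /= addr0 add0r; ring.
Qed.

End NatSeries.

(** * The logarithm series *)

Section LnSeries.
Context {R : realType}.

(** The derivative of -ln(1 - y) is a geometric series, from which the sum removes the first N
    terms. *)
Lemma is_derive_ln_tail (N : nat) (y : R) : y < 1 ->
  is_derive y 1 (fun y => - ln (1 - y) - \sum_(i < N) y ^+ i.+1 / i.+1%:R)
    (y ^+ N / (1 - y)).
Proof.
move=> y1; have y0 : 0 < 1 - y by rewrite subr_gt0.
elim: N => [|N IH].
  rewrite (_ : (fun y => _) = (fun y => - ln (1 - y))); last first.
    by apply/funext => t; rewrite big_ord0 subr0.
  have dl := @is_derive1_ln R (1 - y) y0.
  have d1 : is_derive y 1 (fun t : R => 1 - t) (-1).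
    by apply: is_derive_eq; ring.
  have d2 := @is_derive1_comp R (@ln R) (fun t => 1 - t) y _ _ dl d1.
  apply: (is_derive_eq (is_deriveN d2)).
  by rewrite expr0; ring.
have n0 : N.+1%:R != 0 :> R by rewrite pnatr_eq0.
have dp : is_derive y 1 (fun t : R => t ^+ N.+1 / N.+1%:R) (y ^+ N).
  have dX := @is_deriveX R R id N.+1 y 1 1 (is_derive_id y 1).
  have dZ := @is_deriveZ R R R _ N.+1%:R^-1 y 1 _ dX.
  have -> : (fun t : R => t ^+ N.+1 / N.+1%:R) = N.+1%:R^-1 \*: (id ^+ N.+1 : R -> R).
    by apply/funext => t; rewrite /= fctE [RHS]mulrC.
  by apply: (is_derive_eq dZ); rewrite /GRing.scale/= mulr1 mulKf.
rewrite (_ : (fun y => _) = (fun y => - ln (1 - y) - \sum_(i < N) y ^+ i.+1 / i.+1%:R)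
   \- (fun t => t ^+ N.+1 / N.+1%:R)); last first.
  by apply/funext => t /=; rewrite big_ord_recr/= opprD addrA.
apply: (is_derive_eq (is_deriveB IH dp)).
by rewrite exprS; field; rewrite gt_eqF.
Qed.

(** Mean value theorem on [0, x]: the remainder vanishes at 0, and its derivative is increasing,
    hence controlled by its value at rho. *)
Lemma ln_series_tail (N : nat) (x rho : R) : 0 <= x <= rho -> rho < 1 ->
  `|- ln (1 - x) - \sum_(i < N) x ^+ i.+1 / i.+1%:R| <= rho ^+ N / (1 - rho).
Proof.
move=> /andP[x0 xr] r1; have x1 : x < 1 by exact: le_lt_trans r1.
have r0 : 0 <= rho by exact: le_trans xr.
pose g (y : R) := - ln (1 - y) - \sum_(i < N) y ^+ i.+1 / i.+1%:R.
have dg (y : R) : y <= x -> is_derive y 1 g (y ^+ N / (1 - y)).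
  by move=> yx; apply: is_derive_ln_tail; exact: le_lt_trans yx x1.
have cg : {within `[0, x], continuous g}.
  apply: derivable_within_continuous => y; rewrite in_itv/= => /andP[_ yx].
  by case: (dg y yx).
have [|c cx] := @MVT_segment R g (fun y => y ^+ N / (1 - y)) 0 x x0 _ cg.
  by move=> y; rewrite in_itv/= => /andP[_ /ltW]; exact: dg.
have g0 : g 0 = 0.
  rewrite /g subr0 ln1 oppr0 sub0r big1 ?oppr0// => i _.
  by rewrite expr0n mul0r.
rewrite g0 !subr0 -/(g x) => ->.
move: cx; rewrite in_itv/= => /andP[c0 cx].
have c1 : 0 < 1 - c by rewrite subr_gt0; exact: le_lt_trans cx x1.
have cr : c <= rho by exact: le_trans xr.
have q0 : 0 <= c ^+ N / (1 - c) by rewrite divr_ge0 ?exprn_ge0// ltW.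
rewrite ger0_norm ?(mulr_ge0 q0 x0)// -[leRHS]mulr1.
apply: ler_pM => //; last exact: ltW.
apply: ler_pM; rewrite ?exprn_ge0 ?invr_ge0 ?(ltW c1)//.
  by apply: lerXn2r; rewrite ?nnegrE.
have r10 : 0 < 1 - rho by rewrite subr_gt0.
by rewrite lef_pV2 ?posrE// lerB.
Qed.

Lemma geometric_sum_le (s : R) n : 0 <= s < 1 -> \sum_(0 <= i < n) s ^+ i <= (1 - s)^-1.
Proof.
move=> /andP[s0 s1]; have s10 : 0 < 1 - s by rewrite subr_gt0.
suff -> : \sum_(0 <= i < n) s ^+ i = (1 - s ^+ n) / (1 - s).
  by rewrite -[leRHS]mul1r ler_pM2r ?invr_gt0// gerBl exprn_ge0.
elim: n => [|n IH]; first by rewrite big_geq// expr0 subrr mul0r.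
rewrite big_nat_recr//= IH exprS; field; exact: lt0r_neq0.
Qed.

Lemma nsum_geometric (s : R) : 0 <= s < 1 -> (nsum (fun m : nat => s ^+ m)%R < +oo)%E.
Proof.
move=> s01; apply: (@le_lt_trans _ _ ((1 - s)^-1)%:E); last by rewrite ltry.
apply: nsum_nat_le => n; first by rewrite exprn_ge0//; case/andP: s01.
exact: geometric_sum_le.
Qed.

(* [ln_coeff 0 = 0], since [0^-1 = 0]. *)
Definition ln_coeff (m : nat) : R[i] := (m%:R^-1 : R)%:C%C.

Lemma cmod_ln_coeff m : cmod (ln_coeff m) <= 1.
Proof.
rewrite /ln_coeff cmodR ger0_norm ?invr_ge0//; case: m => [|m].
  by rewrite invr0.
by rewrite invf_le1 ?ler1n// ltr0n.
Qed.

Lemma ln_series (x : R) : 0 <= x < 1 ->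
  csum setT (fun m : nat => ln_coeff m * x%:C%C ^+ m) = (- ln (1 - x))%:C%C.
Proof.
move=> x01; have /andP[x0 x1] := x01.
have s10 : 0 < 1 - x by rewrite subr_gt0.
apply: csum_natP.
  apply: csummable_le (nsum_geometric x01) _ => m.
  rewrite cmodM cmodX cmodR ger0_norm// ler_piMl ?exprn_ge0//; exact: cmod_ln_coeff.
move=> e e0; have e1 : 0 < e * (1 - x) by rewrite mulr_gt0.
have : x ^+ n @[n --> \oo] --> (0 : R) by apply: cvg_expr; rewrite ger0_norm.
move=> /cvgrPdist_le /(_ _ e1) [N _ hN]; exists N.+1 => -[//|n] Nn.
have -> : \sum_(k < n.+1) ln_coeff k * x%:C%C ^+ k = (\sum_(i < n) x ^+ i.+1 / i.+1%:R)%:C%C.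
  rewrite big_ord_recl /ln_coeff invr0 mul0r add0r rmorph_sum.
  by apply: eq_bigr => i _; rewrite -rmorphXn -rmorphM mulrC.
rewrite -rmorphB cmodR; apply: le_trans (@ln_series_tail n x x _ x1) _.
  by rewrite x0 lexx.
rewrite ler_pdivrMr//; have := hN n Nn.
by rewrite sub0r normrN ger0_norm// exprn_ge0.
Qed.

End LnSeries.

(** * Logarithm and exponential of functions with decaying coefficients *)

Section FunctionalCalculus.
Context {R : realType} {n' : nat}.
Notation d := n'.+1.
Variable alpha : R.
Hypothesis da : d%:R < alpha.
Notation w := (fun k : 'rV[int]_d => weight alpha (lat k)).
Notation decay := (@decay R n' alpha).
Notation S := (wsum alpha d).
Implicit Types (f g u : 'rV[R[i]]_d -> R[i]) (a : nat -> R[i]).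

Let alpha0 : 0 < alpha.
Proof. by apply: lt_trans da; rewrite ltr0n. Qed.

Let w_gt0 k : 0 < w k. Proof. exact: weight_gt0. Qed.
Let w_ge0 k : 0 <= w k. Proof. by rewrite ltW. Qed.

Lemma decayD f g A B : wiener f -> wiener g -> decay f A -> decay g B ->
  decay (fun z => f z + g z) (A + B).
Proof.
move=> wf wg fA gB k; rewrite fourierD//; apply: le_trans (ler_cmodD _ _) _.
by rewrite mulrDl lerD.
Qed.

Lemma decayZ f (x : R[i]) A : wiener f -> decay f A ->
  decay (fun z => x * f z) (cmod x * A).
Proof.
by move=> wf fA k; rewrite fourierZ// cmodM -mulrA ler_wpM2l ?cmod_ge0.
Qed.

Section PowerSeries.
Variables (u : 'rV[R[i]]_d -> R[i]) (a : nat -> R[i]) (B : nat -> R).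
Hypotheses (wu : wiener u) (uB : forall m, decay (fun z => u z ^+ m) (B m)).
Hypothesis aB : (nsum (fun m => cmod (a m) * B m)%R < +oo)%E.

Let B0 m : 0 <= B m. Proof. exact: decay_ge0 (uB m). Qed.
Let aB0 m : 0 <= cmod (a m) * B m. Proof. by rewrite mulr_ge0 ?cmod_ge0. Qed.

(** The coefficients of the sum of [a m * u ^+ m], summed over [m] frequency by frequency. The
    hypothesis [aB] is met by geometric bounds for the logarithm and, thanks to the factorials, by
    powers of any constant for the exponential. *)
Definition series_coef (k : 'rV[int]_d) : R[i] :=
  csum setT (fun m => a m * fourier (fun z => u z ^+ m) k).

Let bound := fine (nsum (fun m => cmod (a m) * B m)).

Lemma nsum_series_coef k :
  (nsum (fun m => cmod (a m * fourier (fun z => u z ^+ m) k)%R) <= (bound * w k)%:E)%E.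
Proof.
apply: (@le_trans _ _ (nsum (fun m => w k * (cmod (a m) * B m)))).
  apply: le_nsum => m; rewrite cmodM [leRHS]mulrC -mulrA ler_wpM2l ?cmod_ge0//.
  exact: uB.
by rewrite nsumZ// [bound * _]mulrC EFinM /bound -nsumE.
Qed.

Lemma cmod_series_coef k : cmod (series_coef k) <= bound * w k.
Proof.
by rewrite -lee_fin; apply: le_trans (cmod_csum _) (nsum_series_coef k).
Qed.

Lemma fser_series_coef t : cube t ->
  fser series_coef (torus_pt t) = csum setT (fun m => a m * u (torus_pt t) ^+ m).
Proof.
move=> ct; have tt := torus_torus_pt t.
pose F k m := a m * fourier (fun z => u z ^+ m) k * monom (torus_pt t) k.
have b0 : 0 <= bound by rewrite fine_ge0// nsum_ge0.
have sF : csummable (fun p => F p.1 p.2).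
  apply: csummable_fubini.
  apply: (@le_lt_trans _ _ (nsum (fun k => bound * w k))).
    apply: le_esum => k _; apply: le_trans (nsum_series_coef k).
    by apply: le_nsum => m; rewrite /F cmodM (cmod_monom k tt) mulr1.
  by apply: nsumZ_fin => //; exact: nsum_weight.
transitivity (csum setT (fun k => csum setT (F k))).
  rewrite /fser; apply: eq_csum => k; rewrite mulrC /series_coef -csumZ.
    by apply: eq_csum => m; rewrite /F mulrC.
  by apply: le_lt_trans (nsum_series_coef k) _; rewrite ltry.
rewrite (csum_swap sF); apply: eq_csum => m; rewrite /F.
have [su hu] := wienerP (wienerX m wu).
rewrite (hu t ct) /fser -csumZ; last exact: csummable_fser.
by apply: eq_csum => k; rewrite mulrA.
Qed.

Lemma csummable_series_coef : csummable series_coef.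
Proof. exact: (csummable_weight da cmod_series_coef). Qed.

Lemma has_coef_series f :
  (forall t, cube t -> f (torus_pt t) = csum setT (fun m => a m * u (torus_pt t) ^+ m)) ->
  has_coef f series_coef.
Proof.
move=> hf; split; first exact: csummable_series_coef.
by move=> t ct; rewrite (fser_series_coef ct) hf.
Qed.

End PowerSeries.

(** For the cardinal symbol as [s], the function [L] is convertible to [log_omega]. *)
Lemma ln_decay s (A mu M : R) (x : 'rV[R]_d -> R) : wiener s -> decay s A -> 0 < mu ->
  (forall t, cube t -> s (torus_pt t) = (x t)%:C%C /\ mu <= x t <= M) ->
  let L z := (ln (Re (s z)^-1))%:C%C in
  exists2 B, wiener L & decay L B.
Proof.
move=> ws sA mu0 hs L.
have c0 : cube (0 : 'rV[R]_d) by move=> i; rewrite mxE lexx ler01.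
have [_ /andP[mx0 xM0]] := hs 0 c0.
have M0 : 0 < M by apply: lt_le_trans (le_trans mx0 xM0).
have muM : mu <= M by exact: le_trans xM0.
(* This is 1 - s/M, written so that [decayD] and [decayZ] apply. *)
pose u z := 1 + (- M^-1)%:C%C * s z.
have wu : wiener u by apply: wienerD; [exact: wiener1|exact: wienerZ].
have ut t : cube t -> u (torus_pt t) = (1 - x t / M)%:C%C.
  move=> ct; rewrite /u; have [-> _] := hs t ct.
  by rewrite -rmorphM -(rmorph1 (real_complex R)) -rmorphD mulNr mulrC.
have ur t : cube t -> 0 <= 1 - x t / M <= 1 - mu / M.
  move=> ct; have [_ /andP[h1 h2]] := hs t ct.
  rewrite subr_ge0 ler_pdivrMr// mul1r h2 lerD2l lerN2 ler_pM2r ?invr_gt0//.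
have rho01 : 0 <= 1 - mu / M < 1.
  by rewrite subr_ge0 ler_pdivrMr// mul1r muM gtrBl divr_gt0.
have uA : decay u _ :=
  decayD (@wiener1 R d) (wienerZ (- M^-1)%:C%C ws) (@decay1 R n' alpha)
    (decayZ (- M^-1)%:C%C ws sA).
have [D [q [D0 q01 hD]]] : exists D q : R, [/\ 0 <= D, 0 < q < 1 &
    forall m, decay (fun z => u z ^+ m) (D * q ^+ m)].
  apply: (decay_geometric da uA wu rho01) => t ct.
  by rewrite ut// cmodR; have /andP[h1 h2] := ur t ct; rewrite ger0_norm.
have /andP[q0 q1] := q01.
have hsum : (nsum (fun m => cmod (ln_coeff m : R[i]) * (D * q ^+ m))%R < +oo)%E.
  have : (nsum (fun m => D * q ^+ m)%R < +oo)%E.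
    apply: nsumZ_fin => //; first by move=> m; rewrite exprn_ge0// ltW.
    by apply: nsum_geometric; rewrite q1 ltW.
  apply: le_nsum_fin => m; rewrite ler_piMl ?cmod_ln_coeff//.
  by rewrite mulr_ge0// exprn_ge0// ltW.
pose f (z : 'rV[R[i]]_d) := csum setT (fun m => ln_coeff m * u z ^+ m) : R[i].
have hf : has_coef f (series_coef u (@ln_coeff R)) by exact: (has_coef_series wu hD hsum).
(* From s = M (1 - u): log(1/s) = -log(1 - u) - log M. *)
pose g (z : 'rV[R[i]]_d) := f z + (- ln M)%:C%C * 1.
have wg : wiener g.
  by apply: wienerD; [exact: has_coef_wiener hf|apply: wienerZ; exact: wiener1].
have Lg t : cube t -> L (torus_pt t) = g (torus_pt t).
  move=> ct; rewrite /L /g /f ut//; have /andP[u0 u1] := ur t ct.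
  have [-> /andP[h1 h2]] := hs t ct.
  have x0 : 0 < x t by exact: lt_le_trans h1.
  rewrite ln_series; last by rewrite u0 (le_lt_trans u1)//; case/andP: rho01.
  rewrite -fmorphV /= mulr1 -rmorphD; congr (_%:C)%C.
  have -> : 1 - (1 - x t / M) = x t / M by ring.
  by rewrite ln_div ?posrE// lnV ?posrE//; ring.
have [sg hg] := wienerP wg.
exists (fine (nsum (fun m => cmod (ln_coeff m : R[i]) * (D * q ^+ m))) + cmod (- ln M)%:C%C * 1).
  by exists (fourier g); split=> // t ct; rewrite Lg// hg.
move=> k; rewrite (eq_fourier wg Lg).
apply: decayD; [exact: has_coef_wiener hf|apply: wienerZ; exact: wiener1| |].
  move=> l; rewrite (has_coef_fourier hf); exact: (cmod_series_coef hD hsum).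
by apply: decayZ; [exact: wiener1|exact: decay1].
Qed.

(** Determined by [A], alpha and the dimension, so the bound obtained for gamma is the same for all
    half-spaces. *)
Definition exp_bound (A : R) : R :=
  fine (nsum (fun m : nat => (2 * wK alpha * S * A) ^+ m / m`!%:R)).

Section Exponential.
Variables (u : 'rV[R[i]]_d -> R[i]) (A : R).
Hypotheses (wu : wiener u) (uA : decay u A).

Let A0 : 0 <= A. Proof. exact: decay_ge0 uA. Qed.

Let E0 : 0 <= 2 * wK alpha * S * A.
Proof. by rewrite !mulr_ge0 ?wK_ge0 ?wsum_ge0. Qed.

(** Both terms of [decayM] equal wK * S * A times the previous bound, whence the base with its
    factor 2. No smallness is sought here. *)
Lemma decayX m : decay (fun z => u z ^+ m) ((2 * wK alpha * S * A) ^+ m).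
Proof.
elim: m => [|m IH]; first by rewrite expr0; exact: decay1.
have -> : (fun z => u z ^+ m.+1) = (fun z => u z * u z ^+ m).
  by apply/funext => z; rewrite exprS.
set E := _ * A in IH *.
have := decayM da wu (wienerX m wu) uA IH (decay_norm1 da uA) (decay_norm1 da IH).
have -> // : wK alpha * (A * (E ^+ m * S) + E ^+ m * (A * S)) = E ^+ m.+1.
by rewrite exprS {3}/E; ring.
Qed.

Let ec (m : nat) : R[i] := (m`!%:R)^-1.

Let ecE m : cmod (ec m) * (2 * wK alpha * S * A) ^+ m = (2 * wK alpha * S * A) ^+ m / m`!%:R.
Proof. by rewrite /ec cmodV cmod_fact mulrC. Qed.

Lemma has_coef_exp : has_coef (fun z => cexp (u z)) (series_coef u ec).
Proof.
apply: (has_coef_series wu decayX).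
  by under eq_nsum do rewrite ecE; exact: nsum_exp_coeff.
by move=> t ct; rewrite cexpE; apply: eq_csum => m; rewrite mulrC.
Qed.

Lemma exp_wiener : wiener (fun z => cexp (u z)).
Proof. exact: has_coef_wiener has_coef_exp. Qed.

Lemma exp_decay : decay (fun z => cexp (u z)) (exp_bound A).
Proof.
move=> k; rewrite (has_coef_fourier has_coef_exp).
have h : (nsum (fun m => cmod (ec m) * (2 * wK alpha * S * A) ^+ m)%R < +oo)%E.
  by under eq_nsum do rewrite ecE; exact: nsum_exp_coeff.
apply: le_trans (cmod_series_coef decayX h k) _.
by under eq_nsum do rewrite ecE.
Qed.

(** H is an additive monoid, so the spectrum of every power of [u] stays in H. *)
Lemma exp_support (H : set 'rV[int]_d) : H 0 ->
  (forall k l, H k -> H l -> H (k + l)) ->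
  (forall k, ~ H k -> fourier u k = 0) ->
  forall k, ~ H k -> fourier (fun z => cexp (u z)) k = 0.
Proof.
move=> H0 HD Hu k Hk; rewrite (has_coef_fourier has_coef_exp) /series_coef.
have pw m l : ~ H l -> fourier (fun z => u z ^+ m) l = 0.
  elim: m l => [|m IH] l Hl.
    have -> : (fun z => u z ^+ 0) = (fun=> 1 : R[i]) by [].
    by rewrite fourier1 /delta0; case: eqP => // l0; rewrite l0 in Hl.
  have -> : (fun z => u z ^+ m.+1) = (fun z => u z * u z ^+ m).
    by apply/funext => z; rewrite exprS.
  rewrite fourierM//; last exact: wienerX.
  rewrite /convol (@eq_csum _ _ _ _ (fun=> 0)) ?csum0// => j.
  have [Hj|/Hu ->] := pselect (H j); last by rewrite mul0r.
  rewrite IH ?mulr0// => Hlj; apply: Hl.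
  by rewrite (_ : l = j + (l - j)); [exact: HD|rewrite addrC subrK].
by rewrite (@eq_csum _ _ _ _ (fun=> 0)) ?csum0// => m; rewrite pw// mulr0.
Qed.

End Exponential.

End FunctionalCalculus.

(** * The symbol and its Wiener-Hopf factor *)

Section Symbol.
Context {R : realType} {n : nat}.
Notation d := n.+1.

Lemma monom_torus_pt (t : 'rV[R]_d) (k : 'rV[int]_d) :
  monom (torus_pt t) k = cexp (0 +i* (2 * pi * \sum_i (k 0 i)%:~R * t 0 i))%C.
Proof.
rewrite /monom; transitivity (\prod_i cexp ((k 0 i)%:~R * (0 +i* (2 * pi * t 0 i))%C)).
  by apply: eq_bigr => i _; rewrite mxE cexpMz.
rewrite -(big_morph (@cexp R) (@cexpD R) (@cexp0 R)); congr cexp.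
have im (x y : R) : (0 +i* (x + y))%C = (0 +i* x)%C + (0 +i* y)%C.
  by apply: complex_eqP; rewrite ?cReD ?cImD/= ?addr0.
rewrite mulr_sumr (big_morph (fun x : R => (0 +i* x)%C) im (erefl _)).
apply: eq_bigr => i _; rewrite -(rmorph_int (real_complex R)).
by apply: complex_eqP; rewrite ?cReM ?cImM/=; ring.
Qed.

Lemma continuous_monom (x : R) (k : 'rV[int]_d) :
  continuous (fun t : 'rV[R]_d => Re (x%:C%C * monom (torus_pt t) k)).
Proof.
have -> : (fun t : 'rV[R]_d => Re (x%:C%C * monom (torus_pt t) k)) =
    (fun t => x * cos (2 * pi * \sum_i (k 0 i)%:~R * t 0 i)).
  apply/funext => t; rewrite monom_torus_pt cReM /= expR0; ring.
have cs : continuous (fun t : 'rV[R]_d => \sum_i (k 0 i)%:~R * t 0 i).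
  apply: continuous_sum => i t.
  apply: (@continuous_comp _ _ _ (fun t : 'rV[R]_d => t 0 i) ( *%R (k 0 i)%:~R)).
    exact: coord_continuous.
  exact: mulrl_continuous.
pose lin (t : 'rV[R]_d) := \sum_i (k 0 i)%:~R * t 0 i.
move=> t.
apply: (@continuous_comp _ _ _ (fun t => cos (2 * pi * lin t)) ( *%R x)); last first.
  exact: mulrl_continuous.
apply: (@continuous_comp _ _ _ (fun t => 2 * pi * lin t) cos); last exact: continuous_cos.
apply: (@continuous_comp _ _ _ lin ( *%R (2 * pi))); first exact: cs.
exact: mulrl_continuous.
Qed.

Lemma cube_compact : compact (@cube R d).
Proof.
have := @rV_compact R d (fun=> `[0, 1]%classic) (fun=> @segment_compact R 0 1).
congr compact; apply/seteqP; split => t /= ht i; have := ht i; by rewrite /= in_itv.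
Qed.

Variables (alpha : R) (phi : 'rV[R]_d -> R) (C0 : R).
Hypothesis da : d%:R < alpha.
Hypothesis phi_le : forall x, `|phi x| <= C0 * weight alpha x.
Hypothesis symbol_gt0 : forall z : 'rV[R[i]]_d, torus z -> 0 < cardinal_symbol phi z.

Lemma phi_decay (k : 'rV[int]_d) : cmod (phi (lat k))%:C%C <= C0 * weight alpha (lat k).
Proof. by rewrite cmodR; exact: phi_le. Qed.

Lemma csummable_phi : csummable (fun k : 'rV[int]_d => (phi (lat k))%:C%C).
Proof. exact: (csummable_weight da phi_decay). Qed.

Lemma symbol_has_coef :
  has_coef (cardinal_symbol phi) (fun k : 'rV[int]_d => (phi (lat k))%:C%C).
Proof. by split; first exact: csummable_phi. Qed.

(** The series converges uniformly, so its real part is continuous and attains a positive minimum on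
    the compact cube. *)
Lemma symbol_min : exists2 mu, 0 < mu &
  forall t, cube t -> mu <= Re (cardinal_symbol phi (torus_pt t)).
Proof.
pose h (t : 'rV[R]_d) := Re (cardinal_symbol phi (torus_pt t)).
have h0 t : 0 < h t.
  by have := symbol_gt0 (torus_torus_pt t); rewrite ltcE => /andP[].
have ch : continuous h.
  apply: (@continuous_Re_csum _ _ _ (fun t k => (phi (lat k))%:C%C * monom (torus_pt t) k) _ csummable_phi).
    by move=> t k; rewrite cmodM (cmod_monom k (torus_torus_pt t)) mulr1.
  by move=> k; exact: continuous_monom.
have c0 : cube (0 : 'rV[R]_d) by move=> i; rewrite mxE lexx ler01.
have [c _ hc] := compact_EVT_min (ex_intro _ _ c0) cube_compact (continuous_subspaceT ch).
exists (h c); first exact: h0.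
by move=> t ct; exact: (hc t (mem_set ct)).
Qed.

Lemma log_coef_decay : exists B, forall k : 'rV[int]_d,
  cmod (log_coef phi k) <= B * weight alpha (lat k).
Proof.
have [mu mu0 hmu] := symbol_min.
have hs := symbol_has_coef.
have sd : decay alpha (cardinal_symbol phi) C0.
  by move=> k; rewrite (has_coef_fourier hs); exact: phi_decay.
(* The Wiener norm of the symbol, used as an upper bound for its values. *)
pose M := fine (nsum (fun k : 'rV[int]_d => cmod (phi (lat k))%:C%C)).
have [|B wB hB] := @ln_decay R n alpha da _ _ mu M (fun t => Re (cardinal_symbol phi (torus_pt t)))
  (has_coef_wiener hs) sd mu0; last by exists B.
move=> t ct; have tt := torus_torus_pt t; split.
  (* In the order of [R[i]], being positive includes being real. *)
  have := symbol_gt0 tt; rewrite ltcE => /andP[/eqP im0 _].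
  by apply: complex_eqP => //=.
apply/andP; split; [exact: hmu|].
apply: le_trans (ler_norm _) _; apply: le_trans (ler_Re_cmod _) _.
apply: cmod_csum_le; first exact: csummable_phi.
by move=> k; rewrite cmodM (cmod_monom k tt) mulr1.
Qed.

End Symbol.

Section HalfLattice.
Context {n : nat}.
Implicit Types H : half_space n.

Lemma half_lattice0 H : half_lattice H 0.
Proof.
case: H => [|le]; last exact: (ole_refl le).
by rewrite /half_lattice /slice_lattice /= mxE.
Qed.

Lemma half_latticeD H k l : half_lattice H k -> half_lattice H l -> half_lattice H (k + l).
Proof.
case: H => [|le] /=; rewrite /slice_lattice /=; first by rewrite mxE; exact: addr_ge0.
move=> k0 l0; apply: (ole_trans l0).
by have := ole_add l k0; rewrite add0r.
Qed.

End HalfLattice.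

(** * The Wiener-Hopf factor and the semi-cardinal coefficients *)

Section WienerHopf.
Context {R : realType} {n : nat}.
Notation d := n.+1.
Variables (alpha : R) (phi : 'rV[R]_d -> R) (B : R).
Hypothesis da : d%:R < alpha.
Hypothesis log_le : forall k : 'rV[int]_d, cmod (log_coef phi k) <= B * weight alpha (lat k).
Implicit Types H : half_space n.

Let lam (k : 'rV[int]_d) : R[i] := log_coef phi k.

Let slam : csummable lam.
Proof. exact: (csummable_weight da log_le). Qed.

(** [Lambda_plus] as one Fourier series over the whole lattice, with the halved boundary terms and
    the cut-off put into the coefficients. *)
Definition lambda_coef H (k : 'rV[int]_d) : R[i] :=
  match H with
  | SliceHalf => if k 0 ord_max == 0 then 2^-1 * log_coef phi k
                 else if 0 < k 0 ord_max then log_coef phi k else 0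
  | OrderHalf le => if k == 0 then 2^-1 * log_coef phi k
                    else if le 0 k then log_coef phi k else 0
  end.

Lemma lambda_coef_support H k : ~ half_lattice H k -> lambda_coef H k = 0.
Proof.
case: H => [|le] /=.
  move=> /negP; rewrite -ltNge => k0; rewrite lt_eqF//.
  by rewrite ltNge (ltW k0).
move=> /negP/negbTE k0; rewrite k0; case: eqP => // kE; move: k0.
by rewrite kE ole_refl.
Qed.

Lemma cmod_half_le (z : R[i]) : cmod (2^-1 * z) <= cmod z.
Proof.
rewrite cmodM ler_piMl ?cmod_ge0// cmodV.
have -> : (2 : R[i]) = (2 : R)%:C%C by rewrite rmorph_nat.
by rewrite cmodR ger0_norm// invf_le1// ler1n.
Qed.

Lemma cmod_lambda_coef H k : cmod (lambda_coef H k) <= cmod (log_coef phi k).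
Proof.
by case: H => [|le] /=; do 2?case: ifP => _; rewrite ?cmod_half_le ?cmod0 ?cmod_ge0.
Qed.

Lemma csummable_lambda_coef H : csummable (lambda_coef H).
Proof. by apply: le_nsum_fin slam => k; exact: cmod_lambda_coef. Qed.

Lemma csummable_if (T : choiceType) (P : pred T) (f : T -> R[i]) :
  csummable f -> csummable (fun k => if P k then f k else 0).
Proof. by apply: le_nsum_fin => k; case: ifP; rewrite ?cmod0 ?cmod_ge0. Qed.

Lemma Lambda_plusE H z : torus z -> Lambda_plus H phi z = fser (lambda_coef H) z.
Proof.
move=> tz; have st := csummable_fser slam tz.
case: H => [|le] /=.
  rewrite csum_mkcond [X in _ + X]csum_mkcond.
  set P0 := [set k : 'rV[int]_d | k 0 ord_max = 0].
  set P1 := [set k : 'rV[int]_d | 0 < k 0 ord_max].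
  have s0 := csummable_if (fun k => k \in P0) st; have s1 := csummable_if (fun k => k \in P1) st.
  rewrite -(csumZ _ s0) -(csumD (csummableZ _ s0) s1); apply: eq_csum => k /=.
  have -> : (k \in P0) = (k 0 ord_max == 0) by apply/idP/eqP; rewrite inE.
  have -> : (k \in P1) = (0 < k 0 ord_max) by apply/idP/idP; rewrite inE.
  case: eqP => [->|_]; first by rewrite ltxx addr0 mulrA.
  by case: ifP; rewrite mulr0 add0r// mul0r.
rewrite csum_mkcond; set P := [set k : 'rV[int]_d | le 0 k /\ k <> 0].
have s1 := csummable_if (fun k => k \in P) st.
have d0 (k : 'rV[int]_d) : k \notin [:: 0] -> (if k == 0 then 2^-1 * lam 0 else 0) = 0.
  by rewrite mem_seq1 => /negbTE ->.
have -> : 2^-1 * log_coef phi 0 = csum setT (fun k : 'rV[int]_d => if k == 0 then 2^-1 * lam 0 else 0).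
  by rewrite (@csum_seq _ _ [:: 0] _ isT d0) big_seq1 eqxx.
rewrite -(csumD (@csummable_seq _ _ [:: 0] _ isT d0) s1); apply: eq_csum => k /=.
have -> : (k \in P) = (le 0 k && (k != 0)).
  by apply/idP/andP; rewrite inE /P /= => -[h1 /eqP h2].
have [->|k0] := eqVneq k 0; first by rewrite andbF addr0 monom0 mulr1.
by rewrite andbT add0r; case: ifP; rewrite ?mul0r.
Qed.

Lemma Lambda_has_coef H : has_coef (Lambda_plus H phi) (lambda_coef H).
Proof.
split; first exact: csummable_lambda_coef.
by move=> t _; apply: Lambda_plusE; exact: torus_torus_pt.
Qed.

Lemma Lambda_decay H : decay alpha (Lambda_plus H phi) B.
Proof.
move=> k; rewrite (has_coef_fourier (Lambda_has_coef H)).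
by apply: le_trans (log_le k); exact: cmod_lambda_coef.
Qed.

Let wLambda H : wiener (Lambda_plus H phi) := has_coef_wiener (Lambda_has_coef H).

Lemma omega_plus_wiener H : wiener (omega_plus H phi).
Proof. exact: (exp_wiener da (wLambda H) (Lambda_decay H)). Qed.

Lemma wh_coef_decay H k :
  cmod (wh_coef H phi k) <= @exp_bound R n alpha B * weight alpha (lat k).
Proof. exact: (exp_decay da (wLambda H) (Lambda_decay H)). Qed.

Lemma wh_coef_support H k : ~ half_lattice H k -> wh_coef H phi k = 0.
Proof.
apply: (exp_support da (wLambda H) (Lambda_decay H)).
- exact: half_lattice0.
- exact: half_latticeD.
- move=> l Hl; rewrite (has_coef_fourier (Lambda_has_coef H)).
  exact: lambda_coef_support.
Qed.

Lemma csummable_wh_coef H : csummable (wh_coef H phi).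
Proof. exact: (wiener_csumm (omega_plus_wiener H)). Qed.

Lemma omega_plusE H t : cube t ->
  omega_plus H phi (torus_pt t) = fser (wh_coef H phi) (torus_pt t).
Proof. by move=> ct; have [_ ->] := wienerP (omega_plus_wiener H). Qed.

(* Periodicity moves the point with parameter [- t] back into the cube. *)
Lemma inv_torus_pt (t : 'rV[R]_d) : inv_pt (torus_pt t) = torus_pt (const_mx 1 - t).
Proof.
apply/rowP => i; rewrite !mxE -cexpN; apply: complex_eqP; rewrite /= ?oppr0 ?expR0 !mul1r.
  by rewrite mulrBr mulr1 [2 * pi]mulr_natl addrC cosD2pi.
by rewrite mulrBr mulr1 [2 * pi]mulr_natl addrC sinD2pi.
Qed.

Lemma cube_flip (t : 'rV[R]_d) : cube t -> cube (const_mx 1 - t).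
Proof. by move=> ct i; rewrite !mxE; have /andP[] := ct i; lra. Qed.

(** From zeta^j omega_+(zeta^-1) = sum of gamma_m zeta^(j - m), with m = j - k. *)
Lemma flipped_has_coef H j :
  has_coef (fun w => monom w j * omega_plus H phi (inv_pt w)) (fun k => wh_coef H phi (j - k)).
Proof.
have bj := csub_bij j.
have sj : csummable (fun k => wh_coef H phi (j - k)).
  exact: (csummable_reindex bj (csummable_wh_coef H)).
split=> // t ct; have tt := torus_torus_pt t; have ti := torus_inv_pt tt.
rewrite inv_torus_pt (omega_plusE H (cube_flip ct)) -inv_torus_pt.
rewrite /fser -csumZ; last exact: (csummable_fser (csummable_wh_coef H) ti).
rewrite -(csum_reindex _ bj); apply: eq_csum => k.
rewrite monom_inv_pt mulrCA -monomD//; congr (_ * monom _ _).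
by rewrite opprB addrC subrK.
Qed.

(** Since [P_plus] only drops terms from a sum of moduli, [l] may run over the whole lattice. *)
Lemma semi_coef_le H k j :
  ((cmod (semi_coef H phi k j))%:E <=
   nsum (fun l => cmod (wh_coef H phi (k - l)) * cmod (wh_coef H phi (j - l)))%R)%E.
Proof.
pose b (k : 'rV[int]_d) := if k \in half_lattice H then wh_coef H phi (j - k) else 0.
have [sj _] := flipped_has_coef H j.
have sb : csummable b by exact: (csummable_if (fun k => k \in half_lattice H) sj).
have hb : has_coef (P_plus H (fun w => monom w j * omega_plus H phi (inv_pt w))) b.
  split=> // t ct; rewrite /P_plus (has_coef_fourier (flipped_has_coef H j)).
  rewrite csum_mkcond /fser; apply: eq_csum => l; rewrite /b.
  by case: ifP; rewrite ?mul0r.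
have hs : has_coef (semi_symbol H phi j) (convol (wh_coef H phi) b).
  exact: (has_coefM (wienerP (omega_plus_wiener H)) hb).
rewrite /semi_coef (has_coef_fourier hs); apply: le_trans (cmod_csum _) _.
(* The convolution pairs gamma_m with the frequency k - m; the substitution m = k - l gives the form
   symmetric in k and j. *)
rewrite -(@nsum_reindex _ _ _ _ _ (csub_bij k)); apply: le_nsum => l.
have -> : k - (k - l) = l by rewrite opprB addrC subrK.
rewrite cmodM /b; case: ifP => // _.
by rewrite cmod0 mulr0 mulr_ge0 ?cmod_ge0.
Qed.

End WienerHopf.

(** * Decay of the Lagrange functions *)

Section AlgebraicDecay.
Context {R : realType} {n : nat}.
Notation d := n.+1.

Variable alpha : R.
Hypothesis da : d%:R < alpha.

Let alpha0 : 0 < alpha.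
Proof. by apply: lt_trans da; rewrite ltr0n. Qed.

Lemma eucl_norm_ge0 (x : 'rV[R]_d) : 0 <= eucl_norm x.
Proof. exact: sqrtr_ge0. Qed.

Lemma eucl_weight_le (x : 'rV[R]_d) :
  (1 + eucl_norm x) `^ (- alpha) <= d%:R `^ alpha * weight alpha x.
Proof.
have e0 := eucl_norm_ge0 x; have l0 := l1_norm_ge0 x.
have d1 : 1 <= d%:R :> R by rewrite ler1n.
apply: powRN_le; rewrite ?ltr_pwDl ?(ltW alpha0)//.
by rewrite mulrDr mulr1; apply: lerD => //; exact: l1_le_eucl.
Qed.

Lemma weight_le_eucl (x : 'rV[R]_d) : weight alpha x <= (1 + eucl_norm x) `^ (- alpha).
Proof.
have e0 := eucl_norm_ge0 x; have l0 := l1_norm_ge0 x.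
have := @powRN_le R alpha (1 + l1_norm x) (1 + eucl_norm x) 1.
rewrite powR1 !mul1r; apply; rewrite ?ltr_pwDl ?(ltW alpha0)//.
by rewrite lerD2l; exact: eucl_le_l1.
Qed.

Let M : R := (1 + d%:R) `^ alpha * wsum alpha d.

Let M0 : 0 <= M.
Proof. by rewrite mulr_ge0 ?powR_ge0 ?wsum_ge0. Qed.

(** By [weightM_le] the weight of [x - y] factors out, leaving two sums over translated lattices,
    each at most [M]. Used for the coefficients a_{k,j} and again for chi_j. *)
Lemma nsum_weight_product (x y : 'rV[R]_d) :
  (nsum (fun k : 'rV[int]_d => weight alpha (x - lat k) * weight alpha (lat k - y))%R <=
    (wK alpha * weight alpha (x - y) * (M + M))%:E)%E.
Proof.
have wp (z : 'rV[R]_d) : 0 <= weight alpha z by rewrite ltW// weight_gt0.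
have K0 : 0 <= wK alpha * weight alpha (x - y) by rewrite mulr_ge0// wK_ge0.
apply: (@le_trans _ _ (nsum (fun k : 'rV[int]_d => wK alpha * weight alpha (x - y) *
   (weight alpha (x - lat k) + weight alpha (y - lat k)))%R)).
  apply: le_nsum => k; have := weightM_le alpha0 (x - lat k) (lat k - y).
  have -> : x - lat k + (lat k - y) = x - y by rewrite addrA subrK.
  by rewrite -[weight alpha (y - lat k)]weightN opprB.
rewrite (nsumZ K0); last by move=> k; rewrite addr_ge0.
rewrite nsumD// [leRHS]EFinM; apply: lee_wpmul2l; first by rewrite lee_fin.
by rewrite EFinD; apply: leeD; exact: nsum_weight_shift.
Qed.

Variables (phi : 'rV[R]_d -> R) (C0 B : R).
Hypothesis phi_le : forall x, `|phi x| <= C0 * weight alpha x.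
Hypothesis log_le : forall k : 'rV[int]_d, cmod (log_coef phi k) <= B * weight alpha (lat k).

Let Gam := @exp_bound R n alpha B.

Let wp (z : 'rV[R]_d) : 0 <= weight alpha z.
Proof. by rewrite ltW// weight_gt0. Qed.

Let Gam0 : 0 <= Gam.
Proof.
have := wh_coef_decay da log_le SliceHalf 0; rewrite lat0 weight0 mulr1.
by apply: le_trans; exact: cmod_ge0.
Qed.

Let C00 : 0 <= C0.
Proof.
by have := phi_le 0; rewrite weight0 mulr1; apply: le_trans.
Qed.

Lemma semi_coef_decay H k j : cmod (semi_coef H phi k j) <=
  Gam ^+ 2 * (wK alpha * (M + M)) * weight alpha (lat k - lat j).
Proof.
rewrite -lee_fin; apply: le_trans (semi_coef_le da log_le H k j) _.
apply: (@le_trans _ _ (nsum (fun l : 'rV[int]_d => Gam ^+ 2 *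
    (weight alpha (lat k - lat l) * weight alpha (lat l - lat j)))%R)).
  apply: le_nsum => l.
  apply: le_trans (ler_pM (cmod_ge0 _) (cmod_ge0 _)
    (wh_coef_decay da log_le H (k - l)) (wh_coef_decay da log_le H (j - l))) _.
  rewrite !latD !latN -[weight alpha (lat l - lat j)]weightN opprB -/Gam.
  by rewrite mulrACA -expr2.
rewrite (nsumZ (exprn_ge0 2 Gam0)); last by move=> l; rewrite mulr_ge0.
apply: le_trans (lee_wpmul2l _ (nsum_weight_product _ _)) _; first by rewrite lee_fin exprn_ge0.
by rewrite -EFinM lee_fin (mulrAC (wK alpha)) [leLHS]mulrA.
Qed.

Lemma chi_le_nsum H j x : ((cmod (chi H phi j x))%:E <=
  nsum (fun k => cmod (semi_coef H phi k j) * `|phi (x - lat k)|)%R)%E.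
Proof.
rewrite /chi csum_mkcond; apply: le_trans (cmod_csum _) _; apply: le_nsum => k.
case: ifP => _; first by rewrite cmodM cmodR.
by rewrite cmod0 mulr_ge0 ?cmod_ge0.
Qed.

(** The constant precedes H because [Gam] and [M] are free of it. *)
Lemma chi_decay : exists C, forall H x j,
  cmod (chi H phi j x) <= C * (1 + eucl_norm (x - lat j)) `^ (- alpha).
Proof.
pose A := Gam ^+ 2 * (wK alpha * (M + M)).
have A0 : 0 <= A by rewrite !mulr_ge0 ?exprn_ge0 ?wK_ge0 ?addr_ge0.
have AC0 : 0 <= A * C0 by rewrite mulr_ge0.
exists (A * C0 * (wK alpha * (M + M))) => H x j.
apply: (@le_trans _ _ (A * C0 * (wK alpha * (M + M)) * weight alpha (x - lat j))); last first.
  by rewrite ler_wpM2l ?weight_le_eucl// mulr_ge0// mulr_ge0 ?wK_ge0 ?addr_ge0.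
rewrite -lee_fin; apply: le_trans (chi_le_nsum H j x) _.
apply: (@le_trans _ _ (nsum (fun k : 'rV[int]_d => A * C0 *
    (weight alpha (x - lat k) * weight alpha (lat k - lat j)))%R)).
  apply: le_nsum => k.
  apply: le_trans (ler_pM (cmod_ge0 _) (normr_ge0 _)
    (semi_coef_decay H k j) (phi_le (x - lat k))) _.
  by rewrite -/A mulrACA (mulrC (weight alpha (x - lat k))).
rewrite (nsumZ AC0); last by move=> l; rewrite mulr_ge0.
apply: le_trans (lee_wpmul2l _ (nsum_weight_product _ _)) _; first by rewrite lee_fin.
by rewrite -EFinM lee_fin (mulrAC (wK alpha)) [leLHS]mulrA.
Qed.

End AlgebraicDecay.

(** * Exponential decay *)

Section ExponentialDecay.
Context {R : realType} {n : nat}.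
Notation d := n.+1.

(** The exponent [n.+2] exceeds the dimension by one, which makes the weight summable. With m = n+2,
    exp(dl y) is the m-th power of exp(dl y / m) >= 1 + dl y / m >= c (1 + y). *)
Lemma expR_le_weight (dl : R) : 0 < dl -> exists2 C : R, 0 <= C &
  forall x : 'rV[R]_d, expR (- dl * l1_norm x) <= C * weight n.+2%:R x.
Proof.
move=> dl0; pose c := Num.min 1 (dl / n.+2%:R).
have c0 : 0 < c by rewrite lt_min ltr01 divr_gt0// ltr0n.
exists (c ^+ n.+2)^-1; first by rewrite invr_ge0 exprn_ge0// ltW.
move=> x; have y0 := l1_norm_ge0 x; set y := l1_norm x in y0 *.
have y10 : 0 < 1 + y by rewrite ltr_pwDl.
rewrite /weight -/y powRN powR_mulrn ?(ltW y10)// -invfM -exprMn mulNr expRN.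
rewrite lef_pV2 ?posrE ?expR_gt0 ?exprn_gt0 ?mulr_gt0//.
have -> : dl * y = n.+2%:R * (dl / n.+2%:R * y).
  by rewrite mulrA [_ * (dl / _)]mulrC divfK// pnatr_eq0.
rewrite expRM_natl; apply: lerXn2r; rewrite ?nnegrE ?expR_ge0 ?mulr_ge0 ?(ltW c0) ?(ltW y10)//.
apply: le_trans (expR_ge1Dx _); rewrite mulrDr mulr1; apply: lerD.
  by rewrite ge_min lexx.
by rewrite ler_wpM2r// ge_min lexx orbT.
Qed.

Lemma nsum_expR (dl : R) : 0 < dl -> exists2 E : R, 0 <= E &
  forall x : 'rV[R]_d,
   (nsum (fun k : 'rV[int]_d => expR (- dl * l1_norm (x - lat k)))%R <= E%:E)%E.
Proof.
move=> dl0; have [C C0 hC] := expR_le_weight dl0.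
have dn : d%:R < n.+2%:R :> R by rewrite ltr_nat.
exists (C * ((1 + d%:R) `^ n.+2%:R * wsum n.+2%:R d)).
  by rewrite !mulr_ge0 ?powR_ge0 ?wsum_ge0.
move=> x; apply: le_trans (le_nsum (fun k => hC (x - lat k))) _.
rewrite nsumZ//; last by move=> k; rewrite ltW// weight_gt0// ltr0n.
by rewrite EFinM; apply: lee_wpmul2l; [rewrite lee_fin|exact: nsum_weight_shift].
Qed.

(** [N] is the exponent to be proved, so that the isotropic and the anisotropic estimates share one
    argument. [B] and [alpha1] provide the Fourier expansions and the support of gamma; the
    exponential rates come from [phi_le] and [wh_le]. *)
Variables (phi : 'rV[R]_d -> R) (H : half_space n) (alpha beta dl C0 C1 B alpha1 : R).
Variable (N : 'rV[R]_d -> R) (c : 'rV[int]_d -> 'rV[int]_d -> 'rV[int]_d).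
Hypothesis da1 : d%:R < alpha1.
Hypothesis log_le : forall k : 'rV[int]_d, cmod (log_coef phi k) <= B * weight alpha1 (lat k).
Hypothesis phi_le : forall x, `|phi x| <= C0 * expR (- alpha * l1_norm x).
Hypothesis wh_le : forall k, cmod (wh_coef H phi k) <= C1 * expR (- beta * l1_norm (lat k)).
Hypothesis dl0 : 0 < dl.
Hypothesis beta_alpha : beta < alpha.
Hypothesis ND : forall x y, N (x + y) <= N x + N y.
Hypothesis N_le : forall x, N x <= beta * l1_norm x.
(* A common translate [c k j] of the exponential weight absorbs the sum over [l]. *)
Hypothesis N_split : forall k j l, half_lattice H (k - l) -> half_lattice H (j - l) ->
  N (lat k - lat j) + dl * l1_norm (lat (c k j) - lat l) <=
  beta * l1_norm (lat (k - l) : 'rV[R]_d) + beta * l1_norm (lat (j - l) : 'rV[R]_d).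

Let C00 : 0 <= C0.
Proof.
by have := phi_le 0; rewrite l1_norm0 mulr0 expR0 mulr1; apply: le_trans.
Qed.

Let C10 : 0 <= C1.
Proof.
have := wh_le 0; rewrite lat0 l1_norm0 mulr0 expR0 mulr1.
by apply: le_trans; exact: cmod_ge0.
Qed.

Lemma semi_coef_exp_decay : exists2 A : R, 0 <= A & forall k j,
  cmod (semi_coef H phi k j) <= A * expR (- N (lat k - lat j)).
Proof.
have [E E0 hE] := nsum_expR dl0.
exists (C1 ^+ 2 * E) => [|k j]; first by rewrite mulr_ge0 ?exprn_ge0.
rewrite -lee_fin; apply: le_trans (semi_coef_le da1 log_le H k j) _.
apply: (@le_trans _ _ (nsum (fun l : 'rV[int]_d => C1 ^+ 2 * expR (- N (lat k - lat j)) *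
    expR (- dl * l1_norm (lat (c k j) - lat l)))%R)).
  apply: le_nsum => l.
  (* Terms with k - l or j - l outside H vanish, which is why [N_split] may assume both
     memberships. *)
  have [Hk|Hk] := pselect (half_lattice H (k - l)); last first.
    by rewrite (wh_coef_support da1 log_le Hk) cmod0 mul0r !mulr_ge0 ?exprn_ge0 ?expR_ge0.
  have [Hj|Hj] := pselect (half_lattice H (j - l)); last first.
    by rewrite (wh_coef_support da1 log_le Hj) cmod0 mulr0 !mulr_ge0 ?exprn_ge0 ?expR_ge0.
  apply: le_trans (ler_pM (cmod_ge0 _) (cmod_ge0 _) (wh_le (k - l)) (wh_le (j - l))) _.
  rewrite mulrACA -expr2 -mulrA ler_wpM2l ?exprn_ge0// -!expRD ler_expR.
  by have := N_split Hk Hj; lra.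
rewrite nsumZ; last 2 first.
- by rewrite mulr_ge0 ?exprn_ge0 ?expR_ge0.
- by move=> l; exact: expR_ge0.
apply: le_trans (lee_wpmul2l _ (hE _)) _; first by rewrite lee_fin mulr_ge0 ?exprn_ge0 ?expR_ge0.
by rewrite -EFinM lee_fin mulrAC.
Qed.

(** Passing from k - j to x - j costs at most the rate beta in x - k. As phi decays at the rate
    alpha, the surplus alpha - beta bounds the sum over k uniformly in x. *)
Lemma chi_exp_decay : exists C, forall x j,
  cmod (chi H phi j x) <= C * expR (- N (x - lat j)).
Proof.
have [A A0 hA] := semi_coef_exp_decay.
have ab0 : 0 < alpha - beta by rewrite subr_gt0.
have [E E0 hE] := nsum_expR ab0.
exists (A * C0 * E) => x j.
rewrite -lee_fin; apply: le_trans (chi_le_nsum phi H j x) _.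
apply: (@le_trans _ _ (nsum (fun k : 'rV[int]_d => A * C0 * expR (- N (x - lat j)) *
    expR (- (alpha - beta) * l1_norm (x - lat k)))%R)).
  apply: le_nsum => k.
  apply: le_trans (ler_pM (cmod_ge0 _) (normr_ge0 _) (hA k j) (phi_le (x - lat k))) _.
  rewrite mulrACA -[leRHS]mulrA ler_wpM2l ?mulr_ge0// -!expRD ler_expR.
  have := ND (x - lat k) (lat k - lat j); rewrite addrA subrK.
  by have := N_le (x - lat k); lra.
rewrite nsumZ; last 2 first.
- by rewrite !mulr_ge0 ?expR_ge0.
- by move=> l; exact: expR_ge0.
apply: le_trans (lee_wpmul2l _ (hE _)) _; first by rewrite lee_fin !mulr_ge0 ?expR_ge0.
by rewrite -EFinM lee_fin mulrAC.
Qed.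

End ExponentialDecay.

Theorem theorem3p9 (R : realType) (n : nat) (phi : 'rV[R]_n.+1 -> R)
    (phi_cont : continuous phi)
    (phi_sym : forall x : 'rV[R]_n.+1, phi (- x) = phi x)
    (phi_norm : (cube_norm phi < +oo)%E)
    (symbol_gt0 : forall z : 'rV[R[i]]_n.+1, torus z -> 0 < cardinal_symbol phi z) :
  (forall alpha : R, n.+1%:R < alpha ->
    (exists2 C0 : R, 0 < C0 &
      forall x : 'rV[R]_n.+1, `|phi x| <= C0 * (1 + eucl_norm x) `^ (- alpha)) ->
    exists C3 : R, forall (H : half_space n) (x : 'rV[R]_n.+1) (j : 'rV[int]_n.+1),
      half_lattice H j ->
      cmod (chi H phi j x)
        <= C3 * (1 + eucl_norm (x - lat j)) `^ (- alpha))
  /\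
  (forall (H : half_space n) (alpha beta : R), 0 < alpha ->
    (exists2 C0 : R, 0 < C0 &
      forall x : 'rV[R]_n.+1, `|phi x| <= C0 * expR (- alpha * l1_norm x)) ->
    0 < beta < alpha ->
    (exists C1 : R, forall k : 'rV[int]_n.+1, half_lattice H k ->
      cmod (wh_coef H phi k) <= C1 * expR (- beta * l1_norm (lat k))) ->
    forall beta' : R, 0 < beta' < beta ->
      (exists C3 : R, forall (x : 'rV[R]_n.+1) (j : 'rV[int]_n.+1),
        half_lattice H j ->
        cmod (chi H phi j x) <= C3 * expR (- beta' * l1_norm (x - lat j)))
      /\
      (half_lattice H = @slice_lattice n ->
       exists C3 : R, forall (x : 'rV[R]_n.+1) (j : 'rV[int]_n.+1),
        half_lattice H j ->
        cmod (chi H phi j x)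
          <= C3 * expR (- beta' * l1_norm_init (x - lat j)
                        - beta * `|(x - lat j) 0 ord_max|))).
Proof.
split=> [alpha da [C0 C0_gt0 phi_le]|H alpha beta alpha0 [C0 C0_gt0 phi_le] /andP[beta0 beta_alpha]
    [C1 wh_le] beta' /andP[b'0 b'b]].
  have phi_weight x : `|phi x| <= C0 * n.+1%:R `^ alpha * weight alpha x.
    by rewrite -mulrA; apply: le_trans (phi_le x) _; rewrite ler_wpM2l ?(ltW C0_gt0)// (eucl_weight_le da).
  have [B hB] := log_coef_decay da phi_weight symbol_gt0.
  have [C hC] := chi_decay da phi_weight hB.
  by exists C => H x j _; exact: hC.
have dn : n.+1%:R < n.+2%:R :> R by rewrite ltr_nat.
(* The exponential bound on phi is weakened to a summable polynomial one, which is what the estimate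
   of log omega takes as input. *)
have [C _ hC] := @expR_le_weight R n alpha alpha0.
have C0_ge0 : 0 <= C0 by exact: ltW.
have phi_weight x : `|phi x| <= C0 * C * weight n.+2%:R x.
  by rewrite -mulrA; apply: le_trans (phi_le x) _; rewrite ler_wpM2l.
have [B hB] := log_coef_decay dn phi_weight symbol_gt0.
have C1_ge0 : 0 <= C1.
  have := wh_le 0 (half_lattice0 H); rewrite lat0 l1_norm0 mulr0 expR0 mulr1.
  by apply: le_trans; exact: cmod_ge0.
(* gamma vanishes off H, so its bound extends to the whole lattice. *)
have wh_all k : cmod (wh_coef H phi k) <= C1 * expR (- beta * l1_norm (lat k)).
  have [Hk|Hk] := pselect (half_lattice H k); first exact: wh_le.
  by rewrite (wh_coef_support dn hB Hk) cmod0 mulr_ge0// expR_ge0.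
have dl0 : 0 < beta - beta' by rewrite subr_gt0.
have l1_init (x : 'rV[R]_n.+1) : l1_norm x = l1_norm_init x + `|x 0 ord_max|.
  by rewrite /l1_norm /l1_norm_init (bigD1 ord_max)//= addrC.
have init_ge0 (x : 'rV[R]_n.+1) : 0 <= l1_norm_init x by exact: sumr_ge0.
have initD (x y : 'rV[R]_n.+1) : l1_norm_init (x + y) <= l1_norm_init x + l1_norm_init y.
  by rewrite /l1_norm_init -big_split; apply: ler_sum => i _; rewrite mxE ler_normD.
have initN (x : 'rV[R]_n.+1) : l1_norm_init (- x) = l1_norm_init x.
  by apply: eq_bigr => i _; rewrite mxE normrN.
split.
  pose N (x : 'rV[R]_n.+1) := beta' * l1_norm x.
  (* The translate is centred at k: splitting |k - j| spends beta' on |k - l| and on |j - l|, and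
     the rate left on |k - l| is beta - beta'. *)
  have [|x|k j l _ _|C3 h3] := @chi_exp_decay R n phi H alpha beta (beta - beta') C0 C1 B _ N
    (fun k _ => k) dn hB phi_le wh_all dl0 beta_alpha.
  - by move=> x y; rewrite /N -mulrDr ler_wpM2l ?l1_normD// ltW.
  - by rewrite /N ler_wpM2r ?l1_norm_ge0// ltW.
  - rewrite /N !latD !latN; set a := lat k - lat l; set b := lat j - lat l.
    have -> : lat k - lat j = a - b :> 'rV[R]_n.+1 by rewrite /a /b opprB addrA subrK.
    have h : l1_norm (a - b) <= l1_norm a + l1_norm b.
      by apply: le_trans (l1_normD _ _) _; rewrite l1_normN.
    have := ler_wpM2l (ltW b'0) h.
    have := mulr_ge0 (ltW dl0) (l1_norm_ge0 b).
    lra.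
  - by exists C3 => x j _; apply: le_trans (h3 x j) _; rewrite /N mulNr.
move=> HE.
pose N (x : 'rV[R]_n.+1) := beta' * l1_norm_init x + beta * `|x 0 ord_max|.
(* In the last coordinate, l_d <= min(k_d, j_d) gives (k_d - l_d) + (j_d - l_d) = |k_d - j_d| + 2
   (min(k_d, j_d) - l_d). The full rate beta thus survives on |k_d - j_d|, and the rest pays for the
   sum over l_d when the centre is the minimum. The other coordinates are centred at k as before. *)
pose c (k j : 'rV[int]_n.+1) : 'rV[int]_n.+1 :=
  \row_i if i == ord_max then Num.min (k 0 i) (j 0 i) else k 0 i.
have [|x|k j l|C3 h3] := @chi_exp_decay R n phi H alpha beta (beta - beta') C0 C1 B _ N
  c dn hB phi_le wh_all dl0 beta_alpha.
- move=> x y; have := ler_wpM2l (ltW b'0) (initD x y).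
  have := ler_wpM2l (ltW beta0) (ler_normD (x 0 ord_max) (y 0 ord_max)).
  by rewrite /N mxE; lra.
- rewrite /N l1_init mulrDr lerD2r ler_wpM2r// ltW//.
- rewrite HE /slice_lattice /= !mxE !subr_ge0 => lk lj.
  pose p : R := (k 0 ord_max)%:~R.
  pose q : R := (j 0 ord_max)%:~R.
  pose r : R := (l 0 ord_max)%:~R.
  have Elast : (lat (c k j) - lat l : 'rV[R]_n.+1) 0 ord_max = Num.min p q - r.
    have minz (y z : int) : (Num.min y z)%:~R = Num.min y%:~R z%:~R :> R.
      case: (leP y z) => yz; first by rewrite min_l// ler_int.
      by rewrite min_r// ler_int ltW.
    by rewrite !mxE eqxx minz.
  have rp : r <= p by rewrite ler_int.
  have rq : r <= q by rewrite ler_int.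
  have Einit : l1_norm_init (lat (c k j) - lat l : 'rV[R]_n.+1) = l1_norm_init (lat k - lat l : 'rV[R]_n.+1).
    by apply: eq_bigr => i /negbTE iN; rewrite !mxE iN.
  rewrite /N !l1_init Einit Elast !latD !latN.
  set a := lat k - lat l; set b := lat j - lat l.
  have -> : lat k - lat j = a - b :> 'rV[R]_n.+1 by rewrite /a /b opprB addrA subrK.
  have h : l1_norm_init (a - b) <= l1_norm_init a + l1_norm_init b.
    by apply: le_trans (initD _ _) _; rewrite initN.
  have := ler_wpM2l (ltW b'0) h.
  have := mulr_ge0 (ltW dl0) (init_ge0 b).
  have -> : (a - b) 0 ord_max = p - q by rewrite /a /b !mxE opprB addrA subrK.
  have -> : a 0 ord_max = p - r by rewrite /a !mxE.
  have -> : b 0 ord_max = q - r by rewrite /b !mxE.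
  rewrite (ger0_norm (_ : 0 <= p - r)) ?subr_ge0//.
  rewrite (ger0_norm (_ : 0 <= q - r)) ?subr_ge0//.
  rewrite (ger0_norm (_ : 0 <= Num.min p q - r)); last by rewrite subr_ge0 le_min rp.
  have h1 : 0 <= beta * (p - r) by rewrite mulr_ge0 ?subr_ge0// ltW.
  have h2 : 0 <= beta * (q - r) by rewrite mulr_ge0 ?subr_ge0// ltW.
  have h3 : 0 <= beta' * (p - r) by rewrite mulr_ge0 ?subr_ge0// ltW.
  have h4 : 0 <= beta' * (q - r) by rewrite mulr_ge0 ?subr_ge0// ltW.
  rewrite /Num.min; case: ltP => pq.
    by rewrite ltr0_norm ?subr_lt0//; lra.
  by rewrite ger0_norm ?subr_ge0//; lra.
- by exists C3 => x j _; apply: le_trans (h3 x j) _; rewrite /N opprD !mulNr.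
Qed.
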